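(* Let $4\le p<6$, $k>0$, $\theta>0$ and $\lambda>0$, and let $u_0\in\mathcal{S}_\lambda$ be a positive minimizer, where $\mathcal{S}_\lambda=\{u\in\mathcal{M}: I(u)=m\}$. Then for any $\varepsilon>0$ there exists $\delta>0$ such that, if $z_0\in H^1(\mathbb{R})$ is an initial datum satisfying assumption (A) stated in the context and $$\inf_{\eta,\xi\in\mathbb{R}}\|z_0-e^{i\eta}u_0(\cdot+\xi)\|<\delta,$$ then the solution $z(x,t)$ of $$i\partial_t z=-z''-k(|z|^2)''z-\theta|z|^{p-2}z,\qquad x\in\mathbb{R},$$ with initial value $z(x,0)=z_0$ satisfies $$\inf_{\eta,\xi\in\mathbb{R}}\|z(\cdot,t)-e^{i\eta}u_0(\cdot+\xi)\|<\varepsilon\quad\text{for any } t\in[0,T^* ).$$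
   Context: Functions are complex-valued on $\mathbb{R}$; $'$ and $''$ denote spatial derivatives. $H^1(\mathbb{R})$ carries the norm $\|u\|^2=\int_{\mathbb{R}}[|u'|^2+|u|^2]$. Define on $H^1(\mathbb{R})$ $$I(u)=\int_{\mathbb{R}}\Big[\tfrac12|u'|^2+\tfrac k4|(|u|^2)'|^2-\tfrac\theta p|u|^p\Big],$$ $$\mathcal{M}=\Big\{u\in H^1(\mathbb{R}):\ \tfrac12\int_{\mathbb{R}}|u|^2=\lambda\Big\},\qquad m=\inf_{u\in\mathcal{M}}I(u).$$ Assumption (A): for the given $p\ge4$, $k>0$ and $z_0$, the Cauchy problem with $z(x,0)=z_0$ has a solution $z(x,t)$ on $[0,T^* )$, with $T^*<\infty$ or $T^*=\infty$. Solutions satisfy $z(\cdot,t)\in H^1(\mathbb{R})$ and the conservation laws $\int_{\mathbb{R}}|z(\cdot,t)|^2=\int_{\mathbb{R}}|z_0|^2$ and $I(z(\cdot,t))=I(z_0)$ for all $t\in[0,T^* )$. *)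

(* Defs.v *)
From HB Require Import structures.
From mathcomp Require Export all_boot all_order all_algebra.
From mathcomp Require Export all_classical all_reals all_analysis.
From mathcomp Require Export complex.
Export Order.TTheory GRing.Theory Num.Theory.
Export numFieldNormedType.Exports.

Set Implicit Arguments.
Unset Strict Implicit.
Unset Printing Implicit Defensive.

Local Open Scope classical_set_scope.
Local Open Scope ring_scope.
Local Open Scope complex_scope.

(* MathComp-Analysis has no integration theory for complex-valued functions:
   measurability and integrals are taken on real and imaginary parts.
   Elements of L^2 and H^1 are represented by functions, never compared
   pointwise but only through integrals or almost everywhere. *)

Section ComplexFunctions.
Context {R : realType}.
Local Notation mu := (@lebesgue_measure R).
Implicit Types (u v : R -> R[i]) (phi : R -> R).

(* In R[i] the norm `|z| is itself a (real) element of R[i]. *)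
Definition cabs (z : R[i]) : R := complex.Re `|z|.

Definition cis (eta : R) : R[i] := cos eta +i* sin eta.

Definition cintegral (D : set R) u : R[i] :=
  (\int[mu]_(x in D) complex.Re (u x)) +i* (\int[mu]_(x in D) complex.Im (u x)).

Definition cintegrable (D : set R) u : Prop :=
  mu.-integrable D (fun x => (complex.Re (u x))%:E) /\
  mu.-integrable D (fun x => (complex.Im (u x))%:E).

Definition clocally_integrable u : Prop :=
  locally_integrable setT (fun x => complex.Re (u x)) /\
  locally_integrable setT (fun x => complex.Im (u x)).

Definition square_integrable u : Prop :=
  (fun x => complex.Re (u x)) \in Lfun mu 2%:E /\
  (fun x => complex.Im (u x)) \in Lfun mu 2%:E.

(* Real-valued test functions suffice: distributions are complex-linear. *)
Definition test_function phi : Prop :=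
  (forall n x, derivable (derive1n n phi) x 1) /\
  compact (closure [set x | phi x != 0]).

Definition weak_derivative u v : Prop :=
  [/\ clocally_integrable u, clocally_integrable v &
      forall phi, test_function phi ->
        cintegral setT (fun x => u x * (derive1 phi x)%:C) =
        - cintegral setT (fun x => v x * (phi x)%:C)].

(* A weak derivative, unique up to a null set; 0 if there is none. *)
Definition wderiv u : R -> R[i] :=
  xget (fun=> 0) [set v | weak_derivative u v].

Definition H1 u : Prop :=
  square_integrable u /\ exists2 v, weak_derivative u v & square_integrable v.

Definition H1norm u : R :=
  Num.sqrt (\int[mu]_x (cabs (wderiv u x) ^+ 2 + cabs (u x) ^+ 2)).

Definition mass u : R := \int[mu]_x (cabs (u x) ^+ 2).

Definition sqmod u : R -> R[i] := fun x => `|u x| ^+ 2.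

End ComplexFunctions.

Section QuasilinearSchroedinger.
Context {R : realType}.
Local Notation mu := (@lebesgue_measure R).
Implicit Types (k theta p lambda : R) (u w : R -> R[i]).

Definition energy k theta p u : R :=
  \int[mu]_x (2^-1 * cabs (wderiv u x) ^+ 2
              + k / 4 * cabs (wderiv (sqmod u) x) ^+ 2
              - theta / p * cabs (u x) `^ p).

Definition constraint lambda : set (R -> R[i]) :=
  [set u | H1 u /\ 2^-1 * mass u = lambda].

Definition min_energy k theta p lambda : \bar R :=
  ereal_inf [set (energy k theta p u)%:E | u in constraint lambda].

Definition minimizers k theta p lambda : set (R -> R[i]) :=
  [set u | constraint lambda u /\
           (energy k theta p u)%:E = min_energy k theta p lambda].

(* inf over eta and xi of || w - e^(i eta) u0(. + xi) || *)
Definition orbit_dist (u0 : R -> R[i]) w : R :=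
  inf [set r | exists eta xi : R,
         r = H1norm (fun x => w x - cis eta * u0 (x + xi))].

(* -u'' - k (|u|^2)'' u - theta |u|^(p-2) u tested against phi, with one
   derivative moved onto phi, resp. onto u phi. *)
Definition weak_rhs k theta p u (phi : R -> R) : R[i] :=
  cintegral setT (fun x => wderiv u x * (derive1 phi x)%:C)
  + k%:C * cintegral setT (fun x =>
      wderiv (sqmod u) x * wderiv (fun y => u y * (phi y)%:C) x)
  - theta%:C * cintegral setT (fun x =>
      (cabs (u x) `^ (p - 2))%:C * u x * (phi x)%:C).

(* z t x stands for z(x,t), and Tstar is finite or +oo.  The equation holds in
   the sense of distributions in x, integrated in time; no continuity of
   t |-> z t in H^1 is required. *)
Definition solution k theta p (z0 : R -> R[i]) (Tstar : \bar R)
    (z : R -> R -> R[i]) : Prop :=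
  [/\ forall t, 0 <= t -> (t%:E < Tstar)%E -> H1 (z t),
      {ae mu, forall x, z 0 x = z0 x} &
      forall phi t, test_function phi -> 0 <= t -> (t%:E < Tstar)%E ->
        cintegrable `[0, t] (fun s => weak_rhs k theta p (z s) phi) /\
        'i%C * (cintegral setT (fun x => z t x * (phi x)%:C)
              - cintegral setT (fun x => z0 x * (phi x)%:C)) =
        cintegral `[0, t] (fun s => weak_rhs k theta p (z s) phi)].

Definition assumptionA k theta p (z0 : R -> R[i]) (Tstar : \bar R)
    (z : R -> R -> R[i]) : Prop :=
  [/\ (0 < Tstar)%E,
      solution k theta p z0 Tstar z,
      forall t, 0 <= t -> (t%:E < Tstar)%E -> mass (z t) = mass z0 &
      forall t, 0 <= t -> (t%:E < Tstar)%E ->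
        energy k theta p (z t) = energy k theta p z0].

End QuasilinearSchroedinger.

(* Main.v *)
Require Import Defs.
From mathcomp Require Import measurable_realfun ring lra.

(** Write r = p/2 - 1, which lies in [1, 2), and c = sqrt (2 theta / p).  For
    u = a + i b and q = |u|^2 the energy density is
      1/2 |u'|^2 + k (a a' + b b')^2 - c^2/2 q^(r+1).
    Stability follows from an explicit lower bound for the energy together with
    a study of its almost equality case.

    The lower bound.  Translate u so that q attains its maximum Q at 0, put
      rate = c sqrt ((Q^r - q^r) / (1 + 2 k q)),
      Phi = c/2 sqrt ((Q^r - q^r) (1 + 2 k q)),
    and let R = u' + sgn(x) rate u be the residual.  Completing squares
    (defectE) gives
      density + c^2/2 Q^r q = 1/2 |R|^2 + k (Re (conj u R))^2 - sgn(x) Phi q',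
    and the last term is exact on either half-line.  Integrating (bogomolny),
      I(u) + c^2/2 Q^r int |u|^2 = defect + J(Q),
    where defect >= 1/2 int |R|^2 and J(Q) = 2 int_0^Q Phi.
    The residual vanishes on a positive profile U with U(0)^2 = Q
    (profile_exists), whose mass is 2 L(Q) (profile_mass).

    The peak.  As a function of Q^r, J is convex with slope c^2 L(Q)
    (Jact_tangent), and L increases from 0 to infinity because r < 2
    (Lmass_mono, Lmass_surj).  Let L(Q) = lambda.  Then the profile U of peak Q
    minimizes the energy under the mass constraint, and for a function whose
    mass is close to 2 lambda and whose energy is close to that of U, both the
    maximum of q is close to Q (peak_coercive) and the residual is small in L^2.

    Compactness.  It remains to see that such functions converge to U in H^1
    once translated and rotated to be positive at their maximum (compactness).
    A small residual means that q cannot decrease much faster than U^2 does, so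
    that q >= U^2 - o(1) at every point (comparison, lower_bound).  Since the
    masses converge, no mass is left over and q tends to U^2 in L^1.  The
    quotient u / U then has small derivative, hence u tends to U pointwise, then
    in L^2 by domination, and finally in H^1 by the formula for the residual.

    Stability.  Mass and energy are continuous in H^1 and invariant under
    translations and rotations (mass_pert, energy_pert, orbit_invariants).  A
    datum close to the orbit of u0 has therefore almost the mass and energy of
    U, and keeps them by the conservation laws.  Both z(t) and u0 itself are
    thus close to the orbit of U, hence close to each other up to symmetries
    (orbital_stability). *)

Set Implicit Arguments.
Unset Strict Implicit.
Unset Printing Implicit Defensive.
Set SsrOldRewriteGoalsOrder.

Local Open Scope classical_set_scope.
Local Open Scope ring_scope.

(** * Integrals on the line *)

Section Integrals.
Context {R : realType}.
Local Notation mu := (@lebesgue_measure R).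
Implicit Types (f g h : R -> R) (a b c x y t : R).

Definition L1 g := mu.-integrable setT (EFin \o g).

Definition L1loc g := forall a b, mu.-integrable `[a, b] (EFin \o g).

Lemma L1_loc g : L1 g -> L1loc g.
Proof. by move=> ig a b; apply: integrableS ig. Qed.

Lemma L1_measurable g : L1 g -> measurable_fun setT g.
Proof. by move=> /measurable_int/measurable_EFinP. Qed.

Lemma Rint_split g a b c : L1loc g -> a <= b -> b <= c ->
  \int[mu]_(x in `[a, c]) g x =
  \int[mu]_(x in `[a, b]) g x + \int[mu]_(x in `[b, c]) g x.
Proof.
move=> ig ab bc; apply/eqP; rewrite addrC -subr_eq; apply/eqP.
rewrite Rintegral_itvB ?bnd_simp//.
rewrite Rintegral_itv_obnd_cbnd//.
by apply: integrableS (ig b c) => //; exact: subset_itv_oc_cc.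
Qed.

Lemma L1locD f g : L1loc f -> L1loc g -> L1loc (fun x => f x + g x).
Proof.
move=> lf lg a b; have -> : EFin \o (fun x => f x + g x) = ((EFin \o f) \+ (EFin \o g))%E by [].
exact: integrableD.
Qed.

Lemma L1locZ k f : L1loc f -> L1loc (fun x => k * f x).
Proof.
move=> lf a b.
have -> : EFin \o (fun x => k * f x) = (fun x => k%:E * (EFin \o f) x)%E by [].
exact: integrableZl.
Qed.

Lemma L1D f g : L1 f -> L1 g -> L1 (fun x => f x + g x).
Proof.
move=> lf lg; rewrite /L1.
have -> : EFin \o (fun x => f x + g x) = ((EFin \o f) \+ (EFin \o g))%E by [].
exact: integrableD.
Qed.

Lemma L1Z k f : L1 f -> L1 (fun x => k * f x).
Proof.
move=> lf; rewrite /L1.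
have -> : EFin \o (fun x => k * f x) = (fun x => k%:E * (EFin \o f) x)%E by [].
exact: integrableZl.
Qed.

Lemma L1_le f g : measurable_fun setT f -> (forall x, `|f x| <= g x) ->
  L1 g -> L1 f.
Proof.
move=> mf fg; apply: le_integrable => //; first exact/measurable_EFinP.
move=> x _; rewrite lee_fin (le_trans (fg x))//; exact: ler_norm.
Qed.

Lemma L1_cont_cc f : continuous f -> L1loc f.
Proof.
move=> cf a b; apply: continuous_compact_integrable; first exact: segment_compact.
exact: continuous_subspaceT.
Qed.

Lemma L1loc_mulC f g : continuous f -> L1loc g -> L1loc (fun x => f x * g x).
Proof.
move=> cf lg a b.
have -> : EFin \o (fun x => f x * g x) = ((EFin \o f) \* (EFin \o g))%E.
  by apply/funext => x /=; rewrite EFinM.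
apply: integrableMr => //.
  by apply: measurable_funTS; exact: continuous_measurable_fun.
have [B [_ Bf]] : bounded_set (f @` `[a, b]).
  apply: compact_bounded; apply: continuous_compact; last exact: segment_compact.
  exact: continuous_subspaceT.
exists B; split; first by rewrite num_real.
by move=> z Bz x xab; apply: Bf Bz _ _; exists x.
Qed.

Lemma le_Rint_itv f g a b : L1loc f -> L1loc g ->
  (forall x, a <= x -> x <= b -> f x <= g x) ->
  \int[mu]_(x in `[a, b]) f x <= \int[mu]_(x in `[a, b]) g x.
Proof.
move=> lf lg fg; apply: le_Rintegral => // x /=.
by rewrite in_itv/= => /andP[? ?]; exact: fg.
Qed.

Lemma L1loc_norm g : L1loc g -> L1loc (fun x => `|g x|).
Proof. by move=> lg a b; apply: integrable_norm. Qed.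

Lemma eq_Rint_itv f g a b : (forall x, a <= x -> x <= b -> f x = g x) ->
  \int[mu]_(x in `[a, b]) f x = \int[mu]_(x in `[a, b]) g x.
Proof.
move=> fg; apply: eq_Rintegral => x; rewrite inE/= in_itv/= => /andP[? ?].
exact: fg.
Qed.

Lemma Rint_itv_cst (k a b : R) : a <= b ->
  \int[mu]_(x in `[a, b]) k = k * (b - a).
Proof.
move=> ab; rewrite Rintegral_cst//= lebesgue_measure_itv/= lte_fin.
case: ltP => //= ba; have -> : a = b by apply/le_anti/andP.
by rewrite subrr.
Qed.

Lemma RintZ_itv (k : R) g a b : L1loc g ->
  \int[mu]_(x in `[a, b]) (k * g x) = k * \int[mu]_(x in `[a, b]) g x.
Proof. by move=> lg; rewrite RintegralZl. Qed.

Lemma cvg_Rint_exhaust g : L1 g ->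
  \int[mu]_(x in `[- n%:R, n%:R]) g x @[n --> \oo] --> \int[mu]_x g x.
Proof.
move=> ig.
pose F n x : \bar R := ((g \_ `[- n%:R, n%:R]) x)%:E.
have [|||||_ _ H] := @dominated_convergence _ _ _ mu setT measurableT F
   (EFin \o g) (fun x => `|g x|%:E).
- move=> n; apply/measurable_EFinP; apply/(measurable_restrictT _ _).1 => //.
  by apply: measurable_funTS; apply: L1_measurable.
- exact: measurable_int ig.
- apply: aeW => x _; apply: cvg_near_cst.
  near=> n; rewrite /F patchE; case: ifPn => //; rewrite notin_setE/= in_itv/=.
  case; rewrite -ler_norml; apply: (@le_trans _ _ (Num.bound `|x|)%:R).
    by rewrite ltW// archi_boundP.
  by rewrite ler_nat; near: n; exact: nbhs_infty_ge.
- exact: integrable_norm.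
- apply: aeW => x n _; rewrite /F patchE lee_fin.
  by case: ifPn => //; rewrite normr0.
have fH : (\int[mu]_x (g x)%:E)%E \is a fin_num by exact: integrable_fin_num.
have {}H : (\int[mu]_x F n x)%E @[n --> \oo] --> (fine (\int[mu]_x (g x)%:E)%E)%:E.
  by rewrite fineK.
move/fine_cvg : H; apply: cvg_trans; apply: near_eq_cvg; near=> n.
rewrite /Rintegral [in RHS]integral_mkcond /=; congr fine; apply: eq_integral => x _.
by rewrite /F restrict_EFin.
Unshelve. all: by end_near. Qed.

End Integrals.

(** * Absolutely continuous functions *)

Section AbsolutelyContinuous.
Context {R : realType}.
Local Notation mu := (@lebesgue_measure R).
Implicit Types (f g h : R -> R) (a b c x y t : R).

(** Local absolute continuity in the form used throughout: f is a primitive of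
    the locally integrable g. *)
Definition AC f g := L1loc g /\
  forall a b, a <= b -> f b - f a = \int[mu]_(x in `[a, b]) g x.

Lemma AC_L1loc f g : AC f g -> L1loc g.
Proof. by case. Qed.

Lemma AC_continuous f g : AC f g -> continuous f.
Proof.
move=> [lg fE] x.
have ab : x - 1 < x + 1 by lra.
have := parameterized_integral_continuous (ltW ab) (lg (x - 1) (x + 1)).
move/(continuous_within_itvP _ ab) => [H _ _].
have /H : x \in `](x - 1), (x + 1)[ by rewrite in_itv/=; apply/andP; split; lra.
rewrite /continuous_at /parameterized_integral => Hx.
have {Hx}: (f (x - 1) + \int[mu]_(t in `[x - 1, y]) g t) @[y --> x] -->
    f (x - 1) + \int[mu]_(t in `[x - 1, x]) g t.
  by apply: cvgD => //; exact: cvg_cst.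
rewrite -(fE (x - 1) x); last by lra.
rewrite [X in _ --> X -> _]addrC subrK; apply: cvg_trans; apply: near_eq_cvg.
near=> y; rewrite -fE; first by rewrite addrC subrK.
near: y; exists 1 => //= z; rewrite /ball_/= ltr_norml => /andP[? ?]; lra.
Unshelve. all: by end_near. Qed.

Lemma AC_D f1 g1 f2 g2 : AC f1 g1 -> AC f2 g2 ->
  AC (fun x => f1 x + f2 x) (fun x => g1 x + g2 x).
Proof.
move=> [l1 E1] [l2 E2]; split; first exact: L1locD.
move=> a b ab; rewrite RintegralD// -?E1 -?E2//; ring.
Qed.

Lemma AC_Z k f g : AC f g -> AC (fun x => k * f x) (fun x => k * g x).
Proof.
move=> [l1 E1]; split; first exact: L1locZ.
move=> a b ab; rewrite RintegralZl// -?E1 ?mulrBr//.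
Qed.

Lemma AC_cst (k : R) : AC (fun=> k) (fun=> 0).
Proof.
split; first by apply: L1_cont_cc => x; exact: cvg_cst.
by move=> a b ab; rewrite Rint_itv_cst// subrr mul0r.
Qed.

Lemma AC_B f1 g1 f2 g2 : AC f1 g1 -> AC f2 g2 ->
  AC (fun x => f1 x - f2 x) (fun x => g1 x - g2 x).
Proof.
move=> h1 /(AC_Z (-1)) h2; have := AC_D h1 h2.
by under eq_fun do rewrite mulN1r; under [X in AC _ X -> _]eq_fun do rewrite mulN1r.
Qed.

Lemma AC_C1 f g : (forall x, is_derive x 1 f (g x)) -> continuous g -> AC f g.
Proof.
move=> df cg; split; first exact: L1_cont_cc.
move=> a b; rewrite le_eqVlt => /predU1P[->|ab].
  by rewrite subrr set_itv1 Rintegral_set1.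
have cf : continuous f.
  by move=> x; apply: differentiable_continuous; apply/derivable1_diffP; case: (df x).
rewrite /Rintegral (@continuous_FTC2 _ g f a b)//.
- exact: continuous_subspaceT.
- split; first by move=> x _; case: (df x).
  + exact: cvg_at_right_filter (cf a).
  + exact: cvg_at_left_filter (cf b).
- by move=> x _; rewrite derive1E; apply: derive_val.
Qed.

(** A bound on the increments of D around each point passes to [a, b]: the
    supremum of the points up to which it holds cannot be less than b. *)
Lemma straddle (D M : R -> R) a b : a <= b ->
  (forall t, a <= t -> t <= b -> exists2 d, 0 < d & forall x y,
     a <= x -> t - d < x -> x <= t -> t <= y -> y < t + d -> y <= b ->
     `|D y - D x| <= M y - M x) ->
  `|D b - D a| <= M b - M a.
Proof.
move=> ab H.
pose S := [set x | a <= x <= b /\ `|D x - D a| <= M x - M a].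
have Sa : S a by rewrite /S/= lexx ab subrr normr0 subrr.
have hS : has_sup S by split; [exists a|exists b => x [/andP[]]].
pose s := sup S.
have as_ : a <= s by apply: sup_upper_bound.
have sb : s <= b by apply: ge_sup => //; [exists a|move=> x [/andP[]]].
have tri u v w : `|D v - D u| <= M v - M u -> `|D w - D v| <= M w - M v ->
   `|D w - D u| <= M w - M u.
  move=> h1 h2; have -> : D w - D u = (D w - D v) + (D v - D u) by ring.
  by apply: (le_trans (ler_normD _ _)); lra.
have [d d0 Hd] := H s as_ sb.
have Ss : S s.
  have [x [/andP[ax xb] Sx] sx] := sup_adherent d0 hS.
  have xs : x <= s by apply: sup_upper_bound => //; split => //; apply/andP.
  split; first by rewrite as_ sb.
  by apply: (tri _ x) => //; apply: Hd => //; rewrite -/s; lra.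
have [sb1|snb] := eqVneq s b; first by case: Ss; rewrite sb1.
have sltb : s < b by rewrite lt_neqAle snb.
pose y := Num.min b (s + d / 2).
have ys : s < y by rewrite /y lt_min sltb; lra.
have : y <= s.
  apply: sup_upper_bound => //; split.
    by rewrite /y ge_min lexx andbT; rewrite (le_trans as_)//; exact: ltW.
  case: (Ss) => _; move/tri; apply; apply: Hd => //; first lra.
  - exact: ltW.
  - by rewrite /y gt_min; apply/orP; right; lra.
  - by rewrite /y ge_min lexx.
by rewrite leNgt ys.
Qed.

(** The chain rule.  On a short interval H o f has increment h(xi) int g with
    h(xi) close to h o f, so it differs from int (h o f) g by at most e int |g|;
    straddle sums these errors.  The derivative of H is asked only strictly
    between two points of P, so that f may touch an end of the range where H is
    not differentiable, such as |s|^r at 0 for r = 1. *)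
Lemma AC_comp (H h : R -> R) (P : set R) f g : AC f g ->
  (forall x, P (f x)) ->
  (forall s t u, P s -> P u -> s < t < u -> is_derive t 1 H (h t)) ->
  continuous H ->
  (forall s, P s -> {for s, continuous h}) ->
  AC (fun x => H (f x)) (fun x => h (f x) * g x).
Proof.
move=> ACf fr dH cH ch; have cf := AC_continuous ACf.
have [lg fE] := ACf.
have chf : continuous (fun x => h (f x)).
  by move=> x; apply: continuous_comp; [exact: cf|apply: ch].
have lhg : L1loc (fun x => h (f x) * g x) by exact: L1loc_mulC.
split=> // a b ab.
have MVTH s t : P s -> s <= t -> P t ->
   exists2 xi, s <= xi <= t & H t - H s = h xi * (t - s).
  move=> Ps st Pt.
  have [] := @MVT_segment _ H h s t st.
  - by move=> x; rewrite in_itv/=; exact: dH.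
  - exact: continuous_subspaceT.
  by move=> xi; rewrite in_itv/= => ? ?; exists xi.
pose G c := \int[mu]_(x in `[a, c]) (h (f x) * g x).
pose N c := \int[mu]_(x in `[a, c]) `|g x|.
suff HE e : 0 < e -> `|H (f b) - G b - (H (f a) - G a)| <= e * N b - e * N a.
  have -> : H (f b) - H (f a) = (H (f b) - G b - (H (f a) - G a)) + G b.
    by rewrite {2}/G set_itv1 Rintegral_set1; ring.
  suff /eqP -> : H (f b) - G b - (H (f a) - G a) == 0 by rewrite add0r.
  rewrite -normr_le0; apply/ler_addgt0Pr => e e0; rewrite add0r.
  have N0 : 0 <= N b by apply: Rintegral_ge0.
  have e1 : 0 < e / (N b + 1) by rewrite divr_gt0//; lra.
  apply: (le_trans (HE _ e1)).
  have -> : N a = 0 by rewrite /N set_itv1 Rintegral_set1.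
  by rewrite mulr0 subr0 mulrAC ler_pdivrMr; nra.
move=> e0.
apply: (@straddle (fun c => H (f c) - G c) (fun c => e * N c)) => // t at_ tb.
have /cvgrPdist_le /(_ (e / 2)) := ch _ (fr t).
have e20 : 0 < e / 2 by rewrite divr_gt0.
move=> /(_ e20) [r /= r0 Hr].
have /cvgrPdist_lt /(_ r r0) [d /= d0 Hd] := cf t.
exists d => // x y ax tdx xt ty ytd yb.
have xy := le_trans xt ty.
have near_t z : x <= z -> z <= y -> `|f t - f z| < r.
  by move=> xz zy; apply: Hd; rewrite /ball_/= ltr_norml; apply/andP; split; lra.
have ax_y := le_trans ax xy.
have Gxy : G y - G x = \int[mu]_(x in `[x, y]) (h (f x) * g x).
  by rewrite /G (@Rint_split _ _ a x y)//; ring.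
have Nxy : N y - N x = \int[mu]_(x in `[x, y]) `|g x|.
  by rewrite /N (@Rint_split _ _ a x y)//; [ring|exact: L1loc_norm].
have [xi xir HE] : exists2 xi, `|f t - xi| < r & H (f y) - H (f x) = h xi * (f y - f x).
  have := near_t x (lexx _) xy; have := near_t y xy (lexx _).
  rewrite !ltr_norml => /andP[? ?] /andP[? ?].
  have [fxy|/ltW fxy] := leP (f x) (f y).
    have [xi /andP[? ?] E] := MVTH _ _ (fr x) fxy (fr y).
    by exists xi => //; rewrite ltr_norml; apply/andP; split; lra.
  have [xi /andP[? ?] E] := MVTH _ _ (fr y) fxy (fr x).
  exists xi; first by rewrite ltr_norml; apply/andP; split; lra.
  by rewrite -opprB E; ring.
have -> : H (f y) - G y - (H (f x) - G x) =
    \int[mu]_(z in `[x, y]) ((h xi - h (f z)) * g z).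
  transitivity (H (f y) - H (f x) - (G y - G x)); first by ring.
  rewrite Gxy HE (fE _ _ xy) -RintegralZl//.
  rewrite -RintegralB//; last exact: (L1locZ _ lg).
  by apply: eq_Rintegral => z _; rewrite mulrBl.
have lI : L1loc (fun z => (h xi - h (f z)) * g z).
  apply: L1loc_mulC => // z; apply: cvgB; [exact: cvg_cst|exact: chf].
have lgn := L1loc_norm lg; rewrite -mulrBr Nxy -RintegralZl//.
apply: le_trans (le_normr_Rintegral _ (lI _ _)) _ => //.
apply: le_Rint_itv; [exact: L1loc_norm|exact/L1locZ/L1loc_norm|].
move=> z xz zy; rewrite normrM ler_wpM2r//.
have h1 := Hr xi xir; have h2 := Hr (f z) (near_t z xz zy).
have -> : h xi - h (f z) = (h (f t) - h (f z)) - (h (f t) - h xi) by ring.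
by apply: (le_trans (ler_normB _ _)); lra.
Qed.

End AbsolutelyContinuous.

Section MoreAC.
Context {R : realType}.
Local Notation mu := (@lebesgue_measure R).
Implicit Types (f g h : R -> R) (a b c x y t : R).

Lemma AC_eq f g h : AC f g -> (forall x, g x = h x) -> AC f h.
Proof. by move=> + gh; have -> : g = h by apply/funext. Qed.

Lemma AC_sqr f g : AC f g -> AC (fun x => f x ^+ 2) (fun x => 2 * (f x * g x)).
Proof.
move=> ACf.
apply: AC_eq (AC_comp (H := fun s => s ^+ 2) (h := fun s => 2 * s) (P := setT) ACf _ _ _ _) _ => //.
- move=> s t u _ _ _; apply: is_derive_eq.
  by rewrite /GRing.scale/=; ring.
- by move=> s; exact: exprn_continuous.
- by move=> s _; apply: cvgMr; exact: cvg_id.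
- by move=> x; rewrite mulrA.
Qed.

Lemma AC_M f1 g1 f2 g2 : AC f1 g1 -> AC f2 g2 ->
  AC (fun x => f1 x * f2 x) (fun x => g1 x * f2 x + f1 x * g2 x).
Proof.
move=> h1 h2.
have hD := AC_Z 4^-1 (AC_B (AC_sqr (AC_D h1 h2)) (AC_sqr (AC_B h1 h2))).
have E1 x : 4^-1 * ((f1 x + f2 x) ^+ 2 - (f1 x - f2 x) ^+ 2) = f1 x * f2 x by field.
under [in X in AC X]eq_fun do rewrite -E1.
by apply: AC_eq hD _ => x; field.
Qed.

Lemma AC_int f g a b : AC f g -> a <= b ->
  \int[mu]_(x in `[a, b]) g x = f b - f a.
Proof. by move=> [_ H] ab; rewrite H. Qed.

(** For t in [x, x + 1] one has |f x| <= |f t| + int_[x, x+1] |g|; average over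
    t. *)
Lemma AC_sup f g x : AC f g -> L1 f -> L1 g ->
  `|f x| <= \int[mu]_(t in `[x, x + 1]) (`|f t| + `|g t|).
Proof.
move=> ACf If Ig.
have x1 : x <= x + 1 by lra.
have lf := L1loc_norm (L1_loc If); have lg := L1loc_norm (L1_loc Ig).
have -> : `|f x| = \int[mu]_(t in `[x, x + 1]) `|f x|.
  by rewrite Rint_itv_cst//; ring.
rewrite RintegralD//.
pose C := \int[mu]_(t in `[x, x + 1]) `|g t|.
have -> : \int[mu]_(t in `[x, x + 1]) `|g t| = \int[mu]_(t in `[x, x + 1]) C.
  by rewrite Rint_itv_cst// /C; ring.
have lC k : L1loc (fun=> k : R) by apply: L1_cont_cc => z; exact: cvg_cst.
rewrite -RintegralD//; last exact: lC.
apply: le_Rint_itv; [exact: lC|exact: L1locD|].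
move=> t xt tx1.
have -> : f x = f t - \int[mu]_(z in `[x, t]) g z by rewrite (AC_int ACf)//; ring.
apply: (le_trans (ler_normB _ _)); rewrite lerD2l.
apply: le_trans (le_normr_Rintegral _ _) _ => //; first exact: L1_loc.
rewrite /C (Rint_split lg xt tx1) lerDl.
by apply: Rintegral_ge0.
Qed.

Lemma Rint_le_T f a b : L1 f -> (forall x, 0 <= f x) ->
  \int[mu]_(x in `[a, b]) f x <= \int[mu]_x f x.
Proof.
move=> If f0; rewrite /Rintegral fine_le//.
- by apply: integrable_fin_num => //; exact: L1_loc.
- by apply: integrable_fin_num.
apply: ge0_subset_integral => //; first exact: measurable_int If.
by move=> x _; rewrite lee_fin.
Qed.

Lemma le_RintT f g : L1 f -> L1 g -> (forall x, f x <= g x) ->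
  \int[mu]_x f x <= \int[mu]_x g x.
Proof. by move=> If Ig fg; apply: le_Rintegral. Qed.

Lemma RintD f g : L1 f -> L1 g ->
  \int[mu]_x (f x + g x) = \int[mu]_x f x + \int[mu]_x g x.
Proof. by move=> If Ig; rewrite RintegralD. Qed.

Lemma RintB f g : L1 f -> L1 g ->
  \int[mu]_x (f x - g x) = \int[mu]_x f x - \int[mu]_x g x.
Proof. by move=> If Ig; rewrite RintegralB. Qed.

Lemma RintZ k f : L1 f -> \int[mu]_x (k * f x) = k * \int[mu]_x f x.
Proof. by move=> If; rewrite RintegralZl. Qed.

Lemma L1B f g : L1 f -> L1 g -> L1 (fun x => f x - g x).
Proof.
move=> lf lg; have := L1D lf (L1Z (-1) lg).
by under eq_fun do rewrite mulN1r.
Qed.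

Lemma L1_norm f : L1 f -> L1 (fun x => `|f x|).
Proof. by move=> lf; apply: integrable_norm. Qed.

Lemma Rint_tail f (e : R) : L1 f -> (forall x, 0 <= f x) -> 0 < e ->
  exists2 N : R, 0 < N & forall a b, a <= b -> N <= a \/ b <= - N ->
    \int[mu]_(x in `[a, b]) f x < e.
Proof.
move=> If f0 e0.
have /cvgrPdist_lt /(_ e e0) [n _ Hn] := cvg_Rint_exhaust If.
exists n.+1%:R => // a b ab; have lf := L1_loc If.
have nn : n%:R <= n.+1%:R :> R by rewrite ler_nat.
have n0 : 0 <= n%:R :> R by [].
have := Hn n (leqnn _) => /=.
set I := \int[mu]_x f x; set J := \int[mu]_(x in `[- n%:R, n%:R]) f x => IJ.
have {}IJ : I - J < e by apply: le_lt_trans IJ; exact: ler_norm.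
move=> [na|bn]; apply: le_lt_trans IJ.
- rewrite lerBrDl; apply: le_trans (Rint_le_T (- n%:R) b If f0).
  rewrite (@Rint_split _ _ (- n%:R) n%:R b)//; [|lra|lra].
  rewrite lerD2l (@Rint_split _ _ n%:R a b)//; [|lra].
  by rewrite lerDr; apply: Rintegral_ge0.
- rewrite lerBrDl; apply: le_trans (Rint_le_T a n%:R If f0).
  rewrite (@Rint_split _ _ a (- n%:R) n%:R)//; [|lra|lra].
  rewrite addrC lerD2r (@Rint_split _ _ a b (- n%:R))//; [|lra].
  by rewrite lerDl; apply: Rintegral_ge0.
Qed.

(** AC_sup bounds f x by a tail of a convergent integral. *)
Lemma AC_vanish f g (e : R) : AC f g -> L1 f -> L1 g -> 0 < e ->
  exists2 N : R, 0 < N & forall x, N <= `|x| -> `|f x| < e.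
Proof.
move=> ACf If Ig e0.
have IF : L1 (fun t => `|f t| + `|g t|) by apply: L1D; exact: L1_norm.
have F0 x : 0 <= `|f x| + `|g x| by rewrite addr_ge0.
have [N N0 HN] := Rint_tail IF F0 e0.
exists (N + 1); first lra.
move=> x Nx; apply: le_lt_trans (AC_sup x ACf If Ig) _; apply: HN; first lra.
by move: Nx; case: (ger0P x) => ? ?; [left|right]; lra.
Qed.

Lemma AC_bound f g x : AC f g -> L1 f -> L1 g ->
  `|f x| <= \int[mu]_t (`|f t| + `|g t|).
Proof.
move=> ACf If Ig; apply: le_trans (AC_sup x ACf If Ig) _.
apply: Rint_le_T; last by move=> t; rewrite addr_ge0.
by apply: L1D; exact: L1_norm.
Qed.

(** Monotone convergence along the intervals [-n, n]. *)
Lemma L1_of_bound f (C : R) : measurable_fun setT f -> L1loc f ->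
  (forall x, 0 <= f x) ->
  (forall n, \int[mu]_(x in `[- n%:R, n%:R]) f x <= C) -> L1 f.
Proof.
move=> mf lf f0 fC; apply/integrableP; split; first exact/measurable_EFinP.
pose F n x : \bar R := ((f \_ `[- n%:R, n%:R]) x)%:E.
have mF n : measurable_fun setT (F n).
  apply/measurable_EFinP; apply/(measurable_restrictT _ _).1 => //.
  exact: measurable_funTS.
have F0 n x : setT x -> (0 <= F n x)%E.
  by move=> _; rewrite /F patchE lee_fin; case: ifP.
have F_nd x : setT x -> nondecreasing_seq (F^~ x).
  move=> _ n m nm; rewrite /F !patchE lee_fin; case: ifPn => // h1; case: ifPn => // h2.
  move: h1 h2; rewrite !inE/= !in_itv/= => /andP[h1 h2].
  rewrite notin_setE/= in_itv/=; case; apply/andP; split.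
    by apply: le_trans h1; rewrite lerN2 ler_nat.
  by apply: le_trans h2 _; rewrite ler_nat.
have H := @cvg_monotone_convergence _ _ _ mu setT measurableT F mF F0 F_nd.
have limF x : limn (F^~ x) = (f x)%:E.
  apply/cvg_lim => //; apply: cvg_near_cst.
  near=> n; rewrite /F patchE; case: ifPn => //; rewrite notin_setE/= in_itv/=.
  case; rewrite -ler_norml; apply: (@le_trans _ _ (Num.bound `|x|)%:R).
    by rewrite ltW// archi_boundP.
  by rewrite ler_nat; near: n; exact: nbhs_infty_ge.
have -> : (\int[mu]_x `|(EFin \o f) x| = \int[mu]_x limn (F^~ x))%E.
  by apply: eq_integral => x _; rewrite limF/= ger0_norm.
apply: (@le_lt_trans _ _ C%:E); last exact: ltry.
move/cvg_lim : (H) => <- //; apply: lime_le; first by apply/cvg_ex; eexists; exact: H.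
apply: nearW => n.
have -> : (\int[mu]_x F n x)%E = (\int[mu]_(x in `[(- n%:R)%R, n%:R%R]) (f x)%:E)%E.
  rewrite [in RHS]integral_mkcond; apply: eq_integral => x _.
  by rewrite /F restrict_EFin.
rewrite -(fineK (integrable_fin_num _ (lf _ _)))// lee_fin; exact: fC.
Unshelve. all: by end_near. Qed.

Local Notation shift c := ((fun x => x + c) : measurableTypeR R -> measurableTypeR R).

Lemma measurable_shift c : measurable_fun setT (shift c).
Proof. exact: measurable_funD. Qed.

Lemma preimage_shift_itv c (b1 b2 : bool) a b :
  shift c @^-1` [set` Interval (BSide b1 (a + c)) (BSide b2 (b + c))] =
  [set` Interval (BSide b1 a) (BSide b2 b)].
Proof.
apply/seteqP; split => x /=; rewrite !in_itv/=;
  by case: b1; case: b2; rewrite /= ?lerD2r ?ltrD2r.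
Qed.

Lemma lebesgue_measure_shift c (A : set R) : measurable A ->
  pushforward mu (shift c) A = mu A.
Proof.
move=> mA; apply/esym/lebesgue_measure_unique => //=.
  exact: measurable_shift.
move=> ? _ [[a b]] _ <-.
have E := preimage_shift_itv c false false (a - c) (b - c).
rewrite !subrK in E; rewrite /pushforward E/=.
rewrite !lebesgue_measure_itv/= !lte_fin ltrD2r -!EFinB.
by case: ifP => // _; congr EFin; ring.
Qed.

Lemma L1_shift c f : L1 f -> L1 (fun x => f (x + c)).
Proof.
move=> If; apply/integrableP; split.
  apply/measurable_EFinP; apply: measurableT_comp; last exact: measurable_shift.
  exact: L1_measurable.
move/integrableP : If => [mf]; apply: le_lt_trans.
have mf' : measurable_fun setT (fun x => `|(EFin \o f) x|%E).
  exact: measurableT_comp.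
have := @ge0_integral_pushforward _ _ _ _ _ (shift c) (measurable_shift c) mu setT
  (fun x => `|(EFin \o f) x|%E) measurableT mf' (fun x _ => abse_ge0 _).
rewrite preimage_setT => <-.
rewrite le_eqVlt; apply/orP; left; apply/eqP.
apply: eq_measure_integral => //=; first exact: measurable_shift.
by move=> ? A mA _; exact: lebesgue_measure_shift.
Qed.

Lemma Rint_shift c f : L1 f -> \int[mu]_x f (x + c) = \int[mu]_x f x.
Proof.
move=> If; rewrite /Rintegral; congr fine.
have := @integral_pushforward _ _ _ _ _ (shift c) (measurable_shift c) mu setT
  (EFin \o f) (measurable_int _ If).
rewrite preimage_setT => /(_ (L1_shift c If) measurableT) <-.
apply: eq_measure_integral => //=; first exact: measurable_shift.
by move=> ? A mA _; exact: lebesgue_measure_shift.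
Qed.

Lemma L1_restrict a b f : L1loc f -> L1 (f \_ `[a, b]).
Proof.
move=> lf; rewrite /L1 -restrict_EFin.
by apply/integrable_restrict => //; rewrite setTI; exact: lf.
Qed.

Lemma L1loc_shift c f : L1loc f -> L1loc (fun x => f (x + c)).
Proof.
move=> lf a b.
have := L1_shift c (L1_restrict (a + c) (b + c) lf).
move=> h; apply/integrable_mkcond => //.
apply: eq_integrable h => // x _ /=.
rewrite restrict_EFin /= !patchE.
suff -> : (x + c \in `[a + c, b + c]%classic) = (x \in `[a, b]%classic) by [].
by apply/idP/idP; rewrite !inE/= !in_itv/= !lerD2r.
Qed.

Lemma Rint_itv_shift c f a b : L1loc f ->
  \int[mu]_(x in `[a, b]) f (x + c) = \int[mu]_(x in `[a + c, b + c]) f x.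
Proof.
move=> lf; rewrite [LHS]Rintegral_mkcond [RHS]Rintegral_mkcond.
rewrite -(Rint_shift c (L1_restrict (a + c) (b + c) lf)).
apply: eq_Rintegral => x _; rewrite !patchE.
suff -> : (x + c \in `[a + c, b + c]%classic) = (x \in `[a, b]%classic) by [].
by apply/idP/idP; rewrite !inE/= !in_itv/= !lerD2r.
Qed.

Lemma AC_shift c f g : AC f g -> AC (fun x => f (x + c)) (fun x => g (x + c)).
Proof.
move=> [lg fE]; split; first exact: L1loc_shift.
by move=> a b ab; rewrite Rint_itv_shift// fE// lerD2r.
Qed.

Lemma ae_shift c (P : R -> Prop) :
  {ae mu, forall x, P x} -> {ae mu, forall x, P (x + c)}.
Proof.
move=> [N [mN N0 PN]]; exists (shift c @^-1` N); split.
- by rewrite -[X in measurable X]setTI; apply: measurable_shift.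
- by have := lebesgue_measure_shift c mN; rewrite /pushforward N0.
- by move=> x /= nP; apply: PN.
Qed.

End MoreAC.

(** * Smooth functions and test functions *)

Section Derivatives.
Context {R : realType}.
Implicit Types (f g : R -> R) (x a b : R).

Lemma dD f g x a b : is_derive x 1 f a -> is_derive x 1 g b ->
  is_derive x 1 (fun y => f y + g y) (a + b).
Proof. exact: is_deriveD. Qed.

Lemma dB f g x a b : is_derive x 1 f a -> is_derive x 1 g b ->
  is_derive x 1 (fun y => f y - g y) (a - b).
Proof. exact: is_deriveB. Qed.

Lemma dM f g x a b : is_derive x 1 f a -> is_derive x 1 g b ->
  is_derive x 1 (fun y => f y * g y) (f x * b + g x * a).
Proof. exact: is_deriveM. Qed.

Lemma dZ f k x a : is_derive x 1 f a ->
  is_derive x 1 (fun y => k * f y) (k * a).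
Proof. exact: is_deriveZ. Qed.

Lemma dcst (k : R) x : is_derive x 1 (fun=> k) 0.
Proof. exact: is_derive_cst. Qed.

Lemma did x : is_derive x 1 (fun y : R => y) 1.
Proof. exact: is_derive_id. Qed.

Lemma dcomp f g x a b : is_derive (g x) 1 f a -> is_derive x 1 g b ->
  is_derive x 1 (fun y => f (g y)) (a * b).
Proof. exact: is_derive1_comp. Qed.

Lemma dV f x a : f x != 0 -> is_derive x 1 f a ->
  is_derive x 1 (fun y => (f y)^-1) (- a / (f x) ^+ 2).
Proof.
move=> fx0 df; have := is_deriveV fx0 df; rewrite /GRing.scale/=.
by rewrite mulNr mulrC -mulNr.
Qed.

Lemma dX f n x a : is_derive x 1 f a ->
  is_derive x 1 (fun y => f y ^+ n) (n%:R * f x ^+ n.-1 * a).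
Proof.
apply: (dcomp (f := fun s => s ^+ n)); apply: DeriveDef; first exact: exprn_derivable.
by rewrite exp_derive /GRing.scale/= mulr1.
Qed.

Lemma d_eq f x a b : is_derive x 1 f a -> a = b -> is_derive x 1 f b.
Proof. by move=> + <-. Qed.

Lemma d_cont f x a : is_derive x 1 f a -> {for x, continuous f}.
Proof.
by move=> df; apply: differentiable_continuous; apply/derivable1_diffP; case: df.
Qed.

Lemma d_near f g x a : (\forall y \near x, f y = g y) ->
  is_derive x 1 f a -> is_derive x 1 g a.
Proof.
exact: near_eq_is_derive.
Qed.

(** Smoothness through explicit successive derivatives, which makes closure
    under sums and products an induction. *)
Fixpoint diffn (k : nat) f : Prop :=
  if k is k'.+1 then exists2 g, (forall x, is_derive x 1 f (g x)) & diffn k' g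
  else True.

Definition smooth f := forall k, diffn k f.

Lemma diffnS k f : diffn k.+1 f -> diffn k f.
Proof.
elim: k f => [//|k IH] f [g df] dg; exists g => //; exact: IH.
Qed.

Lemma diffn_D k f g : diffn k f -> diffn k g -> diffn k (fun x => f x + g x).
Proof.
elim: k f g => [//|k IH] f g [f' df Hf] [g' dg Hg].
exists (fun x => f' x + g' x); last exact: IH.
by move=> x; apply: dD.
Qed.

Lemma diffn_cst k (c : R) : diffn k (fun=> c).
Proof.
elim: k c => [//|k IH] c; exists (fun=> 0); last exact: IH.
by move=> x; exact: dcst.
Qed.

Lemma diffn_M k f g : diffn k f -> diffn k g -> diffn k (fun x => f x * g x).
Proof.
elim: k f g => [//|k IH] f g Hf Hg.
have [f' df Hf'] := Hf; have [g' dg Hg'] := Hg.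
exists (fun x => f x * g' x + g x * f' x); first by move=> x; apply: dM.
by apply: diffn_D; apply: IH => //; exact: diffnS.
Qed.

Lemma diffn_affine k f (s c : R) : diffn k f -> diffn k (fun x => f (s * x + c)).
Proof.
elim: k f => [//|k IH] f [f' df Hf].
exists (fun x => f' (s * x + c) * s).
  move=> x; apply: dcomp (df _) _.
  by apply: d_eq (dD (dZ s (did x)) (dcst c x)) _; rewrite mulr1 addr0.
by apply: diffn_M; [exact: IH|exact: diffn_cst].
Qed.

Lemma smooth_D f g : smooth f -> smooth g -> smooth (fun x => f x + g x).
Proof. by move=> sf sg k; exact: diffn_D. Qed.

Lemma smooth_M f g : smooth f -> smooth g -> smooth (fun x => f x * g x).
Proof. by move=> sf sg k; exact: diffn_M. Qed.

Lemma smooth_cst c : smooth (fun=> c).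
Proof. by move=> k; exact: diffn_cst. Qed.

Lemma smooth_B f g : smooth f -> smooth g -> smooth (fun x => f x - g x).
Proof.
move=> sf sg; have := smooth_D sf (smooth_M (smooth_cst (-1)) sg).
by under eq_fun do rewrite mulN1r.
Qed.

Lemma smooth_X f n : smooth f -> smooth (fun x => f x ^+ n).
Proof.
move=> sf; elim: n => [|n IH]; first exact: smooth_cst.
under eq_fun do rewrite exprS.
exact: smooth_M.
Qed.

Lemma smooth_continuous f : smooth f -> continuous f.
Proof. by move=> /(_ 1%N) [g df _] x; exact: d_cont (df x). Qed.

Lemma smooth_derive1 f : smooth f -> smooth (derive1 f) /\ forall x, is_derive x 1 f (derive1 f x).
Proof.
move=> sf.
have E g : (forall x, is_derive x 1 f (g x)) -> g = derive1 f.
  by move=> dg; apply/funext => x; rewrite derive1E; apply/esym; apply: derive_val.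
split; first by move=> k; have [g /E <-] := sf k.+1.
by have [g dg _] := sf 1%N; rewrite -(E g dg).
Qed.

Lemma smooth_primitive f g : (forall x, is_derive x 1 f (g x)) -> smooth g -> smooth f.
Proof. by move=> df sg [//|k]; exists g. Qed.

Lemma smooth_derivable f : smooth f -> forall n x, derivable (derive1n n f) x 1.
Proof.
move=> sf n x; suff : smooth (derive1n n f).
  by move=> /(_ 1%N) [g /(_ x) [dg _] _].
elim: n => [//|n IH]; rewrite derive1nS.
by have [] := smooth_derive1 IH.
Qed.

Lemma derivable_smooth f : (forall n x, derivable (derive1n n f) x 1) -> smooth f.
Proof.
move=> sf k; have : forall n, diffn k (derive1n n f).
  elim: k => [//|k IH] n; exists (derive1n n.+1 f); last exact: IH.
  by move=> x; rewrite derive1nS derive1E; apply: DeriveDef => //; exact: sf.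
by move=> /(_ 0%N).
Qed.

(** The classical exp (-1/x) extended by 0; the factors x^-n make the family
    closed under differentiation. *)
Definition flat (n : nat) x : R := if 0 < x then x^-1 ^+ n * expR (- x^-1) else 0.

(** From exp (1/x) >= (1/x)^(n+1) / (n+1)!. *)
Lemma flat_bound n x : 0 <= flat n x <= n.+1`!%:R * `|x|.
Proof.
rewrite /flat; case: ifPn => [x0|_]; last by rewrite lexx mulr_ge0.
have xV : 0 < x^-1 by rewrite invr_gt0.
apply/andP; split; first by rewrite mulr_ge0 ?expR_ge0// exprn_ge0// ltW.
rewrite gtr0_norm// expRN -(ler_pM2r xV) -(mulrA _ x) (divff (lt0r_neq0 x0)) mulr1.
rewrite mulrAC -exprSr ler_pdivrMr ?expR_gt0// mulrC -ler_pdivrMr ?ltr0n ?fact_gt0//.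
by apply: le_trans (expR_ge1Dxn n (ltW xV)); rewrite ler_wpDl.
Qed.

Lemma is_derive_flat n x :
  is_derive x 1 (flat n) (flat n.+2 x - n%:R * flat n.+1 x).
Proof.
have [x0|x0|->] := ltgtP x 0.
- have -> : flat n.+2 x - n%:R * flat n.+1 x = 0.
    by rewrite /flat ltNge (ltW x0)/= mulr0 subr0.
  apply: d_near (dcst 0 x); near=> y; rewrite /flat ltNge.
  suff -> : y <= 0 by [].
  by near: y; exact: lt_le_nbhsl.
- have xn0 : x != 0 by rewrite gt_eqF.
  have dI : is_derive x 1 (fun y : R => y^-1) (- 1 / x ^+ 2) by exact: dV (did x).
  have dIn : is_derive x 1 (fun y : R => y^-1 ^+ n) (n%:R * x^-1 ^+ n.-1 * (- 1 / x ^+ 2)).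
    exact: dX dI.
  have dE : is_derive x 1 (fun y : R => expR (- y^-1)) (expR (- x^-1) * (0 - - 1 / x ^+ 2)).
    apply: dcomp (is_derive_expR _) _.
    have := dB (dcst 0 x) dI.
    by under eq_fun do rewrite sub0r.
  apply: d_near (d_eq (dM dIn dE) _).
    near=> y; rewrite /flat ifT//.
    by near: y; exact: lt_nbhsr.
  rewrite /flat x0.
  case: n {dIn} => [|n] /=; first by rewrite !mul0r mulr0 addr0 subr0; field.
  rewrite !exprS; field.
  by [].
- have -> : flat n.+2 0 - n%:R * flat n.+1 0 = 0 by rewrite /flat ltxx mulr0 subr0.
  apply/is_derive1_caratheodory; exists (flat n.+1); split.
  + move=> z; rewrite /flat ltxx !subr0; case: ifPn => [z0|]; last by rewrite mul0r.
    by rewrite exprSr mulrAC -(mulrA _ z^-1) mulVf ?mulr1// gt_eqF.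
  + apply/cvgrPdist_le => e e0; rewrite /flat ltxx; near=> z.
    rewrite sub0r normrN; have /andP[h1 h2] := flat_bound n.+1 z.
    rewrite ger0_norm//; apply: (le_trans h2).
    rewrite mulrC -ler_pdivlMr ?ltr0n ?fact_gt0//.
    near: z; exists (e / n.+2`!%:R); first by rewrite /= divr_gt0// ltr0n fact_gt0.
    by move=> z; rewrite /ball_/= sub0r normrN => /ltW.
  + by rewrite /flat ltxx.
Unshelve. all: by end_near. Qed.

Lemma smooth_flat n : smooth (flat n).
Proof.
move=> k; elim: k n => [//|k IH] n; exists (fun x => flat n.+2 x - n%:R * flat n.+1 x).
  exact: is_derive_flat.
have := diffn_D (IH n.+2) (diffn_M (diffn_cst k (- n%:R)) (IH n.+1)).
by under eq_fun do rewrite mulNr.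
Qed.

Definition bump (a b x : R) : R := flat 0 (x - a) * flat 0 (b - x).

Lemma smooth_bump a b : smooth (bump a b).
Proof.
apply: smooth_M => k.
  have := diffn_affine 1 (- a) (smooth_flat 0 k).
  by under eq_fun do rewrite mul1r.
have := diffn_affine (-1) b (smooth_flat 0 k).
by under eq_fun do rewrite mulN1r addrC.
Qed.

Lemma flat0_itv x : 0 <= flat 0 x <= 1.
Proof.
rewrite /flat; case: ifPn => [x0|_]; last by rewrite lexx ler01.
by rewrite mul1r expR_ge0/= expR_le1 oppr_le0 invr_ge0 ltW.
Qed.

Lemma bump_itv a b x : 0 <= bump a b x <= 1.
Proof.
have /andP[h1 h2] := flat0_itv (x - a); have /andP[h3 h4] := flat0_itv (b - x).
by rewrite mulr_ge0//= mulr_ile1.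
Qed.

Lemma bump_gt0 a b x : (0 < bump a b x) = (a < x < b).
Proof.
rewrite /bump /flat; have [xa|xa] := boolP (0 < x - a); last first.
  by rewrite mul0r ltxx; move: xa; rewrite subr_gt0 => /negbTE ->.
rewrite subr_gt0 in xa; rewrite xa/=; case: ifPn => bx.
  by rewrite mulr_gt0 ?mul1r ?expR_gt0//; rewrite subr_gt0 in bx.
by rewrite mulr0 ltxx; move: bx; rewrite subr_gt0 => /negbTE ->.
Qed.

Lemma bump0 a b x : ~~ (a < x < b) -> bump a b x = 0.
Proof.
rewrite -bump_gt0 -leNgt => h; apply/le_anti; rewrite h.
by have /andP[] := bump_itv a b x.
Qed.

(** A smooth approximation of the indicator of ]a, b[: the power tends to 0
    exactly where the bump is positive. *)
Definition step (a b : R) (n : nat) x : R := 1 - (1 - bump a b x) ^+ n.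

Lemma smooth_step a b n : smooth (step a b n).
Proof.
apply: smooth_B; first exact: smooth_cst.
by apply: smooth_X; apply: smooth_B; [exact: smooth_cst|exact: smooth_bump].
Qed.

Lemma step_itv a b n x : 0 <= step a b n x <= 1.
Proof.
have /andP[h1 h2] := bump_itv a b x.
rewrite /step subr_ge0 exprn_ile1 ?gerBl ?exprn_ge0//; lra.
Qed.

Lemma step0 a b n x : ~~ (a < x < b) -> step a b n x = 0.
Proof. by move=> h; rewrite /step bump0// subr0 expr1n subrr. Qed.

Lemma cvg_step a b x : step a b n x @[n --> \oo] --> (\1_(`]a, b[%classic) x : R).
Proof.
rewrite indicE; have [xab|xab] := boolP (a < x < b).
  rewrite mem_set/=; last by rewrite in_itv.
  rewrite -[X in _ --> X]subr0; apply: cvgB; first exact: cvg_cst.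
  apply: cvg_expr; have /andP[_ h2] := bump_itv a b x.
  have := bump_gt0 a b x; rewrite xab => h.
  by rewrite ger0_norm; lra.
rewrite memNset/=; last by rewrite in_itv; exact/negP.
by apply: cvg_near_cst; near=> n; rewrite step0.
Unshelve. all: by end_near. Qed.

(** The closure of the support is a closed subset of [a, b]. *)
Lemma test_functionP f a b : smooth f -> (forall x, ~~ (a < x < b) -> f x = 0) ->
  test_function f.
Proof.
move=> sf f0; split; first exact: smooth_derivable.
apply: (subclosed_compact _ (@segment_compact _ a b)); first exact: closed_closure.
rewrite closureE => x; apply; split; first exact: interval_closed.
move=> y /= fy; rewrite in_itv/=; have [/andP[? ?]|/f0 fy0] := boolP (a < y < b).
  by rewrite !ltW.
by rewrite fy0 eqxx in fy.
Qed.

Lemma test_function_support f : test_function f ->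
  exists2 N : R, 0 < N & forall x, ~~ (- N < x < N) -> f x = 0.
Proof.
move=> [_ /compact_bounded [M [_ HM]]].
exists (`|M| + 1); first by have := normr_ge0 M; lra.
move=> x h; apply/eqP/negPn/negP => fx0.
have := HM (`|M| + 1 / 2); have := ler_norm M => ?.
move=> /(_ ltac:(lra) x) H.
have : `|x| <= `|M| + 1 / 2 by apply: H; exact: subset_closure.
by rewrite ler_norml => /andP[? ?]; move/negP: h; apply; apply/andP; split; lra.
Qed.

End Derivatives.

(** * Weak derivatives *)

Section WeakDerivative.
Context {R : realType}.
Local Notation mu := (@lebesgue_measure R).
Implicit Types (f g h : R -> R) (a b c x y t : R).

Lemma loc_L1loc f : locally_integrable setT f -> L1loc f.
Proof.
move=> [mf _ H] a b; apply/integrableP; split.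
  by apply/measurable_EFinP; apply: measurable_funTS.
by apply: H => //; exact: segment_compact.
Qed.

Lemma L1loc_measurable f : L1loc f -> measurable_fun setT f.
Proof.
move=> lf.
have -> : [set: R] = \bigcup_n `[- n%:R, n%:R]%classic.
  apply/esym/seteqP; split => // x _; exists (Num.bound `|x|) => //=.
  by rewrite in_itv/= -ler_norml ltW// archi_boundP.
apply/measurable_fun_bigcup => // n.
by have /measurable_int/measurable_EFinP := lf (- n%:R) n%:R.
Qed.

Lemma L1loc_loc f : L1loc f -> locally_integrable setT f.
Proof.
move=> lf; have mf := L1loc_measurable lf; split => //; first exact: openT.
move=> K _ cK; have [M [_ HM]] := compact_bounded cK.
pose N := `|M| + 1.
have KN : K `<=` `[- N, N].
  move=> x Kx /=; rewrite in_itv/= -ler_norml; apply: HM => //.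
  by rewrite /N; have := ler_norm M; lra.
have /integrableP[_] := lf (- N) N; apply: le_lt_trans.
apply: ge0_subset_integral => //; first exact: compact_measurable.
by apply/measurable_EFinP; apply: measurableT_comp => //; exact: measurable_funTS.
Qed.

Lemma L1_supp f a b : L1loc f -> (forall x, ~~ (a <= x <= b) -> f x = 0) ->
  L1 f /\ \int[mu]_x f x = \int[mu]_(x in `[a, b]) f x.
Proof.
move=> lf f0; have fE : f \_ `[a, b] = f.
  apply/funext => x; rewrite patchE; case: ifPn => //.
  by rewrite notin_setE/= in_itv/= => /negP/f0.
split; first by rewrite -fE; exact: L1_restrict.
by rewrite [RHS]Rintegral_mkcond fE.
Qed.

Lemma test_L1 f phi : L1loc f -> test_function phi -> L1 (fun x => f x * phi x).
Proof.
move=> lf tphi; have [N N0 HN] := test_function_support tphi.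
have cphi : continuous phi by apply: smooth_continuous; apply: derivable_smooth; case: tphi.
have h : L1loc (fun x => f x * phi x).
  by under eq_fun do rewrite mulrC; exact: L1loc_mulC.
apply: (L1_supp (a := - N) (b := N) h _).1 => x xN.
by rewrite HN ?mulr0//; apply: contra xN => /andP[? ?]; rewrite !ltW.
Qed.

Lemma test_function_derive1 phi : test_function phi ->
  test_function (derive1 phi) /\ forall x, is_derive x 1 phi (derive1 phi x).
Proof.
move=> tphi; have [N N0 HN] := test_function_support tphi.
have [s1 s2] := smooth_derive1 (derivable_smooth tphi.1).
split=> //; apply: (@test_functionP _ _ (- N - 1) (N + 1) s1) => x xN.
rewrite derive1E; apply: derive_val; apply: d_near (dcst 0 x).
have [x0|x0] : N < x \/ x < - N.
  have [|xN'] := ltP N x; first by left.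
  right; rewrite ltNge; apply/negP => ?; move/negP: xN; apply; apply/andP; split; lra.
- near=> y; rewrite HN//; apply/negP => /andP[_]; apply/negP; rewrite -leNgt.
  by apply: ltW; near: y; exact: lt_nbhsr.
- near=> y; rewrite HN//; apply/negP => /andP[+ _]; apply/negP; rewrite -leNgt.
  by near: y; exact: lt_le_nbhsl.
Unshelve. all: by end_near. Qed.

(** f phi is absolutely continuous and vanishes far out, so the integral of its
    derivative is 0. *)
Lemma AC_ibp f g phi : AC f g -> test_function phi ->
  \int[mu]_x (f x * derive1 phi x) = - \int[mu]_x (g x * phi x).
Proof.
move=> ACf tphi; have [N N0 HN] := test_function_support tphi.
have [tphi' dphi] := test_function_derive1 tphi.
have ACphi : AC phi (derive1 phi).
  apply: AC_C1 => //; apply: smooth_continuous; exact: derivable_smooth tphi'.1.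
have lf : L1loc f by apply: L1_cont_cc; exact: AC_continuous ACf.
have lg := AC_L1loc ACf.
have ACM := AC_M ACf ACphi.
have I1 := test_L1 lf tphi'; have I2 := test_L1 lg tphi.
apply/eqP; rewrite -addr_eq0 addrC -RintD//; apply/eqP.
have [|_ ->] := @L1_supp (fun x => g x * phi x + f x * derive1 phi x) (- N - 1) (N + 1) (AC_L1loc ACM).
  move=> x xN; rewrite HN; last first.
    by apply: contra xN => /andP[? ?]; apply/andP; split; lra.
  suff -> : derive1 phi x = 0 by rewrite !mulr0 addr0.
  rewrite derive1E; apply: derive_val; apply: d_near (dcst 0 x).
  have [x0|x0] : N < x \/ x < - N.
    have [|xN'] := ltP N x; first by left.
    right; rewrite ltNge; apply/negP => ?; move/negP: xN; apply; apply/andP; split; lra.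
  - near=> y; rewrite HN//; apply/negP => /andP[_]; apply/negP; rewrite -leNgt.
    by apply: ltW; near: y; exact: lt_nbhsr.
  - near=> y; rewrite HN//; apply/negP => /andP[+ _]; apply/negP; rewrite -leNgt.
    by near: y; exact: lt_le_nbhsl.
rewrite (AC_int ACM); last lra.
rewrite !HN ?mulr0 ?subrr//; apply/negP => /andP[? ?]; lra.
Unshelve. all: by end_near. Qed.

Lemma step_test a b n : test_function (step a b n).
Proof. by apply: (@test_functionP _ _ a b); [exact: smooth_step|exact: step0]. Qed.

(** The functions step a b n are test functions that tend boundedly to the
    indicator of ]a, b[. *)
Lemma fundamental_itv f : L1loc f ->
  (forall phi, test_function phi -> \int[mu]_x (f x * phi x) = 0) ->
  forall a b, \int[mu]_(x in `[a, b]) f x = 0.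
Proof.
move=> lf H a b.
pose F n x : \bar R := (f x * step a b n x)%:E.
have If : L1 (f \_ `[a, b]) by exact: L1_restrict.
have fab n x : `|f x * step a b n x| <= `|(f \_ `[a, b]) x|.
  rewrite patchE normrM; have /andP[h1 h2] := step_itv a b n x.
  case: ifPn => [_|]; first by rewrite (ger0_norm h1) ler_piMr.
  rewrite notin_setE/= in_itv/= => xab; rewrite step0 ?normr0 ?mulr0//.
  by apply: contra_notN xab => /andP[? ?]; rewrite !ltW.
have [|||||_ _ L] := @dominated_convergence _ _ _ mu setT measurableT F
   (fun x => (f x * \1_(`]a, b[%classic) x)%:E) (fun x => `|(f \_ `[a, b]) x|%:E).
- by move=> n; apply: measurable_int (test_L1 lf (step_test a b n)).
- apply/measurable_EFinP; apply: measurable_funM; first exact: L1loc_measurable.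
  by apply: measurable_indic.
- apply: aeW => x _; apply: cvg_EFin; first by near=> n.
  by apply: cvgMr; exact: cvg_step.
- exact: L1_norm.
- by apply: aeW => x n _; rewrite lee_fin fab.
have L0 : (\int[mu]_x F n x)%E @[n --> \oo] --> (0%R)%:E.
  apply: cvg_near_cst; near=> n; have := H _ (step_test a b n).
  rewrite /Rintegral => h; rewrite -[LHS]fineK ?h//.
  by apply: integrable_fin_num => //; exact: test_L1 lf (step_test a b n).
have E : (\int[mu]_x (f x * \1_(`]a, b[%classic) x)%:E)%E = 0%:E.
  by apply: cvg_unique L L0; exact: ereal_hausdorff.
have lab : mu.-integrable `]a, b] (EFin \o f).
  by apply: integrableS (lf a b) => //; exact: subset_itv_oc_cc.
rewrite -Rintegral_itv_obnd_cbnd// -Rintegral_itv_bndo_bndc; last first.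
  by apply: integrableS (lf a b) => //; exact: subset_itv_oo_cc.
rewrite Rintegral_mkcond /Rintegral.
rewrite (_ : (\int[mu]_x _)%E = 0%:E)//= -E; apply: eq_integral => x _.
by rewrite patchE indicE; case: ifPn => _; rewrite ?mulr1 ?mulr0.
Unshelve. all: by end_near. Qed.

(** All primitives of f are constant, and f is almost everywhere the derivative
    of its primitive by Lebesgue's theorem. *)
Lemma fundamental f : L1loc f ->
  (forall phi, test_function phi -> \int[mu]_x (f x * phi x) = 0) ->
  {ae mu, forall x, f x = 0}.
Proof.
move=> lf H.
have I0 := fundamental_itv lf H.
have Hn n : {ae mu, forall x, - n%:R < x -> f x = 0}.
  have := @FTC1 R f (BLeft (- n%:R)) (fun y => lf _ y) (L1loc_loc lf).
  apply: filterS; first exact: (ae_filter_ringOfSetsType mu).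
  move=> x /= + nx => /(_ nx) [_ <-].
  rewrite derive1E; apply: derive_val; apply: d_near (dcst 0 x).
  by near=> y; rewrite I0.
have : {ae mu, forall x n, - n%:R < x -> f x = 0} by apply/ae_foralln.
apply: filterS; first exact: (ae_filter_ringOfSetsType mu).
move=> x /(_ (Num.bound `|x|)); apply.
by rewrite ltrNl; apply: le_lt_trans (archi_boundP (normr_ge0 x)); rewrite -normrN ler_norm.
Unshelve. all: by end_near. Qed.

Definition prim h x : R :=
  if 0 <= x then \int[mu]_(t in `[0, x]) h t else - \int[mu]_(t in `[x, 0]) h t.

Lemma AC_prim h : L1loc h -> AC (prim h) h.
Proof.
move=> lh; split => // a b ab; rewrite /prim.
case: (leP 0 a) => a0; case: (leP 0 b) => b0.
- by rewrite (Rint_split lh a0 ab); ring.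
- by lra.
- by rewrite (Rint_split lh (ltW a0) b0); ring.
- by rewrite (Rint_split lh ab (ltW b0)); ring.
Qed.

Lemma is_derive_prim h x : continuous h -> is_derive x 1 (prim h) (h x).
Proof.
move=> ch; have lh := L1_cont_cc ch.
have [_ E] := AC_prim lh.
have [||||d1 d2] := @continuous_FTC1_closed _ h (x - 1) x (x + 1).
- lra.
- exact: lh.
- lra.
- exact: ch.
have : is_derive x 1 (fun y => prim h (x - 1) + \int[mu]_(t in `[x - 1, y]) h t) (0 + h x).
  apply: (dD (dcst _ x)).
  by apply: DeriveDef; [exact: d1|rewrite -derive1E].
rewrite add0r; apply: d_near; near=> y; rewrite -E; first by ring.
by apply: ltW; near: y; apply: lt_nbhsr; lra.
Unshelve. all: by end_near. Qed.

(** Subtracting from a test function psi a multiple of a fixed psi0 of nonzero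
    integral leaves a function h of zero integral, whose primitive is a test
    function.  As f annihilates the derivative h of this function, f - c
    annihilates psi, for a constant c independent of psi. *)
Lemma du_Bois_Reymond f : L1loc f ->
  (forall phi, test_function phi -> \int[mu]_x (f x * derive1 phi x) = 0) ->
  exists c, {ae mu, forall x, f x = c}.
Proof.
move=> lf H.
have l1 : L1loc (fun=> 1 : R) by apply: L1_cont_cc => z; exact: cvg_cst.
have [psi0 tpsi0 m0] : exists2 psi0, test_function psi0 & \int[mu]_x psi0 x != 0.
  apply: contrapT => nex.
  have h phi : test_function phi -> \int[mu]_x (1 * phi x) = 0.
    move=> tphi; under eq_Rintegral do rewrite mul1r.
    by apply/eqP/negPn/negP => /eqP h; apply: nex; exists phi => //; apply/eqP.
  have := fundamental_itv l1 h 0 1; rewrite Rint_itv_cst ?ler01// subr0 mulr1.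
  by move/eqP; rewrite oner_eq0.
pose m := \int[mu]_x psi0 x.
pose c := m^-1 * \int[mu]_x (f x * psi0 x).
exists c.
suff : {ae mu, forall x, f x - c = 0}.
  apply: filterS; first exact: (ae_filter_ringOfSetsType mu).
  by move=> x /eqP; rewrite subr_eq0 => /eqP.
have lc k : L1loc (fun=> k : R) by apply: L1_cont_cc => z; exact: cvg_cst.
apply: fundamental.
  by have := L1locD lf (lc (- c)).
move=> psi tpsi.
have I1 : L1 psi by have := test_L1 l1 tpsi; under eq_fun do rewrite mul1r.
have I0 : L1 psi0 by have := test_L1 l1 tpsi0; under eq_fun do rewrite mul1r.
pose k := m^-1 * \int[mu]_x psi x.
pose h x := psi x - k * psi0 x.
have sh : smooth h.
  apply: smooth_B; first by apply: derivable_smooth; case: tpsi.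
  by apply: smooth_M; [exact: smooth_cst|apply: derivable_smooth; case: tpsi0].
have ch := smooth_continuous sh; have lh := L1_cont_cc ch.
have Ih : \int[mu]_x h x = 0.
  rewrite /h RintB//; last exact: L1Z.
  by rewrite RintZ// /k mulrAC mulVf ?mul1r ?subrr.
have [N1 N10 HN1] := test_function_support tpsi.
have [N0 N00 HN0] := test_function_support tpsi0.
pose N := N1 + N0.
have hN x : ~~ (- N <= x <= N) -> h x = 0.
  move=> xN; rewrite /h HN1 ?HN0 ?mulr0 ?subr0//.
    by apply: contra xN; rewrite /N => /andP[? ?]; apply/andP; split; lra.
  by apply: contra xN; rewrite /N => /andP[? ?]; apply/andP; split; lra.
pose phi x := prim h x - prim h (- N).
have dphi x : is_derive x 1 phi (h x).
  by apply: d_eq (dB (is_derive_prim x ch) (dcst _ x)) _; rewrite subr0.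
have [_ EP] := AC_prim lh.
have tphi : test_function phi.
  apply: (@test_functionP _ _ (- N) N); first exact: smooth_primitive dphi sh.
  move=> x xN; rewrite /phi.
  have [Nx|xN'] := leP x (- N).
    apply/eqP; rewrite -oppr_eq0 opprB EP//; apply/eqP.
    transitivity (\int[mu]_(t in `[x, - N]) (0 : R)).
      rewrite -!Rintegral_itv_bndo_bndc.
      - apply: eq_Rintegral => t; rewrite inE/= in_itv/= => /andP[_ tN].
        by apply: hN; apply/negP => /andP[? _]; lra.
      - by apply: integrableS (lc 0 x (- N)) => //; exact: subset_itv_co_cc.
      - by apply: integrableS (lh x (- N)) => //; exact: subset_itv_co_cc.
    by rewrite Rint_itv_cst// mul0r.
  have Nx : N <= x by rewrite leNgt; move: xN; rewrite xN'.
  rewrite EP; last exact: ltW.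
  rewrite -Ih; apply/esym; apply: (L1_supp lh _).2 => t tN.
  by apply: hN; apply: contra tN => /andP[? ?]; apply/andP; split; lra.
have := H phi tphi.
have -> : derive1 phi = h.
  by apply/funext => x; rewrite derive1E; apply: derive_val.
have Ifpsi := test_L1 lf tpsi; have Ifpsi0 := test_L1 lf tpsi0.
have -> : (fun x => f x * h x) = (fun x => f x * psi x - k * (f x * psi0 x)).
  by apply/funext => x; rewrite /h; ring.
rewrite RintB// ?RintZ//; last exact: L1Z.
move=> E.
have -> : (fun x => (f x - c) * psi x) = (fun x => f x * psi x - c * psi x).
  by apply/funext => x; ring.
rewrite RintB ?RintZ//; last exact: L1Z.
by rewrite -{}E /c /k; ring.
Qed.

(** The weak derivative of a real function, that is, either component of
    weak_derivative. *)
Definition wd f g := [/\ locally_integrable setT f, locally_integrable setT g &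
  forall phi, test_function phi ->
    \int[mu]_x (f x * derive1 phi x) = - \int[mu]_x (g x * phi x)].

Lemma ae_L1loc f g : measurable_fun setT g ->
  {ae mu, forall x, f x = g x} -> L1loc f -> L1loc g.
Proof.
move=> mg fg lf a b.
have mf := L1loc_measurable lf.
apply/integrableP; split; first by apply/measurable_EFinP; exact: measurable_funTS.
have /integrableP[_] := lf a b; apply: le_lt_trans.
rewrite le_eqVlt; apply/orP; left; apply/eqP; apply: ae_eq_integral => //.
- by do 2 apply: measurableT_comp => //; exact: measurable_funTS.
- by do 2 apply: measurableT_comp => //; exact: measurable_funTS.
- apply: filterS fg; first exact: (ae_filter_ringOfSetsType mu).
  by move=> x /= ->.
Qed.

Lemma AC_wd f h g : AC f g -> measurable_fun setT h ->
  {ae mu, forall x, f x = h x} -> wd h g.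
Proof.
move=> ACf mh fh.
have lf : L1loc f by apply: L1_cont_cc; exact: AC_continuous ACf.
have lh := ae_L1loc mh fh lf.
split; [exact: L1loc_loc|exact: L1loc_loc (AC_L1loc ACf)|].
move=> phi tphi; rewrite -(AC_ibp ACf tphi).
rewrite /Rintegral; congr fine; apply: ae_eq_integral => //.
- by apply: measurable_int (test_L1 lh (test_function_derive1 tphi).1).
- by apply: measurable_int (test_L1 lf (test_function_derive1 tphi).1).
- apply: filterS fh; first exact: (ae_filter_ringOfSetsType mu).
  by move=> x /= -> _.
Qed.

(** h minus the primitive of g has zero weak derivative, hence is constant. *)
Lemma wd_AC h g : wd h g -> exists2 f, AC f g & {ae mu, forall x, h x = f x}.
Proof.
move=> [/loc_L1loc lh /loc_L1loc lg H].
have AP := AC_prim lg.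
have lP : L1loc (prim g) by apply: L1_cont_cc; exact: AC_continuous AP.
have [||c Hc] := @du_Bois_Reymond (fun x => h x + (- 1) * prim g x).
- by apply: L1locD => //; exact: L1locZ.
- move=> phi tphi.
  have tphi' := (test_function_derive1 tphi).1.
  have -> : (fun x => (h x + -1 * prim g x) * derive1 phi x) =
            (fun x => h x * derive1 phi x - prim g x * derive1 phi x).
    by apply/funext => x; ring.
  rewrite RintB; [|exact: test_L1|exact: test_L1].
  by rewrite H// (AC_ibp AP tphi) subrr.
exists (fun x => c + prim g x).
  by have := AC_D (AC_cst c) AP; move/AC_eq; apply => x; rewrite add0r.
apply: filterS Hc; first exact: (ae_filter_ringOfSetsType mu).
by move=> x <-; ring.
Qed.

Lemma wd_unique h g1 g2 : wd h g1 -> wd h g2 -> {ae mu, forall x, g1 x = g2 x}.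
Proof.
move=> [_ /loc_L1loc l1 H1] [_ /loc_L1loc l2 H2].
suff : {ae mu, forall x, g1 x + (-1) * g2 x = 0}.
  apply: filterS; first exact: (ae_filter_ringOfSetsType mu).
  by move=> x; rewrite mulN1r => /eqP; rewrite subr_eq0 => /eqP.
apply: fundamental; first by apply: L1locD => //; exact: L1locZ.
move=> phi tphi.
have -> : (fun x => (g1 x + -1 * g2 x) * phi x) =
          (fun x => g1 x * phi x - g2 x * phi x).
  by apply/funext => x; ring.
rewrite RintB; [|exact: test_L1|exact: test_L1].
by have := H1 _ tphi; rewrite H2// => /oppr_inj ->; rewrite subrr.
Qed.

End WeakDerivative.

(** * Continuous representatives of functions in H^1 *)

Section Representatives.
Local Open Scope complex_scope.
Context {R : realType}.
Local Notation mu := (@lebesgue_measure R).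
Local Notation Re := complex.Re.
Local Notation Im := complex.Im.
Implicit Types (f g a b da db : R -> R) (u v w : R -> R[i]).

Definition L2 f := measurable_fun setT f /\ L1 (fun x => f x ^+ 2).

Lemma Lfun2P f : f \in Lfun mu 2%:E <-> L2 f.
Proof.
split => [lf|[mf lf]].
  split; last exact: Lfun2_integrable_sqr.
  by move: lf; rewrite inE => /andP[+ _]; rewrite inE.
rewrite inE; apply/andP; split; rewrite inE//=.
rewrite /finite_norm unlock; apply: poweR_lty.
move/integrableP : lf => [_]; apply: le_lt_trans.
rewrite le_eqVlt; apply/orP; left; apply/eqP; apply: eq_integral => x _ /=.
by rewrite powR_mulrn// normrX.
Qed.

Lemma ae_Rint f g : measurable_fun setT f -> measurable_fun setT g ->
  {ae mu, forall x, f x = g x} -> \int[mu]_x f x = \int[mu]_x g x.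
Proof.
move=> mf mg fg; rewrite /Rintegral; congr fine; apply: ae_eq_integral => //.
- exact/measurable_EFinP.
- exact/measurable_EFinP.
- apply: filterS fg; first exact: (ae_filter_ringOfSetsType mu).
  by move=> x /= ->.
Qed.

Lemma ae_L1 f g : measurable_fun setT g ->
  {ae mu, forall x, f x = g x} -> L1 f -> L1 g.
Proof.
move=> mg fg If; apply/integrableP; split; first exact/measurable_EFinP.
have mf := L1_measurable If.
move/integrableP : If => [_]; apply: le_lt_trans.
rewrite le_eqVlt; apply/orP; left; apply/eqP; apply: ae_eq_integral => //.
- by apply: measurableT_comp => //; exact/measurable_EFinP.
- by apply: measurableT_comp => //; exact/measurable_EFinP.
- apply: filterS fg; first exact: (ae_filter_ringOfSetsType mu).
  by move=> x /= ->.
Qed.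

Lemma ae_and (P Q : R -> Prop) : {ae mu, forall x, P x} -> {ae mu, forall x, Q x} ->
  {ae mu, forall x, P x /\ Q x}.
Proof.
move=> hP hQ; apply: filterS2 hP hQ; first exact: (ae_filter_ringOfSetsType mu).
by move=> x; split.
Qed.

Lemma ae_imp (P Q : R -> Prop) : (forall x, P x -> Q x) ->
  {ae mu, forall x, P x} -> {ae mu, forall x, Q x}.
Proof. move=> PQ h; apply: filterS h; [exact: (ae_filter_ringOfSetsType mu)|exact: PQ]. Qed.

Lemma L2_lin (s t : R) f g : L2 f -> L2 g -> L2 (fun x => s * f x + t * g x).
Proof.
move=> [mf lf] [mg lg].
have m : measurable_fun setT (fun x => s * f x + t * g x).
  by apply: measurable_funD; apply: measurable_funM.
split => //; apply: L1_le (L1D (L1Z (2 * s ^+ 2) lf) (L1Z (2 * t ^+ 2) lg)).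
  exact: measurable_funX.
move=> x; rewrite ger0_norm ?sqr_ge0//.
by have := sqr_ge0 (s * f x - t * g x); nra.
Qed.

Lemma L2_M f g : L2 f -> L2 g -> L1 (fun x => f x * g x).
Proof.
move=> [mf lf] [mg lg]; apply: L1_le (L1D lf lg); first exact: measurable_funM.
move=> x; rewrite ler_norml; apply/andP; split.
  by have := sqr_ge0 (f x + g x); have := sqr_ge0 (f x); have := sqr_ge0 (g x); nra.
by have := sqr_ge0 (f x - g x); have := sqr_ge0 (f x); have := sqr_ge0 (g x); nra.
Qed.

Lemma L2_shift c f : L2 f -> L2 (fun x => f (x + c)).
Proof.
move=> [mf lf]; split; last exact: (L1_shift c lf).
by apply: measurableT_comp => //; exact: measurable_shift.
Qed.

Lemma ae_L2 f g : measurable_fun setT g ->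
  {ae mu, forall x, f x = g x} -> L2 f -> L2 g.
Proof.
move=> mg fg [mf lf]; split => //; apply: ae_L1 lf; first exact: measurable_funX.
by apply: ae_imp fg => x ->.
Qed.

(** u is almost everywhere a + i b with a, b absolutely continuous and a, b, a',
    b' in L^2.  Mass, energy and H^1 norm are integrals of expressions in these
    four functions, free of the choice made in wderiv. *)
Record rep u a b da db : Prop := Rep {
  rep_re : {ae mu, forall x, a x = Re (u x)};
  rep_im : {ae mu, forall x, b x = Im (u x)};
  rep_mre : measurable_fun setT (fun x => Re (u x));
  rep_mim : measurable_fun setT (fun x => Im (u x));
  rep_ACa : AC a da;
  rep_ACb : AC b db;
  rep_a : L2 a;
  rep_b : L2 b;
  rep_da : L2 da;
  rep_db : L2 db }.

Lemma ReM u (phi : R -> R) x : Re (u x * (phi x)%:C) = Re (u x) * phi x.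
Proof. by case: (u x) => p q /=; rewrite mulr0 subr0. Qed.

Lemma ImM u (phi : R -> R) x : Im (u x * (phi x)%:C) = Im (u x) * phi x.
Proof. by case: (u x) => p q /=; rewrite mulr0 add0r. Qed.

Lemma weak_derivativeP u v : weak_derivative u v <->
  wd (fun x => Re (u x)) (fun x => Re (v x)) /\
  wd (fun x => Im (u x)) (fun x => Im (v x)).
Proof.
have E w (phi : R -> R) : cintegral setT (fun x => w x * (phi x)%:C) =
    (\int[mu]_x (Re (w x) * phi x)) +i* (\int[mu]_x (Im (w x) * phi x)).
  rewrite /cintegral; congr (_ +i* _); apply: eq_Rintegral => x _.
    exact: ReM.
  exact: ImM.
split.
- move=> [[l1 l2] [l3 l4] H]; split; split=> // phi tphi.
  + by have := H phi tphi; rewrite !E => -[].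
  + by have := H phi tphi; rewrite !E => -[].
- move=> [[l1 l3 H1] [l2 l4 H2]]; split=> // phi tphi.
  by rewrite !E H1// H2.
Qed.

Lemma H1_rep u : H1 u -> exists a b da db, rep u a b da db.
Proof.
move=> [[/Lfun2P r1 /Lfun2P r2] [v /weak_derivativeP[w1 w2] [/Lfun2P v1 /Lfun2P v2]]].
have [a ACa ha] := wd_AC w1; have [b ACb hb] := wd_AC w2.
exists a, b, (fun x => Re (v x)), (fun x => Im (v x)).
have ma : measurable_fun setT a by apply: continuous_measurable_fun; exact: AC_continuous ACa.
have mb : measurable_fun setT b by apply: continuous_measurable_fun; exact: AC_continuous ACb.
split => //.
- by apply: ae_imp ha => x.
- by apply: ae_imp hb => x.
- by case: r1.
- by case: r2.
- exact: ae_L2 ha r1.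
- exact: ae_L2 hb r2.
Qed.

Section Rep.
Variables (u : R -> R[i]) (a b da db : R -> R).
Hypothesis ru : rep u a b da db.

Lemma rep_weak_derivative : weak_derivative u (fun x => da x +i* db x).
Proof.
case: ru => re im mre mim ACa ACb _ _ _ _; apply/weak_derivativeP.
split; [exact: AC_wd ACa mre re|exact: AC_wd ACb mim im].
Qed.

Lemma rep_H1 : H1 u.
Proof.
have wdu := rep_weak_derivative.
case: ru => re im mre mim ACa ACb la lb la' lb'; split.
  by split; apply/Lfun2P; [exact: ae_L2 re la|exact: ae_L2 im lb].
by exists (fun x => da x +i* db x) => //; split; apply/Lfun2P.
Qed.

End Rep.

Lemma wderiv_ae u v : weak_derivative u v ->
  [/\ {ae mu, forall x, Re (wderiv u x) = Re (v x)},
      {ae mu, forall x, Im (wderiv u x) = Im (v x)},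
      measurable_fun setT (fun x => Re (wderiv u x)) &
      measurable_fun setT (fun x => Im (wderiv u x))].
Proof.
move=> uv; have H : weak_derivative u (wderiv u).
  exact: (xgetPex (fun=> 0) (ex_intro _ v uv)).
have /weak_derivativeP[v1 v2] := uv; have /weak_derivativeP[w1 w2] := H.
split; [exact: wd_unique w1 v1|exact: wd_unique w2 v2| |].
- by case: w1 => _ [].
- by case: w2 => _ [].
Qed.

Lemma cabs_sqr (z : R[i]) : cabs z ^+ 2 = Re z ^+ 2 + Im z ^+ 2.
Proof. by rewrite /cabs normc_def /= sqr_sqrtr// addr_ge0 ?sqr_ge0. Qed.

Lemma cabsE (z : R[i]) : cabs z = Num.sqrt (Re z ^+ 2 + Im z ^+ 2).
Proof. by rewrite /cabs normc_def. Qed.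

Lemma sqmodE u x : sqmod u x = (Re (u x) ^+ 2 + Im (u x) ^+ 2)%:C.
Proof.
by rewrite /sqmod normc_def -rmorphXn sqr_sqrtr// addr_ge0 ?sqr_ge0.
Qed.

Lemma rep_mass u a b da db : rep u a b da db ->
  mass u = \int[mu]_x (a x ^+ 2 + b x ^+ 2).
Proof.
case=> re im mre mim ACa ACb [ma _] [mb _] _ _.
rewrite /mass; under eq_Rintegral do rewrite cabs_sqr.
apply: ae_Rint.
- by apply: measurable_funD; exact: measurable_funX.
- by apply: measurable_funD; exact: measurable_funX.
- by apply: ae_imp (ae_and re im) => x [-> ->].
Qed.

Lemma rep_H1norm u a b da db : rep u a b da db ->
  H1norm u = Num.sqrt (\int[mu]_x (da x ^+ 2 + db x ^+ 2 + (a x ^+ 2 + b x ^+ 2))).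
Proof.
move=> ru; have [e1 e2 m1 m2] := wderiv_ae (rep_weak_derivative ru).
case: ru => re im mre mim ACa ACb [ma _] [mb _] [ma' _] [mb' _].
rewrite /H1norm; congr Num.sqrt.
under eq_Rintegral do rewrite !cabs_sqr.
apply: ae_Rint.
- by do 2 apply: measurable_funD; exact: measurable_funX.
- by do 2 apply: measurable_funD; exact: measurable_funX.
- apply: ae_imp (ae_and (ae_and re im) (ae_and e1 e2)) => x.
  by move=> [[-> ->] [-> ->]].
Qed.

Definition edens (k theta p : R) (a b da db : R -> R) (x : R) : R :=
  2^-1 * (da x ^+ 2 + db x ^+ 2) + k * (a x * da x + b x * db x) ^+ 2
  - theta / p * (a x ^+ 2 + b x ^+ 2) `^ (p / 2).

Lemma sqrt_powR (s p : R) : 0 <= s -> Num.sqrt s `^ p = s `^ (p / 2).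
Proof. by move=> s0; rewrite -powR12_sqrt// -powRrM mulrC. Qed.

Lemma measurable_sqsum (f g : R -> R) : measurable_fun setT f -> measurable_fun setT g ->
  measurable_fun setT (fun x => f x ^+ 2 + g x ^+ 2).
Proof. by move=> mf mg; apply: measurable_funD; exact: measurable_funX. Qed.

Lemma measurable_edens k theta p a b da db : measurable_fun setT a ->
  measurable_fun setT b -> measurable_fun setT da -> measurable_fun setT db ->
  measurable_fun setT (edens k theta p a b da db).
Proof.
move=> ma mb ma' mb'; apply: measurable_funB.
  apply: measurable_funD.
    by apply: measurable_funM => //; exact: measurable_sqsum.
  apply: measurable_funM => //; apply: measurable_funX.
  by apply: measurable_funD; exact: measurable_funM.
apply: measurable_funM => //.
apply: (measurableT_comp (measurable_powR _)); exact: measurable_sqsum.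
Qed.

(** The weak derivative of |u|^2 is 2 (a a' + b b'), which turns the term
    k/4 |(|u|^2)'|^2 into k (a a' + b b')^2. *)
Lemma rep_energy k theta p u a b da db : rep u a b da db ->
  energy k theta p u = \int[mu]_x edens k theta p a b da db x.
Proof.
move=> ru; have [e1 e2 m1 m2] := wderiv_ae (rep_weak_derivative ru).
case: ru => re im mre mim ACa ACb [ma _] [mb _] [ma' _] [mb' _].
have ACq := AC_D (AC_sqr ACa) (AC_sqr ACb).
have msq : measurable_fun setT (fun x => Re (sqmod u x)).
  by under eq_fun do rewrite sqmodE /=; exact: measurable_sqsum.
have wdq : weak_derivative (sqmod u) (fun x => (2 * (a x * da x) + 2 * (b x * db x))%:C).
  apply/weak_derivativeP; split.
    apply: AC_wd ACq msq _; apply: ae_imp (ae_and re im) => x [-> ->].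
    by rewrite sqmodE.
  rewrite (_ : (fun x => Im (sqmod u x)) = fun=> 0); last first.
    by apply/funext => x; rewrite sqmodE.
  apply: AC_wd (AC_cst 0) _ _; first exact: measurable_cst.
  exact: aeW.
have [f1 f2 n1 n2] := wderiv_ae wdq.
rewrite /energy; apply: ae_Rint.
- under eq_fun do rewrite !cabs_sqr.
  apply: measurable_funB.
    apply: measurable_funD.
      by apply: measurable_funM => //; exact: measurable_sqsum.
    by apply: measurable_funM => //; exact: measurable_sqsum.
  apply: measurable_funM => //; apply: (measurableT_comp (measurable_powR _)).
  under eq_fun do rewrite cabsE.
  apply: (measurableT_comp (continuous_measurable_fun (@sqrt_continuous R))).
  exact: measurable_sqsum.
- exact: measurable_edens.
apply: ae_imp (ae_and (ae_and re im) (ae_and (ae_and e1 e2) (ae_and f1 f2))) => x.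
move=> [[r1 r2] [[g1 g2] [h1 h2]]].
rewrite !cabs_sqr g1 g2 h1 h2 cabsE -r1 -r2 /edens /=.
rewrite sqrt_powR ?addr_ge0 ?sqr_ge0//.
by congr (_ - _); field.
Qed.

Lemma rep_shift c u a b da db : rep u a b da db ->
  rep (fun x => u (x + c)) (fun x => a (x + c)) (fun x => b (x + c))
      (fun x => da (x + c)) (fun x => db (x + c)).
Proof.
case=> re im mre mim ACa ACb la lb la' lb'; split.
- exact: (@ae_shift _ c (fun x => a x = Re (u x)) re).
- exact: (@ae_shift _ c (fun x => b x = Im (u x)) im).
- by apply: (@measurableT_comp _ _ _ _ _ _ (fun x => Re (u x))) => //; exact: measurable_shift.
- by apply: (@measurableT_comp _ _ _ _ _ _ (fun x => Im (u x))) => //; exact: measurable_shift.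
- exact: AC_shift.
- exact: AC_shift.
- exact: L2_shift.
- exact: L2_shift.
- exact: L2_shift.
- exact: L2_shift.
Qed.

Lemma AC_lin (s t : R) f1 g1 f2 g2 : AC f1 g1 -> AC f2 g2 ->
  AC (fun x => s * f1 x + t * f2 x) (fun x => s * g1 x + t * g2 x).
Proof. by move=> h1 h2; apply: AC_D; exact: AC_Z. Qed.

Lemma rep_cis eta u a b da db : rep u a b da db ->
  rep (fun x => cis eta * u x)
      (fun x => cos eta * a x + - sin eta * b x)
      (fun x => sin eta * a x + cos eta * b x)
      (fun x => cos eta * da x + - sin eta * db x)
      (fun x => sin eta * da x + cos eta * db x).
Proof.
have ER v x : Re (cis eta * v x) = cos eta * Re (v x) + - sin eta * Im (v x).
  by case: (v x) => p q /=; rewrite mulNr.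
have EI v x : Im (cis eta * v x) = sin eta * Re (v x) + cos eta * Im (v x).
  by case: (v x) => p q /=; rewrite addrC.
case=> re im mre mim ACa ACb la lb la' lb'; split.
- by apply: ae_imp (ae_and re im) => x [-> ->]; rewrite ER.
- by apply: ae_imp (ae_and re im) => x [-> ->]; rewrite EI.
- under eq_fun do rewrite ER.
  by apply: measurable_funD; exact: measurable_funM.
- under eq_fun do rewrite EI.
  by apply: measurable_funD; exact: measurable_funM.
- exact: AC_lin.
- exact: AC_lin.
- exact: L2_lin.
- exact: L2_lin.
- exact: L2_lin.
- exact: L2_lin.
Qed.

Lemma rep_B u a b da db w c d dc dd : rep u a b da db -> rep w c d dc dd ->
  rep (fun x => u x - w x) (fun x => a x - c x) (fun x => b x - d x)
      (fun x => da x - dc x) (fun x => db x - dd x).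
Proof.
have l2B f g : L2 f -> L2 g -> L2 (fun x => f x - g x).
  move=> lf lg; have := L2_lin 1 (-1) lf lg.
  by under eq_fun do rewrite mul1r mulN1r.
have ER v1 v2 x : Re (v1 x - v2 x) = Re (v1 x) - Re (v2 x).
  by case: (v1 x) => ? ?; case: (v2 x).
have EI v1 v2 x : Im (v1 x - v2 x) = Im (v1 x) - Im (v2 x).
  by case: (v1 x) => ? ?; case: (v2 x).
case=> re im mre mim ACa ACb la lb la' lb'.
case=> wre wim wmre wmim ACc ACd lc ld lc' ld'; split.
- by apply: ae_imp (ae_and re wre) => x [-> ->]; rewrite ER.
- by apply: ae_imp (ae_and im wim) => x [-> ->]; rewrite EI.
- by under eq_fun do rewrite ER; exact: measurable_funB.
- by under eq_fun do rewrite EI; exact: measurable_funB.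
- exact: AC_B.
- exact: AC_B.
- exact: l2B.
- exact: l2B.
- exact: l2B.
- exact: l2B.
Qed.

End Representatives.

(** * The action and the mass as functions of the peak *)

Section Powers.
Context {R : realType}.
Implicit Types (a q r s t x y z w : R) (f g : R -> R).

Lemma d_powR a x : 0 < x -> is_derive x 1 (fun y => y `^ a) (a * x `^ (a - 1)).
Proof.
move=> x0; have xin : x \in `]0, +oo[%R by rewrite in_itv/= x0.
apply: DeriveDef; first exact: derivable_powR.
by rewrite -derive1E powR_derive1.
Qed.

Lemma continuous_pw a : 0 <= a -> continuous (fun t : R => `|t| `^ a).
Proof.
rewrite le_eqVlt => /predU1P[<-|a0] t.
  by under eq_fun do rewrite powRr0; exact: cvg_cst.
have [t0|t0] := ltP 0 `|t|.
  apply: (@continuous_comp _ _ _ (fun t : R => `|t|) (fun s => s `^ a)).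
    exact: norm_continuous.
  exact: d_cont (d_powR a t0).
have -> : t = 0 by apply/normr0_eq0/le_anti; rewrite t0 normr_ge0.
apply/cvgrPdist_lt => e e0; rewrite normr0 powR0 ?gt_eqF//.
near=> s; rewrite sub0r normrN ger0_norm ?powR_ge0//.
have : `|s| < e `^ a^-1.
  near: s; exists (e `^ a^-1) => /=; first exact: powR_gt0.
  by move=> s; rewrite /ball_/= sub0r normrN.
move=> h; have := gt0_ltr_powR a0 (normr_ge0 s) (powR_ge0 e a^-1) h.
by rewrite -powRrM mulVf ?gt_eqF// powRr1// ltW.
Unshelve. all: by end_near. Qed.

Lemma d_sqrt f x a : 0 < f x -> is_derive x 1 f a ->
  is_derive x 1 (fun y : R => Num.sqrt (f y)) (a / (2 * Num.sqrt (f x))).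
Proof.
move=> fx0 df; apply: d_eq (dcomp (is_derive1_sqrt fx0) df) _.
by rewrite mulrC.
Qed.

Lemma continuous_sqrt f : continuous f -> continuous (fun x : R => Num.sqrt (f x)).
Proof. by move=> cf x; apply: continuous_comp; [exact: cf|exact: sqrt_continuous]. Qed.

(** F has slope l with respect to G, and l is increasing, so F is convex as a
    function of G and lies above its tangent at x. *)
Lemma tangent_mono (F G l g : R -> R) x y :
  0 < x -> 0 < y ->
  (forall z, 0 < z -> is_derive z 1 F (l z * g z)) ->
  (forall z, 0 < z -> is_derive z 1 G (g z)) ->
  (forall z, 0 < z -> 0 <= g z) ->
  (forall z w, 0 < z -> z <= w -> l z <= l w) ->
  l x * (G y - G x) <= F y - F x.
Proof.
move=> x0 y0 dF dG g0 lmono.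
pose D z := F z - l x * G z.
have dD' z : 0 < z -> is_derive z 1 D ((l z - l x) * g z).
  move=> z0; apply: d_eq (dB (dF z z0) (dZ (l x) (dG z z0))) _; ring.
have cD z : 0 < z -> {for z, continuous D} by move=> /dD'; exact: d_cont.
suff : D x <= D y by rewrite /D; lra.
have [xy|yx] := leP x y.
- have [] := @MVT_segment R D (fun z => (l z - l x) * g z) x y xy.
  + by move=> z; rewrite in_itv/= => /andP[xz _]; apply: dD'; exact: lt_trans xz.
  + apply: continuous_in_subspaceT => z; rewrite inE/= in_itv/= => /andP[xz _].
    by apply: cD; exact: lt_le_trans xz.
  move=> z; rewrite in_itv/= => /andP[xz zy] E.
  rewrite -subr_ge0 E; have z0 := lt_le_trans x0 xz.
  by rewrite !mulr_ge0 ?g0 ?subr_ge0// lmono.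
- have [] := @MVT_segment R D (fun z => (l z - l x) * g z) y x (ltW yx).
  + by move=> z; rewrite in_itv/= => /andP[xz _]; apply: dD'; exact: lt_trans xz.
  + apply: continuous_in_subspaceT => z; rewrite inE/= in_itv/= => /andP[xz _].
    by apply: cD; exact: lt_le_trans xz.
  move=> z; rewrite in_itv/= => /andP[yz zx] E.
  rewrite -subr_le0 E; have z0 := lt_le_trans y0 yz.
  have h1 := lmono _ _ z0 zx; have h2 := g0 _ z0.
  by rewrite -oppr_ge0 -mulNr -mulNr opprB !mulr_ge0 ?subr_ge0 ?h2// ltW.
Qed.

End Powers.

Section Actions.
Context {R : realType}.
Local Notation mu := (@lebesgue_measure R).
Context (k c r : R).
Hypotheses (k0 : 0 < k) (c0 : 0 < c) (r1 : 1 <= r) (r2 : r < 2).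
Implicit Types (q t x y Q : R).

Local Ltac slra := first [ lra | have := r1; lra | have := r2; lra
  | have := r1; have := r2; lra | have := k0; lra | have := k0; have := r1; lra ].
Local Ltac snra := first [ nra | have := k0; nra | have := r1; nra
  | have := k0; have := r1; nra ].

(** With q = |u|^2, the factor sqrt (1 + 2 k q) measures the quasilinear
    stretching: for real u, the derivative terms of the energy add up to
    1/2 (1 + 2 k q) |u'|^2. *)
Definition sq2 q : R := Num.sqrt (1 + 2 * k * `|q|).
(** The function m for which the derivative of P sq2(P) rho along the profile is
    r c Q^r P + m(P) rho P', see the virial identity below. *)
Definition mfun q : R := (1 + r / 2) * sq2 q + (sq2 q - (sq2 q)^-1) / 2.
Definition wfun t : R := Num.sqrt (1 - `|t| `^ r).
Definition lfun t Q : R := r^-1 * Q `^ (1 - r / 2) * mfun (Q * t).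
Definition jfun t Q : R := Q `^ (1 + r / 2) * sq2 (Q * t).
(** Half the mass of the profile of peak Q.  Directly it is the integral over
    [0, Q] of sqrt (1 + 2 k q) / (2 c sqrt (Q^r - q^r)), which is singular at
    q = Q; the virial identity replaces it by (r c Q^r)^-1 times the integral of
    sqrt (Q^r - q^r) m(q), here rescaled to [0, 1]. *)
Definition Lmass Q : R := c^-1 * \int[mu]_(t in `[0, 1]) (wfun t * lfun t Q).
(** The integral over [0, Q] of c sqrt ((Q^r - q^r) (1 + 2 k q)), rescaled to
    [0, 1]. *)
Definition Jact Q : R := c * \int[mu]_(t in `[0, 1]) (wfun t * jfun t Q).

Lemma sq2_ge1 q : 1 <= sq2 q.
Proof.
have h : 0 <= 2 * k * `|q| by rewrite !mulr_ge0// ltW.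
by rewrite -[leLHS]sqrtr1 ler_sqrt; slra.
Qed.

Lemma sq2_gt0 q : 0 < sq2 q.
Proof. exact: lt_le_trans (sq2_ge1 q). Qed.

Lemma sq2_sqr q : sq2 q ^+ 2 = 1 + 2 * k * `|q|.
Proof.
have h : 0 <= 2 * k * `|q| by rewrite !mulr_ge0// ltW.
by rewrite sqr_sqrtr//; slra.
Qed.

Lemma sq2_mono x y : 0 <= x -> x <= y -> sq2 x <= sq2 y.
Proof.
move=> x0 xy; have h : 0 <= 2 * k * `|y| by rewrite !mulr_ge0// ltW.
rewrite ler_sqrt; last slra.
by rewrite !ger0_norm ?(le_trans x0)// lerD2l ler_pM2l// mulr_gt0.
Qed.

Lemma sq2_lip x y : 0 <= x -> x <= y -> sq2 y - sq2 x <= k * (y - x).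
Proof.
move=> x0 xy; have := sq2_sqr x; have := sq2_sqr y.
rewrite !ger0_norm ?(le_trans x0)//; have := sq2_mono x0 xy.
have := sq2_ge1 x; have := sq2_ge1 y; snra.
Qed.

Lemma mfun_mono x y : 0 <= x -> x <= y -> mfun x <= mfun y.
Proof.
move=> x0 xy; rewrite /mfun; have h := sq2_mono x0 xy.
have hV : (sq2 y)^-1 <= (sq2 x)^-1 by rewrite lef_pV2// posrE sq2_gt0.
snra.
Qed.

Lemma mfun_lip x y : 0 <= x -> x <= y -> mfun y - mfun x <= 3 * k * (y - x).
Proof.
move=> x0 xy; rewrite /mfun; have h := sq2_lip x0 xy; have h' := sq2_mono x0 xy.
have hV : (sq2 x)^-1 - (sq2 y)^-1 <= sq2 y - sq2 x.
  have X1 := sq2_ge1 x; have Y1 := sq2_ge1 y.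
  have X0 := sq2_gt0 x; have Y0 := sq2_gt0 y.
  have -> : (sq2 x)^-1 - (sq2 y)^-1 = (sq2 y - sq2 x) / (sq2 x * sq2 y).
    by field; rewrite !gt_eqF.
  rewrite ler_pdivrMr ?mulr_gt0// ler_peMr ?subr_ge0//; nra.
have h3 : (2 + r / 2) * (sq2 y - sq2 x) <= 3 * (sq2 y - sq2 x).
  by rewrite ler_wpM2r ?subr_ge0//; slra.
lra.
Qed.

Lemma mfun_ge1 x : 0 <= x -> 1 <= mfun x.
Proof.
move=> x0; rewrite /mfun; have X1 := sq2_ge1 x.
have : (sq2 x)^-1 <= 1 by rewrite invf_le1 ?sq2_gt0.
snra.
Qed.

Lemma continuous_sq2 : continuous sq2.
Proof.
apply: continuous_sqrt => q; apply: cvgD; first exact: cvg_cst.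
by apply: cvgMr; exact: norm_continuous.
Qed.

Lemma continuous_mfun : continuous mfun.
Proof.
move=> q; apply: cvgD; first by apply: cvgMr; exact: continuous_sq2.
apply: cvgMl; apply: cvgB; first exact: continuous_sq2.
apply: cvgV; first by rewrite gt_eqF// sq2_gt0.
exact: continuous_sq2.
Qed.

Lemma continuous_wfun : continuous wfun.
Proof.
apply: continuous_sqrt => q; apply: cvgB; first exact: cvg_cst.
by apply: continuous_pw; slra.
Qed.

Lemma continuous_mulfun (f g : R -> R) : continuous f -> continuous g ->
  continuous (fun x => f x * g x).
Proof. by move=> cf cg x; apply: cvgM; [exact: cf|exact: cg]. Qed.

Lemma continuous_scal (f : R -> R) s : continuous f -> continuous (fun x => f (s * x)).
Proof.
move=> cf x; apply: (@continuous_comp _ _ _ (fun x : R => s * x) f); last exact: cf.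
by apply: cvgMr; exact: cvg_id.
Qed.

Lemma L1loc_wl Q : L1loc (fun t => wfun t * lfun t Q).
Proof.
apply: L1_cont_cc; apply: continuous_mulfun; first exact: continuous_wfun.
apply: continuous_mulfun; first by move=> x; exact: cvg_cst.
exact: continuous_scal continuous_mfun.
Qed.

Lemma L1loc_wj Q : L1loc (fun t => wfun t * jfun t Q).
Proof.
apply: L1_cont_cc; apply: continuous_mulfun; first exact: continuous_wfun.
apply: continuous_mulfun; first by move=> x; exact: cvg_cst.
exact: continuous_scal continuous_sq2.
Qed.

Lemma lfun_mono t x y : 0 <= t -> 0 < x -> x <= y -> lfun t x <= lfun t y.
Proof.
move=> t0 x0 xy; rewrite /lfun.
have m1 : 0 <= mfun (x * t) by apply: le_trans (mfun_ge1 _); rewrite ?mulr_ge0// ltW.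
have rV : 0 <= r^-1 by rewrite invr_ge0; slra.
apply: ler_pM => //.
- by rewrite mulr_ge0// powR_ge0.
- rewrite ler_wpM2l// ge0_ler_powR ?nnegrE//; [slra|exact: ltW|exact: (le_trans (ltW x0))].
- by apply: mfun_mono; [rewrite mulr_ge0// ltW|rewrite ler_wpM2r].
Qed.

Lemma tangent_jl t x y : 0 <= t -> 0 < x -> 0 < y ->
  lfun t x * (y `^ r - x `^ r) <= jfun t y - jfun t x.
Proof.
move=> t0 x0 y0.
apply: (@tangent_mono _ (jfun t) (fun z => z `^ r) (lfun t) (fun z => r * z `^ (r - 1))) => //.
- move=> z z0.
  have zt : 0 <= z * t by rewrite mulr_ge0// ltW.
  have ds : is_derive z 1 (fun Q : R => sq2 (Q * t)) (2 * k * t / (2 * sq2 (z * t))).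
    have := @d_sqrt _ (fun Q => 1 + 2 * k * (Q * t)) z (2 * k * t).
    have E1 : 0 <= 2 * k * (z * t) by rewrite !mulr_ge0// ltW.
    move=> /(_ ltac:(slra)).
    have dl : is_derive z 1 (fun Q => 1 + 2 * k * (Q * t)) (2 * k * t).
      apply: d_eq (dD (dcst 1 z) (dZ (2 * k) (dM (did z) (dcst t z)))) _; ring.
    move=> /(_ dl); rewrite /sq2 ger0_norm//; apply: d_near.
    near=> Q; rewrite ger0_norm// mulr_ge0//; apply: ltW; near: Q.
    exact: lt_nbhsr.
  apply: d_eq (dM (d_powR (1 + r / 2) z0) ds) _.
  rewrite /lfun /mfun.
  have s0 := sq2_gt0 (z * t); have := sq2_sqr (z * t); rewrite ger0_norm//.
  set s := sq2 (z * t) => s2.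
  have -> : 1 + r / 2 - 1 = r / 2 by ring.
  have -> : z `^ (1 + r / 2) = z * z `^ (r / 2).
    by rewrite powRD ?(gt_eqF z0) ?implybT// powRr1 ?ltW.
  have -> : r^-1 * z `^ (1 - r / 2) * ((1 + r / 2) * s + (s - s^-1) / 2) * (r * z `^ (r - 1)) =
     (z `^ (1 - r / 2) * z `^ (r - 1)) * ((1 + r / 2) * s + (s - s^-1) / 2).
    by field; rewrite !gt_eqF//; slra.
  rewrite -powRD; last by rewrite (gt_eqF z0) implybT.
  have -> : 1 - r / 2 + (r - 1) = r / 2 by field.
  have zE : z * t = (s ^+ 2 - 1) / (2 * k) by rewrite s2; field; rewrite gt_eqF.
  transitivity (z `^ (r / 2) * (k * (z * t) / s + (1 + r / 2) * s)).
    by field; rewrite gt_eqF.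
  by rewrite zE; field; rewrite !gt_eqF.
- by move=> z z0; rewrite mulr_ge0 ?powR_ge0//; slra.
- by move=> z w z0 zw; apply: lfun_mono.
Unshelve. all: by end_near. Qed.

Lemma wfun_ge0 t : 0 <= wfun t.
Proof. exact: sqrtr_ge0. Qed.

(** For each t the integrand jfun t is a function of Q^r with slope lfun t Q,
    which is increasing in Q since r < 2. *)
Lemma Jact_tangent x y : 0 < x -> 0 < y ->
  c ^+ 2 * Lmass x * (y `^ r - x `^ r) <= Jact y - Jact x.
Proof.
move=> x0 y0; rewrite /Jact /Lmass -mulrBr.
have -> : c ^+ 2 * (c^-1 * \int[mu]_(t in `[0, 1]) (wfun t * lfun t x)) * (y `^ r - x `^ r)
  = c * (\int[mu]_(t in `[0, 1]) ((wfun t * lfun t x) * (y `^ r - x `^ r))).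
  rewrite RintegralZr//; last exact: L1loc_wl.
  by field; rewrite gt_eqF.
rewrite ler_pM2l// -RintegralB//; [|exact: L1loc_wj|exact: L1loc_wj].
apply: le_Rintegral => //.
- apply: (L1_cont_cc (f := fun t => wfun t * lfun t x * (y `^ r - x `^ r))).
  apply: continuous_mulfun; last by move=> ?; exact: cvg_cst.
  apply: continuous_mulfun; first exact: continuous_wfun.
  apply: continuous_mulfun; first by move=> ?; exact: cvg_cst.
  exact: continuous_scal continuous_mfun.
- have := L1locD (L1loc_wj y) (L1locZ (-1) (L1loc_wj x)).
  rewrite (_ : (fun t => _) = (fun t => wfun t * jfun t y - wfun t * jfun t x)) => [|//]; last by apply/funext => t; rewrite mulN1r.
  exact.
- move=> t /=; rewrite in_itv/= => /andP[t0 t1].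
  by rewrite -mulrBr -mulrA ler_wpM2l ?wfun_ge0// tangent_jl.
Qed.

(** The part of Lmass that stays bounded away from 0: Lmass Q is Q^(1 - r/2) Dm Q
    up to a constant. *)
Definition Dm Q : R := \int[mu]_(t in `[0, 1]) (wfun t * mfun (Q * t)).

Lemma L1loc_wm Q : L1loc (fun t => wfun t * mfun (Q * t)).
Proof.
apply: L1_cont_cc; apply: continuous_mulfun; first exact: continuous_wfun.
exact: continuous_scal continuous_mfun.
Qed.

Lemma LmassE Q : Lmass Q = (r * c)^-1 * Q `^ (1 - r / 2) * Dm Q.
Proof.
rewrite /Lmass /Dm.
have -> : \int[mu]_(t in `[0, 1]) (wfun t * lfun t Q) =
   r^-1 * Q `^ (1 - r / 2) * \int[mu]_(t in `[0, 1]) (wfun t * mfun (Q * t)).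
  rewrite -RintegralZl//; last exact: L1loc_wm.
  by apply: eq_Rintegral => t _; rewrite /lfun; ring.
by rewrite invfM !mulrA [c^-1 * _]mulrC.
Qed.

Lemma Dm_mono x y : 0 <= x -> x <= y -> Dm x <= Dm y.
Proof.
move=> x0 xy; apply: le_Rint_itv; [exact: L1loc_wm|exact: L1loc_wm|].
move=> t t0 t1; rewrite ler_wpM2l ?wfun_ge0//; apply: mfun_mono.
  by rewrite mulr_ge0.
by rewrite ler_wpM2r.
Qed.

Lemma wfun_le1 t : wfun t <= 1.
Proof. by rewrite -[leRHS]sqrtr1 ler_sqrt// gerBl powR_ge0. Qed.

Lemma Dm_lip x y : 0 <= x -> x <= y -> Dm y - Dm x <= 3 * k * (y - x).
Proof.
move=> x0 xy; rewrite /Dm -RintegralB//; [|exact: L1loc_wm|exact: L1loc_wm].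
have -> : 3 * k * (y - x) = \int[mu]_(t in `[0, 1]) (3 * k * (y - x)).
  by rewrite Rint_itv_cst//; ring.
have lc : L1loc (fun=> 3 * k * (y - x)) by apply: L1_cont_cc => ?; exact: cvg_cst.
have ld : L1loc (fun t => wfun t * mfun (y * t) - wfun t * mfun (x * t)).
  have := L1locD (L1loc_wm y) (L1locZ (-1) (L1loc_wm x)).
  by under eq_fun do rewrite mulN1r.
apply: le_Rint_itv => // t t0 t1; rewrite -mulrBr.
have xt : 0 <= x * t by rewrite mulr_ge0.
have xyt : x * t <= y * t by rewrite ler_wpM2r.
have h1 := mfun_lip xt xyt; have h2 := mfun_mono xt xyt.
have h3 := wfun_le1 t; have h4 := wfun_ge0 t.
have h5 : k * (y - x) * t <= k * (y - x) by rewrite ler_piMr// mulr_ge0 ?subr_ge0// ltW.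
have h6 : wfun t * (mfun (y * t) - mfun (x * t)) <= mfun (y * t) - mfun (x * t).
  by rewrite ler_piMl// subr_ge0.
slra.
Qed.

(** A lower bound of Dm, from wfun >= sqrt (1/2) and mfun >= 1 on [0, 1/2]. *)
Definition w0 : R := 2^-1 * Num.sqrt 2^-1.

Lemma w0_gt0 : 0 < w0.
Proof. by rewrite /w0 mulr_gt0 ?sqrtr_gt0 ?invr_gt0. Qed.

Lemma Dm_ge x : 0 <= x -> w0 <= Dm x.
Proof.
move=> x0; rewrite /Dm.
have h01 : 0 <= 2^-1 :> R by rewrite invr_ge0.
have h12 : 2^-1 <= 1 :> R by rewrite invf_le1 ?ler1n.
rewrite (Rint_split (L1loc_wm x) h01 h12).
rewrite -[leLHS]addr0; apply: lerD.
  have -> : w0 = \int[mu]_(t in `[0, 2^-1]) Num.sqrt 2^-1.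
    by rewrite Rint_itv_cst// subr0 mulrC.
  apply: le_Rint_itv; [by apply: L1_cont_cc => ?; exact: cvg_cst|exact: L1loc_wm|].
  move=> t t0 t1.
  have m1 := mfun_ge1 (mulr_ge0 x0 t0).
  apply: (@le_trans _ _ (wfun t)); last by rewrite ler_peMr ?wfun_ge0.
  rewrite /wfun ler_sqrt; last first.
    rewrite subr_ge0 ger0_norm//; have := ge0_ler_powR (_ : 0 <= r) t0 ler01 (le_trans t1 h12).
    by rewrite powR1; apply; slra.
  rewrite ger0_norm//; suff : t `^ r <= t by slra.
  move: t0; rewrite le_eqVlt => /predU1P[<-|t0]; first by rewrite powR0// gt_eqF//; slra.
  by apply: ge1r_powR => //; rewrite t0 (le_trans t1).
apply: Rintegral_ge0 => t; rewrite /= in_itv/= => /andP[t0 _].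
rewrite mulr_ge0 ?wfun_ge0//; apply: le_trans (mfun_ge1 _) => //.
by rewrite mulr_ge0// (le_trans h01).
Qed.

Lemma Lmass_mono x y : 0 < x -> x < y -> Lmass x < Lmass y.
Proof.
move=> x0 xy; rewrite !LmassE -!mulrA.
have rc : 0 < (r * c)^-1 by rewrite invr_gt0 mulr_gt0//; slra.
rewrite ltr_pM2l//.
have Dx := Dm_ge (ltW x0); have Dxy := Dm_mono (ltW x0) (ltW xy); have W := w0_gt0.
have D0 : 0 < Dm x by slra.
apply: (@lt_le_trans _ _ (y `^ (1 - r / 2) * Dm x)).
  rewrite ltr_pM2r//; apply: gt0_ltr_powR => //; rewrite ?nnegrE; slra.
by rewrite ler_wpM2l// powR_ge0.
Qed.

(** Since r < 2, that is p < 6, the exponent 1 - r/2 is positive and the power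
    Q^(1 - r/2) takes Lmass from 0 to infinity. *)
Lemma Lmass_surj l : 0 < l -> exists2 Q, 0 < Q & Lmass Q = l.
Proof.
move=> l0.
have e0 : 0 < 1 - r / 2 by slra.
have rc0 : 0 < r * c by rewrite mulr_gt0//; slra.
have W := w0_gt0.
have invE s : 0 <= s -> (s `^ (1 - r / 2)^-1) `^ (1 - r / 2) = s.
  by move=> s0; rewrite -powRrM mulVf ?gt_eqF// powRr1.
pose b := (l * (r * c) / w0) `^ (1 - r / 2)^-1.
have b0 : 0 < b by apply: powR_gt0; rewrite divr_gt0// mulr_gt0.
have Lb : l <= Lmass b.
  rewrite LmassE invE; last by apply: divr_ge0; [apply: mulr_ge0|]; exact: ltW.
  have Db := Dm_ge (ltW b0).
  have -> : (r * c)^-1 * (l * (r * c) / w0) * Dm b = l * (Dm b / w0).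
    by field; rewrite !gt_eqF//; slra.
  by rewrite ler_peMr ?(ltW l0)// ler_pdivlMr// mul1r.
pose C := Dm b + 1.
have C0 : 0 < C by have := Dm_ge (ltW b0); rewrite /C; slra.
pose a := Num.min b ((l * (r * c) / C) `^ (1 - r / 2)^-1).
have a0 : 0 < a by rewrite /a lt_min b0 powR_gt0// divr_gt0// mulr_gt0.
have ab : a <= b by rewrite /a ge_min lexx.
have La : Lmass a <= l.
  rewrite LmassE.
  have Da := Dm_mono (ltW a0) ab.
  have D0 := Dm_ge (ltW a0).
  have pa : a `^ (1 - r / 2) <= l * (r * c) / C.
    rewrite -[leRHS]invE; last by apply: divr_ge0; [apply: mulr_ge0|]; exact: ltW.
    apply: ge0_ler_powR; rewrite ?nnegrE ?powR_ge0//; [slra|exact: ltW|].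
    by rewrite /a ge_min lexx orbT.
  apply: (@le_trans _ _ ((r * c)^-1 * (l * (r * c) / C) * C)); last first.
    by rewrite le_eqVlt; apply/orP; left; apply/eqP; field; rewrite !gt_eqF//; slra.
  apply: ler_pM => //.
  - by rewrite mulr_ge0 ?powR_ge0// invr_ge0 ltW.
  - slra.
  - by rewrite ler_wpM2l// invr_ge0 ltW.
  - by rewrite /C; slra.
have cL : {within `[a, b], continuous Lmass}.
  apply: continuous_in_subspaceT => x; rewrite inE/= in_itv/= => /andP[ax xb].
  have x0 := lt_le_trans a0 ax.
  have -> : Lmass = (fun Q => (r * c)^-1 * Q `^ (1 - r / 2) * Dm Q).
    by apply/funext => Q; exact: LmassE.
  apply: cvgM; first by apply: cvgMr; exact: d_cont (d_powR _ x0).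
  have k3 : 0 < 3 * k by slra.
  apply/cvgrPdist_lt => e ee0; near=> y.
  have y0 : 0 <= y by apply: ltW; near: y; exact: lt_nbhsr.
  have yx : `|x - y| < e / (3 * k).
    near: y; exists (e / (3 * k)); [by rewrite /= divr_gt0|by move=> y].
  rewrite ltr_pdivlMr// in yx.
  have [xy|/ltW xy] := leP x y.
    rewrite distrC ger0_norm ?subr_ge0 ?Dm_mono// 1?ltW//.
    apply: le_lt_trans (Dm_lip _ xy) _; first exact: ltW.
    by rewrite mulrC; move: yx; rewrite distrC ger0_norm ?subr_ge0.
  rewrite ger0_norm ?subr_ge0 ?Dm_mono//.
  apply: le_lt_trans (Dm_lip y0 xy) _.
  by rewrite mulrC; move: yx; rewrite ger0_norm ?subr_ge0.
have [|Q] := @IVT R Lmass a b l ab cL.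
  by rewrite ge_min La le_max Lb orbT.
rewrite in_itv/= => /andP[aQ _] E; exists Q => //; exact: lt_le_trans aQ.
Unshelve. all: by end_near. Qed.

End Actions.

(** * The profile *)

Section Inverse.
Context {R : realType}.

Lemma cvg0_le (f g : nat -> R) : (forall n, `|f n| <= g n) ->
  g n @[n --> \oo] --> (0 : R) -> f n @[n --> \oo] --> (0 : R).
Proof.
move=> fg /cvgrPdist_lt g0; apply/cvgrPdist_lt => e e0.
have := g0 e e0; apply: filterS => n; rewrite !sub0r !normrN => gn.
by apply: le_lt_trans gn; apply: le_trans (ler_norm _); exact: fg.
Qed.

Lemma C1_inverse (X g : R -> R) (e : R) : 0 < e ->
  (forall y : R, is_derive y 1 X (g y)) -> (forall y : R, e <= g y) ->
  exists Y : R -> R, (forall x, X (Y x) = x) /\ (forall y, Y (X y) = y) /\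
    forall x : R, is_derive x 1 Y (g (Y x))^-1.
Proof.
move=> e0 dX ge.
have cX : continuous X by move=> y; exact: d_cont (dX y).
have grow y z : y <= z -> e * (z - y) <= X z - X y.
  move=> yz; have [] := @MVT_segment R X g y z yz.
  - exact: continuous_subspaceT.
  by move=> x _ ->; rewrite ler_wpM2r// subr_ge0.
have inj : injective X.
  move=> y z E; apply/le_anti/andP; split; rewrite leNgt; apply/negP => h.
    have := grow _ _ (ltW h); have : 0 < e * (y - z) by rewrite mulr_gt0// subr_gt0.
    by rewrite E subrr; lra.
  have := grow _ _ (ltW h); have : 0 < e * (z - y) by rewrite mulr_gt0// subr_gt0.
  by rewrite E subrr; lra.
have surj x : exists y, X y = x.
  pose N := (`|x| + `|X 0|) / e.
  have N0 : 0 <= N by rewrite divr_ge0// ?addr_ge0// ltW.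
  have eN : e * N = `|x| + `|X 0| by rewrite /N mulrCA mulfV ?gt_eqF// mulr1.
  have h1 := grow 0 N N0; have h2 := grow (- N) 0 ltac:(lra).
  have h3 := ler_norm x; have h4 := ler_norm (X 0).
  have h5 := ler_norm (- x); have h6 := ler_norm (- X 0).
  rewrite !normrN in h5 h6.
  have xN : X (- N) <= x by nra.
  have Nx : x <= X N by nra.
  have [|||y _ <-] := @IVT R X (- N) N x; last by exists y.
  - lra.
  - exact: continuous_subspaceT.
  - by rewrite ge_min xN le_max Nx orbT.
have [Y YK] := choice surj.
have KY y : Y (X y) = y by apply: inj; rewrite YK.
exists Y; split => //; split => // x.
rewrite -{1}(YK x); apply: is_derive_inverse.
- by near=> y.
- by near=> y; exact: cX.
- by rewrite gt_eqF// (lt_le_trans e0).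
Unshelve. all: by end_near. Qed.

End Inverse.

Section Profile.
Context {R : realType}.
Local Notation mu := (@lebesgue_measure R).
Context (k c r : R).
Hypotheses (k0 : 0 < k) (c0 : 0 < c) (r1 : 1 <= r).
Implicit Types (q t x y Q : R).
Local Notation sq2 := (sq2 k).
Local Notation mfun := (mfun k r).

Local Ltac slra := first [ lra | have := r1; lra | have := k0; have := r1; lra ].

Definition csh y : R := (expR y + expR (- y)) / 2.
Definition tnh y : R := (expR y - expR (- y)) / (expR y + expR (- y)).

Lemma csh_gt0 y : 0 < csh y.
Proof. by rewrite /csh divr_gt0// addr_gt0// expR_gt0. Qed.

Lemma d_expN y : is_derive y 1 (fun z => expR (- z)) (- expR (- y)).
Proof.
have : is_derive y 1 (fun z : R => - z) (- 1) by exact: is_deriveNid.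
by move=> h; apply: d_eq (dcomp (is_derive_expR _) h) _; rewrite mulrN1.
Qed.

Lemma d_csh y : is_derive y 1 csh (tnh y * csh y).
Proof.
apply: d_eq (dM (dD (is_derive_expR y) (d_expN y)) (dcst 2^-1 y)) _.
have := csh_gt0 y; rewrite /csh /tnh; set s := expR y + _ => s0.
have sn : s != 0 by rewrite gt_eqF//; move: s0; rewrite pmulr_lgt0 ?invr_gt0.
by field.
Qed.

Lemma tnh_csh y : tnh y ^+ 2 + (csh y) ^- 2 = 1.
Proof.
have h1 := expR_gt0 y; have h2 := expRxMexpNx_1 y.
have h3 : expR (- y) = (expR y)^-1 by rewrite expRN.
rewrite /tnh /csh h3; field.
by rewrite !gt_eqF//= addr_gt0 ?exprn_gt0.
Qed.

Lemma d_tnh y : is_derive y 1 tnh ((csh y) ^- 2).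
Proof.
have h1 := expR_gt0 y; have h3 : expR (- y) = (expR y)^-1 by rewrite expRN.
have s0 : expR y + expR (- y) != 0 by rewrite gt_eqF// addr_gt0// expR_gt0.
apply: d_eq (dM (dB (is_derive_expR y) (d_expN y))
  (@dV _ (fun z => expR z + expR (- z)) y _ s0
     (dD (is_derive_expR y) (d_expN y)))) _.
rewrite /csh h3; field.
by rewrite !gt_eqF//= addr_gt0 ?exprn_gt0.
Qed.

(** With P = U^2, the second unknown rho is sgn(x) sqrt (Q^r - P^r), and the
    first equation says that the residual of U vanishes.  Keeping rho as an
    unknown makes the system smooth at the peak, where the square root is not
    Lipschitz and the scalar equation also has the constant solution. *)
Record profile Q (U rho : R -> R) : Prop := Profile {
  profile_dU : forall x, is_derive x 1 U (- (c * rho x / sq2 (U x ^+ 2)) * U x);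
  profile_drho : forall x,
    is_derive x 1 rho (r * c * (U x ^+ 2) `^ r / sq2 (U x ^+ 2));
  profile_eq : forall x, rho x ^+ 2 + (U x ^+ 2) `^ r = Q `^ r;
  profile_gt0 : forall x, 0 < U x;
  profile_U0 : U 0 = Num.sqrt Q;
  profile_rho0 : rho 0 = 0 }.

(** In the variable y with dx = (r c K)^-1 sq2(u^2) dy the stretching disappears
    and the system is that of the semilinear equation, solved by
    u = sqrt Q (cosh y)^(-1/r) and rho = K tanh y with K = Q^(r/2). *)
Lemma profile_exists Q : 0 < Q -> exists U rho, profile Q U rho.
Proof.
move=> Q0.
have r0 : 0 < r by slra.
pose u y := Num.sqrt Q * (csh y) `^ (- r^-1).
pose K := Q `^ (r / 2).
have K0 : 0 < K by exact: powR_gt0.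
have K2 : K ^+ 2 = Q `^ r.
  by rewrite /K -powR_mulrn ?powR_ge0// -powRrM; congr (_ `^ _); field.
pose v y := K * tnh y.
have u0 y : 0 < u y by rewrite /u mulr_gt0 ?sqrtr_gt0 ?powR_gt0 ?csh_gt0.
have du y : is_derive y 1 u (- r^-1 * tnh y * u y).
  apply: d_eq (dZ _ (dcomp (d_powR (- r^-1) (csh_gt0 y)) (d_csh y))) _.
  have C0 := csh_gt0 y.
  rewrite /u powRB; last by rewrite (gt_eqF C0) implybT.
  rewrite powRr1 ?(ltW C0)//.
  by field; rewrite !gt_eqF.
have dv y : is_derive y 1 v (K * (csh y) ^- 2) by exact: dZ (d_tnh y).
have uvE y : v y ^+ 2 + (u y ^+ 2) `^ r = Q `^ r.
  have -> : (u y ^+ 2) `^ r = Q `^ r * (csh y) ^- 2.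
    rewrite /u exprMn sqr_sqrtr ?(ltW Q0)// powRM ?sqr_ge0 ?(ltW Q0)//; congr (_ * _).
    rewrite -(powR_mulrn 2 (powR_ge0 (csh y) (- r^-1))) -!powRrM.
    have -> : - r^-1 * (2 * r) = - 2%:R by field; rewrite gt_eqF.
    by rewrite powR_invn// ltW// csh_gt0.
  by rewrite /v exprMn K2 -mulrDr tnh_csh mulr1.
pose kap := (r * c * K)^-1.
have kap0 : 0 < kap by rewrite invr_gt0 !mulr_gt0.
pose g y := kap * sq2 (u y ^+ 2).
have cu : continuous u by move=> y; exact: d_cont (du y).
have cg : continuous g.
  move=> y; apply: cvgMr; apply: (@continuous_comp _ _ _ (fun y => u y ^+ 2) sq2).
    exact: d_cont (dX 2 (du y)).
  exact: continuous_sq2.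
have ge y : kap <= g y by rewrite /g ler_peMr ?(ltW kap0)// sq2_ge1.
have [Y [XY [YX dY]]] := C1_inverse kap0 (fun y => is_derive_prim y cg) ge.
have Y0 : Y 0 = 0.
  rewrite -[X in Y X](_ : prim g 0 = 0) ?YX//.
  by rewrite /prim lexx set_itv1 Rintegral_set1.
have t0 : tnh 0 = 0 by rewrite /tnh oppr0 expR0 subrr mul0r.
have sqn0 z : sq2 z != 0 by rewrite gt_eqF// sq2_gt0.
exists (fun x => u (Y x)), (fun x => v (Y x)); split.
- move=> x; apply: d_eq (dcomp (du _) (dY x)) _.
  by rewrite /g /kap /v; field; rewrite sqn0 !gt_eqF.
- move=> x; apply: d_eq (dcomp (dv _) (dY x)) _.
  have -> : (u (Y x) ^+ 2) `^ r = K ^+ 2 * (csh (Y x)) ^- 2.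
    have := uvE (Y x); rewrite -K2 /v exprMn -{2}(mulr1 (K ^+ 2)) -(tnh_csh (Y x)) mulrDr.
    by move/addrI.
  by rewrite /g /kap; field; rewrite sqn0 !gt_eqF// csh_gt0.
- by move=> x.
- by move=> x.
- by rewrite Y0 /u /csh oppr0 expR0 (_ : (1 + 1) / 2 = 1 :> R) ?powR1 ?mulr1//; field.
- by rewrite Y0 /v t0 mulr0.
Qed.

Lemma scale_int (h : R -> R) Q : continuous h -> 0 <= Q ->
  prim h Q = Q * \int[mu]_(t in `[0, 1]) h (Q * t).
Proof.
move=> ch Q0.
have AC1 : AC (fun t => prim h (Q * t)) (fun t => h (Q * t) * Q).
  apply: AC_C1.
    move=> t; apply: dcomp (is_derive_prim _ ch) _.
    by apply: d_eq (dZ Q (did t)) _; rewrite mulr1.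
  apply: continuous_mulfun; last by move=> ?; exact: cvg_cst.
  exact: continuous_scal.
have lh : L1loc (fun t => h (Q * t)) by apply: L1_cont_cc; exact: continuous_scal.
have := AC_int AC1 (@ler01 R).
rewrite RintegralZr// mulr1 mulr0 mulrC => ->.
by rewrite {3}/prim lexx set_itv1 Rintegral_set1 subr0.
Qed.

Lemma prim0 (h : R -> R) : prim h 0 = 0.
Proof. by rewrite /prim lexx set_itv1 Rintegral_set1. Qed.

Lemma wfun_scale Q t : 0 <= Q -> 0 <= t ->
  Num.sqrt (Q `^ r - `|Q * t| `^ r) = Q `^ (r / 2) * wfun r t.
Proof.
move=> Q0 t0; rewrite ger0_norm ?mulr_ge0// powRM// /wfun ger0_norm//.
have -> : Q `^ r - Q `^ r * t `^ r = Q `^ r * (1 - t `^ r) by ring.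
rewrite sqrtrM ?powR_ge0//; congr (_ * _).
by rewrite -powR12_sqrt ?powR_ge0// -powRrM.
Qed.

Section ProfileMass.
Variables (Q : R) (U rho : R -> R).
Hypothesis (Q0 : 0 < Q) (pU : profile Q U rho).

Let P x := U x ^+ 2.

Lemma profile_continuous : continuous U.
Proof. by move=> x; exact: d_cont (profile_dU pU x). Qed.

Lemma profile_rho_continuous : continuous rho.
Proof. by move=> x; exact: d_cont (profile_drho pU x). Qed.

Lemma profile_P_gt0 x : 0 < P x.
Proof. by rewrite exprn_gt0// (profile_gt0 pU). Qed.

Lemma profile_dP x : is_derive x 1 P (- 2 * c * rho x * P x / sq2 (P x)).
Proof. by apply: d_eq (dX 2 (profile_dU pU x)) _; rewrite /P; ring. Qed.

Lemma profile_P_cont : continuous P.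
Proof. by move=> x; exact: d_cont (profile_dP x). Qed.

Lemma profile_P0 : P 0 = Q.
Proof. by rewrite /P (profile_U0 pU) sqr_sqrtr// ltW. Qed.

Lemma profile_PQ x : P x <= Q.
Proof.
rewrite leNgt; apply/negP => h.
have r0 : 0 < r by slra.
have := gt0_ltr_powR r0 (ltW Q0) (ltW (profile_P_gt0 x)) h.
have := profile_eq pU x; rewrite -/(P x); have := sqr_ge0 (rho x).
by move=> /[swap] <-; lra.
Qed.

Lemma profile_rho_mono x y : x <= y -> rho x <= rho y.
Proof.
move=> xy; have [] := @MVT_segment R rho _ x y xy (fun z _ => profile_drho pU z).
  apply: continuous_subspaceT; exact: profile_rho_continuous.
move=> z _ E; rewrite -subr_ge0 E mulr_ge0 ?subr_ge0//.
apply: divr_ge0; last exact: ltW (sq2_gt0 k0 _).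
by rewrite !mulr_ge0 ?powR_ge0 ?(ltW c0)//; slra.
Qed.

Lemma profile_rho_abs x : `|rho x| = Num.sqrt (Q `^ r - `|P x| `^ r).
Proof.
rewrite -(profile_eq pU x) -/(P x) (ger0_norm (ltW (profile_P_gt0 x))) addrK.
by rewrite sqrtr_sqr.
Qed.

Lemma profile_rho_le x : `|rho x| <= Q `^ (r / 2).
Proof.
rewrite profile_rho_abs.
have -> : Q `^ (r / 2) = Num.sqrt (Q `^ r).
  by rewrite -powR12_sqrt ?powR_ge0// -powRrM.
by rewrite ler_sqrt ?powR_ge0// gerBl powR_ge0.
Qed.

Let h q := Num.sqrt (Q `^ r - `|q| `^ r) * mfun q.

Let ch : continuous h.
Proof.
apply: continuous_mulfun; last exact: continuous_mfun.
apply: continuous_sqrt => q; apply: cvgB; first exact: cvg_cst.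
by apply: continuous_pw; slra.
Qed.

Let A x := P x * sq2 (P x) * rho x.
Let B x := prim h (P x).
Let dP x := - 2 * c * rho x * P x / sq2 (P x).
Let dA x := (sq2 (P x) + k * P x / sq2 (P x)) * dP x * rho x + r * c * P x `^ r * P x.
Let dB x := h (P x) * dP x.

Let csqP : continuous (fun x => sq2 (P x)).
Proof.
by move=> x; apply: continuous_comp; [exact: profile_P_cont|exact: continuous_sq2].
Qed.

Let cdP : continuous dP.
Proof.
apply: continuous_mulfun.
  apply: continuous_mulfun; last exact: profile_P_cont.
  apply: continuous_mulfun; last exact: profile_rho_continuous.
  by move=> ?; exact: cvg_cst.
by move=> x; apply: cvgV; [by rewrite gt_eqF ?sq2_gt0|exact: csqP].
Qed.

Let d_sq2 q : 0 < q -> is_derive q 1 sq2 (k / sq2 q).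
Proof.
move=> q0.
have E1 : 0 < 1 + 2 * k * q by rewrite addr_gt0// !mulr_gt0.
have dl : is_derive q 1 (fun q => 1 + 2 * k * q) (2 * k).
  by apply: d_eq (dD (dcst 1 q) (dZ (2 * k) (did q))) _; ring.
have h1 : is_derive q 1 sq2 (2 * k / (2 * Num.sqrt (1 + 2 * k * q))).
  apply: d_near (@d_sqrt _ (fun q => 1 + 2 * k * q) q _ E1 dl); near=> s.
  rewrite /sq2 ger0_norm//; apply: ltW; near: s; exact: lt_nbhsr.
apply: d_eq h1 _; have := sq2_gt0 k0 q; rewrite /sq2 (ger0_norm (ltW q0)) => s0.
by field; rewrite gt_eqF.
Unshelve. all: by end_near. Qed.

Let ACA : AC A dA.
Proof.
apply: AC_C1.
  move=> x.
  have h1 := dM (profile_dP x) (dcomp (d_sq2 (profile_P_gt0 x)) (profile_dP x)).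
  apply: d_eq (dM h1 (profile_drho pU x)) _.
  rewrite -/(P x) /dA /dP; have := sq2_gt0 k0 (P x); set s := sq2 (P x) => s0.
  by field; rewrite gt_eqF.
move=> x; apply: cvgD.
  apply: cvgM; last exact: profile_rho_continuous.
  apply: cvgM; last exact: cdP.
  apply: cvgD; first exact: csqP.
  apply: cvgM; first by apply: cvgMr; exact: profile_P_cont.
  by apply: cvgV; [by rewrite gt_eqF ?sq2_gt0|exact: csqP].
apply: cvgM; last exact: profile_P_cont.
apply: cvgMr; apply: (@continuous_comp _ _ _ P (fun s => s `^ r)).
  exact: profile_P_cont.
exact: d_cont (d_powR _ (profile_P_gt0 x)).
Qed.

Let ACB : AC B dB.
Proof.
apply: AC_C1.
  by move=> x; apply: dcomp (is_derive_prim _ ch) (profile_dP x).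
apply: continuous_mulfun; last exact: cdP.
by move=> x; apply: continuous_comp; [exact: profile_P_cont|exact: ch].
Qed.

(* The virial identity: A = P sq2(P) rho has derivative dA. *)
Let alg x : dA x - mfun (P x) * rho x * dP x = r * c * Q `^ r * P x.
Proof.
rewrite /dA /dP -(profile_eq pU x) -/(P x).
have s0 := sq2_gt0 k0 (P x); have := sq2_sqr k0 (P x).
rewrite ger0_norm ?(ltW (profile_P_gt0 x))// /mfun.
move: s0; set s := sq2 (P x) => s0 s2.
have PE : P x = (s ^+ 2 - 1) / (2 * k) by rewrite s2; field; rewrite gt_eqF.
have -> : k * P x / s = (s - s^-1) / 2.
  by rewrite {1}PE; field; rewrite !gt_eqF.
by field; rewrite gt_eqF.
Qed.

Let hP_pos x : 0 <= x -> dB x = mfun (P x) * rho x * dP x.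
Proof.
move=> x0; rewrite /dB /h -profile_rho_abs ger0_norm 1?[rho x * _]mulrC//.
by rewrite -(profile_rho0 pU) profile_rho_mono.
Qed.

Let hP_neg x : x <= 0 -> dB x = - (mfun (P x) * rho x * dP x).
Proof.
move=> x0; rewrite /dB /h -profile_rho_abs ler0_norm; first by ring.
by rewrite -(profile_rho0 pU) profile_rho_mono.
Qed.

Let lP : L1loc P.
Proof. exact: L1_cont_cc profile_P_cont. Qed.

Let A0 : A 0 = 0.
Proof. by rewrite /A (profile_rho0 pU) mulr0. Qed.

Let B0 : B 0 = prim h Q.
Proof. by rewrite /B profile_P0. Qed.

Let intpos (N : R) : 0 <= N ->
  r * c * Q `^ r * \int[mu]_(x in `[0, N]) P x = A N - B N + prim h Q.
Proof.
move=> N0; rewrite -RintegralZl//.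
rewrite (@eq_Rint_itv _ _ (fun x => dA x - dB x)); last first.
  by move=> x x0 _; rewrite hP_pos// alg.
rewrite (AC_int (AC_B ACA ACB))// A0 B0.
by move: (A N) (B N) (prim h Q) => ? ? ?; ring.
Qed.

Let intneg (N : R) : 0 <= N ->
  r * c * Q `^ r * \int[mu]_(x in `[- N, 0]) P x = - A (- N) - B (- N) + prim h Q.
Proof.
move=> N0; rewrite -RintegralZl//.
rewrite (@eq_Rint_itv _ _ (fun x => dA x + dB x)); last first.
  by move=> x _ x0; rewrite hP_neg// alg.
rewrite (AC_int (AC_D ACA ACB)); last by rewrite oppr_le0.
rewrite A0 B0.
by move: (A _) (B _) (prim h Q) => ? ? ?; ring.
Qed.

Let D0 : 0 < r * c * Q `^ r.
Proof. by rewrite !mulr_gt0 ?powR_gt0//; slra. Qed.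

Let int_sym (N : R) : 0 <= N -> \int[mu]_(x in `[- N, N]) P x =
  (A N - A (- N) - B N - B (- N) + 2 * prim h Q) / (r * c * Q `^ r).
Proof.
move=> N0; rewrite (@Rint_split _ P (- N) 0 N)//; last by rewrite lerNl oppr0.
have h1 := intpos N0; have h2 := intneg N0.
apply: (mulfI (lt0r_neq0 D0)); rewrite mulrDr h1 h2 [RHS]mulrC divfK ?gt_eqF//.
by move: (A N) (A (- N)) (B N) (B (- N)) (prim h Q) => ? ? ? ? ?; ring.
Qed.

Let prim_ge0 q : 0 <= q -> 0 <= prim h q.
Proof.
move=> q0; rewrite /prim q0; apply: Rintegral_ge0 => t /=; rewrite in_itv/= => /andP[t0 _].
by rewrite mulr_ge0 ?sqrtr_ge0// (le_trans _ (mfun_ge1 k0 r1 t0)).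
Qed.

Let A_bound x : `|A x| <= Q * sq2 Q * Q `^ (r / 2).
Proof.
have h1 := profile_P_gt0 x; have h2 := sq2_gt0 k0 (P x).
rewrite /A normrM normrM (gtr0_norm h1) (gtr0_norm h2).
apply: ler_pM => //; [by rewrite mulr_ge0// ltW| |exact: profile_rho_le].
apply: ler_pM; [exact: ltW|exact: ltW|exact: profile_PQ|].
by apply: sq2_mono; [|exact: ltW|exact: profile_PQ].
Qed.

Lemma profile_L1 : L1 P.
Proof.
apply: (@L1_of_bound _ _ ((2 * (Q * sq2 Q * Q `^ (r / 2)) + 2 * prim h Q) / (r * c * Q `^ r))).
- exact: continuous_measurable_fun profile_P_cont.
- exact: lP.
- by move=> x; exact: ltW (profile_P_gt0 x).
move=> n; rewrite int_sym// ler_pM2r ?invr_gt0//.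
have B1 : 0 <= B n%:R by apply: prim_ge0; exact: ltW (profile_P_gt0 _).
have B2 : 0 <= B (- n%:R) by apply: prim_ge0; exact: ltW (profile_P_gt0 _).
have := A_bound n%:R; have := A_bound (- n%:R).
rewrite !ler_norml => /andP[? ?] /andP[? ?]; lra.
Qed.

Let dP_bound x : `|dP x| <= 2 * c * Q `^ (r / 2) * P x.
Proof.
have h1 := profile_P_gt0 x; have h2 := sq2_ge1 k0 (P x); have h3 := sq2_gt0 k0 (P x).
have -> : dP x = 2 * c * P x / sq2 (P x) * - rho x by rewrite /dP; ring.
have h4 : 0 <= 2 * c * P x / sq2 (P x).
  by rewrite mulr_ge0 ?invr_ge0 ?(ltW h3)// mulr_ge0 ?(ltW h1)// mulr_ge0 ?(ltW c0).
have hr := profile_rho_le x.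
have h5 : 0 <= 2 * c * P x by rewrite mulr_ge0 ?(ltW h1)// mulr_ge0 ?(ltW c0).
rewrite normrM (ger0_norm h4) normrN mulrAC ler_pdivrMr//.
apply: (@le_trans _ _ (2 * c * P x * Q `^ (r / 2))); first by rewrite ler_wpM2l.
have -> : 2 * c * Q `^ (r / 2) * P x * sq2 (P x) =
  2 * c * P x * Q `^ (r / 2) * sq2 (P x) by ring.
by rewrite ler_peMr// mulr_ge0// powR_ge0.
Qed.

Lemma profile_vanish (e : R) : 0 < e ->
  exists2 N : R, 0 < N & forall x, N <= `|x| -> P x < e.
Proof.
move=> e0.
have ACP : AC P dP by apply: AC_C1; [exact: profile_dP|exact: cdP].
have ldP : L1 dP.
  apply: L1_le dP_bound (L1Z _ profile_L1).
  exact: continuous_measurable_fun cdP.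
have [N N0 HN] := AC_vanish ACP profile_L1 ldP e0.
by exists N => // x /HN; rewrite ger0_norm// ltW// profile_P_gt0.
Qed.

(** Integrate the virial identity over [-n, n]: the boundary terms at infinity
    vanish and m(P) rho P' is exact on either half-line. *)
Lemma profile_mass : \int[mu]_x P x = 2 * Lmass k c r Q.
Proof.
have E : prim h Q = Q * Q `^ (r / 2) * Dm k r Q.
  rewrite (scale_int ch (ltW Q0)) -mulrA; congr (Q * _).
  rewrite /Dm -RintegralZl//; last exact: L1loc_wm.
  apply: eq_Rintegral => t; rewrite inE/= in_itv/= => /andP[t0 _].
  by rewrite /h wfun_scale ?(ltW Q0)// mulrA.
have -> : 2 * Lmass k c r Q = 2 * prim h Q / (r * c * Q `^ r).
  rewrite LmassE// E.
  have -> : Q `^ r = Q `^ (r / 2) * Q `^ (r / 2).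
    by rewrite -powRD ?(gt_eqF Q0) ?implybT//; congr (_ `^ _); field.
  rewrite powRB ?(gt_eqF Q0) ?implybT// powRr1 ?(ltW Q0)//.
  by field; rewrite !gt_eqF ?powR_gt0//; slra.
have H := cvg_Rint_exhaust profile_L1.
apply: (cvg_unique _ H); first exact: Rhausdorff.
have P0 : P n%:R @[n --> \oo] --> (0 : R).
  apply/cvgrPdist_lt => e e0; have [N N0 HN] := profile_vanish e0.
  near=> n; rewrite sub0r normrN ger0_norm ?(ltW (profile_P_gt0 _))//; apply: HN.
  rewrite ger0_norm//; apply: (@le_trans _ _ (Num.bound N)%:R).
    by rewrite ltW// archi_boundP// ltW.
  by rewrite ler_nat; near: n; exact: nbhs_infty_ge.
have P0' : P (- n%:R) @[n --> \oo] --> (0 : R).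
  apply/cvgrPdist_lt => e e0; have [N N0 HN] := profile_vanish e0.
  near=> n; rewrite sub0r normrN ger0_norm ?(ltW (profile_P_gt0 _))//; apply: HN.
  rewrite normrN ger0_norm//; apply: (@le_trans _ _ (Num.bound N)%:R).
    by rewrite ltW// archi_boundP// ltW.
  by rewrite ler_nat; near: n; exact: nbhs_infty_ge.
have As (s : nat -> R) : P (s n) @[n --> \oo] --> (0 : R) -> A (s n) @[n --> \oo] --> (0 : R).
  move=> Ps.
  have hb n : `|A (s n)| <= sq2 Q * Q `^ (r / 2) * P (s n).
    have h1 := profile_P_gt0 (s n); have h2 := sq2_gt0 k0 (P (s n)).
    rewrite /A normrM normrM (gtr0_norm h1) (gtr0_norm h2) -mulrA mulrC.
    rewrite ler_wpM2r ?(ltW h1)//; apply: ler_pM => //; first exact: ltW.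
      by apply: sq2_mono; [|exact: ltW|exact: profile_PQ].
    exact: profile_rho_le.
  apply: (cvg0_le hb).
  by rewrite -[X in _ --> X](mulr0 (sq2 Q * Q `^ (r / 2))); apply: cvgMr.
have Bs (s : nat -> R) : P (s n) @[n --> \oo] --> (0 : R) -> B (s n) @[n --> \oo] --> (0 : R).
  move=> Ps; rewrite -(prim0 h); apply: (cvg_comp _ _ Ps).
  exact: d_cont (is_derive_prim 0 ch).
have -> : (fun n : nat => \int[mu]_(x in `[- n%:R, n%:R]) P x) = (fun n =>
    (A n%:R - A (- n%:R) - B n%:R - B (- n%:R) + 2 * prim h Q) / (r * c * Q `^ r)).
  by apply/funext => n; exact: int_sym.
rewrite /=.
have -> : 2 * prim h Q / (r * c * Q `^ r) = (0 - 0 - 0 - 0 + 2 * prim h Q) / (r * c * Q `^ r).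
  by rewrite !subr0 add0r.
apply: cvgMl; apply: cvgD; last exact: cvg_cst.
by apply: cvgB (Bs _ P0'); apply: cvgB (Bs _ P0); apply: cvgB (As _ P0) (As _ P0').
Unshelve. all: by end_near. Qed.

End ProfileMass.

End Profile.

(** * The energy identity *)

Section H1Pairs.
Context {R : realType}.
Local Notation mu := (@lebesgue_measure R).
Implicit Types (a b da db f g : R -> R) (x y t : R).

Record H1pair a b da db : Prop := MkH1pair {
  pair_ACa : AC a da;
  pair_ACb : AC b db;
  pair_a : L2 a;
  pair_b : L2 b;
  pair_da : L2 da;
  pair_db : L2 db }.

Lemma rep_pair u a b da db : rep u a b da db -> H1pair a b da db.
Proof. by case. Qed.

Definition sqn a b x : R := a x ^+ 2 + b x ^+ 2.
Definition dsqn a b da db x : R := 2 * (a x * da x) + 2 * (b x * db x).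

Lemma sqn_ge0 a b x : 0 <= sqn a b x.
Proof. by rewrite addr_ge0 ?sqr_ge0. Qed.

Section Pair.
Variables (a b da db : R -> R).
Hypothesis (hp : H1pair a b da db).
Local Notation q := (sqn a b).
Local Notation dq := (dsqn a b da db).

Lemma pair_ACq : AC q dq.
Proof. by case: hp => ACa ACb _ _ _ _; apply: AC_D; exact: AC_sqr. Qed.

Lemma pair_L1q : L1 q.
Proof. by case: hp => _ _ [_ la] [_ lb] _ _; exact: L1D. Qed.

Lemma pair_L1dq : L1 dq.
Proof. by case: hp => _ _ la lb lda ldb; apply: L1D; apply: L1Z; exact: L2_M. Qed.

Lemma pair_cq : continuous q.
Proof. exact: AC_continuous pair_ACq. Qed.

Lemma pair_bound : exists2 M : R, 0 < M & forall x, q x <= M.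
Proof.
exists (\int[mu]_t (`|q t| + `|dq t|) + 1).
  by apply: ltr_wpDl => //; apply: Rintegral_ge0 => t _; rewrite addr_ge0.
move=> x; have := AC_bound x pair_ACq pair_L1q pair_L1dq.
by rewrite ger0_norm ?sqn_ge0//; lra.
Qed.

(** AC_bound applied to q, with |q'| <= |u|^2 + |u'|^2. *)
Lemma pair_sup x : q x <=
  2 * \int[mu]_t (da t ^+ 2 + db t ^+ 2 + (a t ^+ 2 + b t ^+ 2)).
Proof.
have := AC_bound x pair_ACq pair_L1q pair_L1dq.
rewrite ger0_norm ?sqn_ge0// => /le_trans; apply.
case: hp => _ _ [_ la] [_ lb] [_ lda] [_ ldb].
have I1 : L1 (fun t => da t ^+ 2 + db t ^+ 2 + (a t ^+ 2 + b t ^+ 2)).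
  by apply: L1D; exact: L1D.
rewrite -RintZ//; apply: le_RintT.
- by apply: L1D; apply: L1_norm; [exact: pair_L1q|exact: pair_L1dq].
- exact: L1Z.
move=> t; rewrite ger0_norm ?sqn_ge0// /sqn /dsqn.
have h1 : `|2 * (a t * da t) + 2 * (b t * db t)| <=
   a t ^+ 2 + da t ^+ 2 + (b t ^+ 2 + db t ^+ 2).
  rewrite ler_norml; apply/andP; split.
    by have := sqr_ge0 (a t + da t); have := sqr_ge0 (b t + db t); nra.
  by have := sqr_ge0 (a t - da t); have := sqr_ge0 (b t - db t); nra.
have := sqr_ge0 (da t); have := sqr_ge0 (db t).
have := sqr_ge0 (a t); have := sqr_ge0 (b t); lra.
Qed.

Lemma pair_vanish (e : R) : 0 < e ->
  exists2 N : R, 0 < N & forall x, N <= `|x| -> q x < e.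
Proof.
move=> e0; have [N N0 HN] := AC_vanish pair_ACq pair_L1q pair_L1dq e0.
by exists N => // x /HN; rewrite ger0_norm// sqn_ge0.
Qed.

Lemma pair_max : 0 < \int[mu]_x q x ->
  exists2 x0, 0 < q x0 & forall x, q x <= q x0.
Proof.
move=> m0.
have [y qy] : exists y, 0 < q y.
  apply: contrapT => nex; move: m0; rewrite (@eq_Rintegral _ _ _ _ _ (fun=> 0)).
    rewrite (_ : \int[mu]_x 0 = 0) ?ltxx//.
    by rewrite /Rintegral integral0.
  move=> x _; apply/le_anti; rewrite sqn_ge0 andbT leNgt; apply/negP => h.
  by apply: nex; exists x.
have [N N0 HN] := pair_vanish qy.
have yN : `|y| < N by rewrite ltNge; apply/negP => /HN; rewrite ltxx.
have NN : - N <= N by lra.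
have [x0 _ Hx0] := EVT_max NN (continuous_subspaceT pair_cq).
have yx0 : q y <= q x0.
  by apply: Hx0; rewrite in_itv/= -ler_norml ltW.
exists x0; first exact: lt_le_trans yx0.
move=> x; have [Nx|xN] := leP N `|x|.
  by apply: ltW; apply: lt_le_trans yx0; exact: HN.
by apply: Hx0; rewrite in_itv/= -ler_norml ltW.
Qed.

Lemma cvg_pair_vanish (s : nat -> R) : (forall n, n%:R <= `|s n|) ->
  q (s n) @[n --> \oo] --> (0 : R).
Proof.
move=> sn; apply/cvgrPdist_lt => e e0; have [N N0 HN] := pair_vanish e0.
near=> n; rewrite sub0r normrN ger0_norm ?sqn_ge0//; apply: HN.
apply: le_trans (sn n); apply: (@le_trans _ _ (Num.bound N)%:R).
  by rewrite ltW// archi_boundP// ltW.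
by rewrite ler_nat; near: n; exact: nbhs_infty_ge.
Unshelve. all: by end_near. Qed.

End Pair.

Definition sgx x : R := if 0 <= x then 1 else - 1.

Lemma sgx_sqr x : sgx x ^+ 2 = 1.
Proof. by rewrite /sgx; case: ifP; rewrite ?sqrrN expr1n. Qed.

Lemma sgx_norm x : `|sgx x| = 1.
Proof. by rewrite /sgx; case: ifP; rewrite ?normrN normr1. Qed.

Lemma measurable_sgx : measurable_fun setT sgx.
Proof.
rewrite (_ : sgx = fun x => 2 * \1_(`[0, +oo[%classic) x - 1).
  have mi : measurable_fun setT (\1_(`[0, +oo[%classic) : R -> R) by apply: measurable_indic.
  by apply: measurable_funB => //; apply: measurable_funM.
apply/funext => x; rewrite /sgx indicE mem_setE in_itv/= andbT.
by case: ifP => _ /=; lra.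
Qed.

End H1Pairs.

Section Bogomolny.
Context {R : realType}.
Local Notation mu := (@lebesgue_measure R).
Context (k c r : R).
Hypotheses (k0 : 0 < k) (c0 : 0 < c) (r1 : 1 <= r).
Implicit Types (a b da db f g : R -> R) (x y t Q : R).
Local Notation sq2 := (sq2 k).

Local Ltac slra := first [ lra | have := r1; lra | have := k0; have := r1; lra ].

Definition wQ Q t : R := Num.sqrt (Q `^ r - `|t| `^ r).

(** The value of |(log U)'| where U^2 = t, for the profile U of peak Q. *)
Definition rate Q t : R := c * wQ Q t / sq2 t.

Lemma continuous_wQ Q : continuous (wQ Q).
Proof.
apply: continuous_sqrt => q; apply: cvgB; first exact: cvg_cst.
by apply: continuous_pw; slra.
Qed.

Lemma continuous_rate Q : continuous (rate Q).
Proof.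
apply: continuous_mulfun.
  by apply: continuous_mulfun; [move=> ?; exact: cvg_cst|exact: continuous_wQ].
by move=> x; apply: cvgV; [rewrite gt_eqF ?sq2_gt0|exact: continuous_sq2].
Qed.

Lemma wQ_ge0 Q t : 0 <= wQ Q t. Proof. exact: sqrtr_ge0. Qed.

Lemma wQ_le Q t : wQ Q t <= Q `^ (r / 2).
Proof.
have -> : Q `^ (r / 2) = Num.sqrt (Q `^ r).
  by rewrite -powR12_sqrt ?powR_ge0// -powRrM.
by rewrite ler_sqrt ?powR_ge0// gerBl powR_ge0.
Qed.

Lemma rate_ge0 Q t : 0 <= rate Q t.
Proof. by rewrite /rate divr_ge0 ?mulr_ge0 ?wQ_ge0 ?(ltW c0) ?(ltW (sq2_gt0 k0 _)). Qed.

Lemma rate_le Q t : rate Q t <= c * Q `^ (r / 2).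
Proof.
rewrite /rate ler_pdivrMr ?sq2_gt0//.
have h1 := wQ_le Q t; have h2 := sq2_ge1 k0 t; have h3 := wQ_ge0 Q t.
apply: (@le_trans _ _ (c * Q `^ (r / 2))); first by rewrite ler_wpM2l ?(ltW c0).
by rewrite ler_peMr// mulr_ge0 ?powR_ge0 ?(ltW c0).
Qed.

(** The energy density, with exponent p = 2 (r + 1) and theta / p = c^2 / 2. *)
Definition dens a b da db x : R :=
  2^-1 * (da x ^+ 2 + db x ^+ 2) + k * (a x * da x + b x * db x) ^+ 2
  - c ^+ 2 / 2 * (sqn a b x `^ (r + 1)).

(** The profile runs down with speed rate on either side of 0; resid is the
    deviation from this law of a component f of u with derivative df. *)
Definition resid Q a b f df x : R := df x + sgx x * rate Q (sqn a b x) * f x.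

Definition defect Q a b da db x : R :=
  2^-1 * (resid Q a b a da x ^+ 2 + resid Q a b b db x ^+ 2)
  + k * (a x * resid Q a b a da x + b x * resid Q a b b db x) ^+ 2.

Lemma powS q : 0 <= q -> q `^ (r + 1) = q * q `^ r.
Proof.
move=> q0; rewrite -(@mulr_powRB1 _ q (r + 1))//; last slra.
by congr (_ * _ `^ _); ring.
Qed.

Definition Phi Q t : R := c / 2 * (wQ Q t * sq2 t).

Lemma continuous_Phi Q : continuous (Phi Q).
Proof.
apply: continuous_mulfun; first by move=> ?; exact: cvg_cst.
by apply: continuous_mulfun; [exact: continuous_wQ|exact: continuous_sq2].
Qed.

(** Scaling [0, Q] to [0, 1]. *)
Lemma two_prim_Phi Q : 0 <= Q -> 2 * prim (Phi Q) Q = Jact k c r Q.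
Proof.
move=> Q0; rewrite (scale_int (@continuous_Phi Q) Q0).
have lI : L1loc (fun t => wfun r t * sq2 (Q * t)).
  apply: L1_cont_cc; apply: continuous_mulfun; first exact: continuous_wfun.
  exact: continuous_scal (@continuous_sq2 _ k).
have -> : \int[mu]_(t in `[0, 1]) Phi Q (Q * t) =
  c / 2 * Q `^ (r / 2) * \int[mu]_(t in `[0, 1]) (wfun r t * sq2 (Q * t)).
  rewrite -(RintZ_itv _ _ _ lI).
  apply: eq_Rintegral => t; rewrite inE/= in_itv/= => /andP[t0 _].
  by rewrite /Phi /wQ wfun_scale//; ring.
rewrite /Jact.
have -> : \int[mu]_(t in `[0, 1]) (wfun r t * jfun k r t Q) =
   Q `^ (1 + r / 2) * \int[mu]_(t in `[0, 1]) (wfun r t * sq2 (Q * t)).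
  rewrite -(RintZ_itv _ _ _ lI).
  by apply: eq_Rintegral => t _; rewrite /jfun; ring.
have -> : Q `^ (1 + r / 2) = Q * Q `^ (r / 2).
  move: Q0; rewrite le_eqVlt => /predU1P[<-|Q0].
    by rewrite mul0r powR0// gt_eqF//; slra.
  by rewrite powRD ?(gt_eqF Q0) ?implybT// powRr1 ?ltW.
by field.
Qed.

Section Identity.
Variables (Q : R) (a b da db : R -> R).
Hypothesis (hp : H1pair a b da db) (Q0 : 0 < Q) (qle : forall x, sqn a b x <= Q).
Local Notation q := (sqn a b).
Local Notation dq := (dsqn a b da db).
Local Notation ra := (resid Q a b a da).
Local Notation rb := (resid Q a b b db).

Lemma wQ_sqr x : wQ Q (q x) ^+ 2 = Q `^ r - q x `^ r.
Proof.
rewrite /wQ (ger0_norm (sqn_ge0 a b x)) sqr_sqrtr// subr_ge0.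
by apply: ge0_ler_powR; rewrite ?nnegrE ?sqn_ge0 ?(ltW Q0)//; slra.
Qed.

(** Expand the squares in terms of m = a a' + b b': the terms linear in rate
    collect to m rate (1 + 2 k q), which is Phi q', and those quadratic in rate
    to c^2/2 q (Q^r - q^r). *)
Lemma defectE x : dens a b da db x + c ^+ 2 / 2 * Q `^ r * q x =
  defect Q a b da db x - sgx x * (Phi Q (q x) * dq x).
Proof.
have s0 := sq2_gt0 k0 (q x).
have s2 := sq2_sqr k0 (q x); rewrite (ger0_norm (sqn_ge0 a b x)) in s2.
have w2 := wQ_sqr x; have g2 := sgx_sqr x.
have qr : q x `^ r = Q `^ r - wQ Q (q x) ^+ 2 by rewrite w2; ring.
rewrite /dens /defect /resid /Phi /rate /dsqn (powS (sqn_ge0 a b x)) qr.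
move: s0 s2 g2; set s := sq2 (q x); set w := wQ Q (q x); set g := sgx x => s0 s2 g2.
have sE : q x = (s ^+ 2 - 1) / (2 * k) by rewrite s2; field; rewrite gt_eqF.
set m := a x * da x + b x * db x.
set B := c * w / s.
have E1 : (da x + g * B * a x) ^+ 2 + (db x + g * B * b x) ^+ 2 =
  da x ^+ 2 + db x ^+ 2 + 2 * g * B * m + g ^+ 2 * B ^+ 2 * q x.
  by rewrite /m /sqn; ring.
have E2 : a x * (da x + g * B * a x) + b x * (db x + g * B * b x) = m + g * B * q x.
  by rewrite /m /sqn; ring.
have E3 : 2 * (a x * da x) + 2 * (b x * db x) = 2 * m by rewrite /m; ring.
rewrite E1 E2 E3 g2.
have -> : k * (m + g * B * q x) ^+ 2 =
  k * m ^+ 2 + g * B * m * (2 * k * q x) + g ^+ 2 * B ^+ 2 * q x * (2 * k * q x) / 2.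
  by field.
rewrite g2; have -> : 2 * k * q x = s ^+ 2 - 1 by rewrite s2; ring.
by rewrite /B; field; rewrite gt_eqF.
Qed.

Lemma measurable_q : measurable_fun setT q.
Proof. exact: continuous_measurable_fun (pair_cq hp). Qed.

Lemma measurable_rateq : measurable_fun setT (fun x => sgx x * rate Q (q x)).
Proof.
apply: measurable_funM; first exact: measurable_sgx.
apply: measurableT_comp measurable_q.
exact: continuous_measurable_fun (@continuous_rate Q).
Qed.

Lemma L2_sgrate f : L2 f -> L2 (fun x => sgx x * rate Q (q x) * f x).
Proof.
move=> [mf lf].
have m : measurable_fun setT (fun x => sgx x * rate Q (q x) * f x).
  by apply: measurable_funM => //; exact: measurable_rateq.
split => //; apply: L1_le (L1Z ((c * Q `^ (r / 2)) ^+ 2) lf).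
  exact: measurable_funX.
move=> x; rewrite ger0_norm ?sqr_ge0//.
rewrite (_ : (_ * _) ^+ 2 = rate Q (q x) ^+ 2 * f x ^+ 2); last first.
  by rewrite [LHS]exprMn [in LHS]exprMn sgx_sqr mul1r.
have h1 := rate_ge0 Q (q x); have h2 := rate_le Q (q x).
by rewrite ler_wpM2r ?sqr_ge0// ler_sqr ?nnegrE// (le_trans h1).
Qed.

Lemma L2_resid f df : L2 f -> L2 df -> L2 (resid Q a b f df).
Proof.
move=> lf ldf; have := L2_lin 1 1 ldf (L2_sgrate lf).
by under eq_fun do rewrite !mul1r.
Qed.

(** By Cauchy-Schwarz the square is at most q (f^2 + g^2), and q is bounded. *)
Lemma L1_quartic f g : L2 f -> L2 g -> L1 (fun x => (a x * f x + b x * g x) ^+ 2).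
Proof.
move=> [mf lf] [mg lg]; have [M M0 qM] := pair_bound hp.
have [ma _] := pair_a hp; have [mb _] := pair_b hp.
apply: L1_le (L1Z M (L1D lf lg)).
  by apply: measurable_funX; apply: measurable_funD; exact: measurable_funM.
move=> x; rewrite ger0_norm ?sqr_ge0//.
apply: (@le_trans _ _ (q x * (f x ^+ 2 + g x ^+ 2))).
  by rewrite /sqn; have := sqr_ge0 (a x * g x - b x * f x); nra.
by rewrite ler_wpM2r// addr_ge0 ?sqr_ge0.
Qed.

Lemma L1_pow : L1 (fun x => q x `^ (r + 1)).
Proof.
have [M M0 qM] := pair_bound hp.
apply: L1_le (L1Z (M `^ r) (pair_L1q hp)).
  apply: (measurableT_comp (measurable_powR _)); exact: measurable_q.
move=> x; rewrite ger0_norm ?powR_ge0// powS ?sqn_ge0// mulrC ler_wpM2r ?sqn_ge0//.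
by apply: ge0_ler_powR; rewrite ?nnegrE ?sqn_ge0 ?(ltW M0)//; slra.
Qed.

Lemma L1_dens : L1 (dens a b da db).
Proof.
have [_ lda] := pair_da hp; have [_ ldb] := pair_db hp.
apply: L1B; last by apply: L1Z; exact: L1_pow.
apply: L1D; first by apply: L1Z; exact: L1D.
by apply: L1Z; apply: L1_quartic; [exact: pair_da hp|exact: pair_db hp].
Qed.

Lemma L2_ra : L2 ra.
Proof. by apply: L2_resid; [exact: pair_a hp|exact: pair_da hp]. Qed.

Lemma L2_rb : L2 rb.
Proof. by apply: L2_resid; [exact: pair_b hp|exact: pair_db hp]. Qed.

Lemma L1_defect : L1 (defect Q a b da db).
Proof.
have [_ la] := L2_ra; have [_ lb] := L2_rb.
apply: L1D; first by apply: L1Z; exact: L1D.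
by apply: L1Z; apply: L1_quartic; [exact: L2_ra|exact: L2_rb].
Qed.

(** On either half-line Phi(q) q' is the derivative of a primitive of Phi at q,
    which goes from q = 0 at infinity to q = Q at 0; at x = 0 itself Phi
    vanishes, whence the value of sgx there is immaterial. *)
Lemma int_total : q 0 = Q ->
  L1 (fun x => sgx x * (Phi Q (q x) * dq x)) /\
  \int[mu]_x (sgx x * (Phi Q (q x) * dq x)) = - Jact k c r Q.
Proof.
move=> q0.
have E : (fun x => sgx x * (Phi Q (q x) * dq x)) =
   (fun x => defect Q a b da db x - (dens a b da db x + c ^+ 2 / 2 * Q `^ r * q x)).
  by apply/funext => x; rewrite defectE; ring.
have LT : L1 (fun x => sgx x * (Phi Q (q x) * dq x)).
  rewrite E; apply: L1B; first exact: L1_defect.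
  by apply: L1D; [exact: L1_dens|apply: L1Z; exact: pair_L1q hp].
split => //.
apply: (cvg_unique _ (cvg_Rint_exhaust LT)); first exact: Rhausdorff.
have cH : continuous (prim (Phi Q)).
  by move=> x; exact: d_cont (is_derive_prim x (@continuous_Phi Q)).
have ACH : AC (fun x => prim (Phi Q) (q x)) (fun x => Phi Q (q x) * dq x).
  apply: (@AC_comp _ _ _ setT) => //; first exact: pair_ACq hp.
  - by move=> s t u _ _ _; exact: is_derive_prim (@continuous_Phi Q).
  - by move=> s _; exact: continuous_Phi.
have lH := AC_L1loc ACH; have lT := L1_loc LT.
have sE n : \int[mu]_(x in `[- n%:R, n%:R]) (sgx x * (Phi Q (q x) * dq x)) =
  prim (Phi Q) (q n%:R) + prim (Phi Q) (q (- n%:R)) - 2 * prim (Phi Q) Q.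
  rewrite (@Rint_split _ _ (- n%:R) 0 n%:R)//.
  rewrite (@eq_Rint_itv _ _ (fun x => -1 * (Phi Q (q x) * dq x)) (- n%:R)); last first.
    move=> x _; rewrite le_eqVlt => /predU1P[->|x0].
      by rewrite q0 /Phi /wQ (ger0_norm (ltW Q0)) subrr sqrtr0 !(mul0r, mulr0).
    by rewrite /sgx leNgt x0.
  rewrite (@eq_Rint_itv _ _ (fun x => Phi Q (q x) * dq x) 0); last first.
    by move=> x x0 _; rewrite /sgx x0 mul1r.
  rewrite RintegralZl// (AC_int ACH)// (AC_int ACH) ?oppr_le0// q0.
  ring.
rewrite -(two_prim_Phi (ltW Q0)).
have -> : (fun n : nat => \int[mu]_(x in `[- n%:R, n%:R]) (sgx x * (Phi Q (q x) * dq x))) =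
  (fun n => prim (Phi Q) (q n%:R) + prim (Phi Q) (q (- n%:R)) - 2 * prim (Phi Q) Q).
  by apply/funext.
have H0 (s : nat -> R) : (forall n, n%:R <= `|s n|) ->
    prim (Phi Q) (q (s n)) @[n --> \oo] --> (0 : R).
  move=> sn; rewrite -(prim0 (Phi Q)); apply: (cvg_comp _ _ (cvg_pair_vanish hp sn)).
  exact: cH.
have L : prim (Phi Q) (q n%:R) + prim (Phi Q) (q (- n%:R)) - 2 * prim (Phi Q) Q
    @[n --> \oo] --> (0 + 0 - 2 * prim (Phi Q) Q : R).
  apply: cvgB; last exact: cvg_cst.
  apply: cvgD; apply: H0 => n; first by rewrite ger0_norm.
  by rewrite normrN ger0_norm.
by rewrite addr0 sub0r in L.
Qed.

(** Integrated form of defectE.  The boundary term depends on the maximum Q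
    only, which makes it a lower bound for the energy. *)
Theorem bogomolny : q 0 = Q ->
  \int[mu]_x dens a b da db x + c ^+ 2 / 2 * Q `^ r * \int[mu]_x q x =
  \int[mu]_x defect Q a b da db x + Jact k c r Q.
Proof.
move=> q0; have [LT IT] := int_total q0.
have Lq := pair_L1q hp.
rewrite -[Jact _ _ _ _]opprK -IT -RintB//; last exact: L1_defect.
rewrite -RintZ// -RintD//; [|exact: L1_dens|exact: L1Z].
by apply: eq_Rintegral => x _; exact: defectE.
Qed.

Lemma le_defect : 2^-1 * \int[mu]_x (ra x ^+ 2 + rb x ^+ 2) <=
  \int[mu]_x defect Q a b da db x.
Proof.
have [_ la] := L2_ra; have [_ lb] := L2_rb.
rewrite -RintZ; last exact: L1D.
apply: le_RintT; [by apply: L1Z; exact: L1D|exact: L1_defect|].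
by move=> x; rewrite /defect lerDl mulr_ge0 ?sqr_ge0// ltW.
Qed.

End Identity.

End Bogomolny.

(** * Comparison with the profile *)

Section Reflection.
Context {R : realType}.
Local Notation mu := (@lebesgue_measure R).
Implicit Types (f g : R -> R) (a b x y t : R).

Local Notation opp := ((fun x => - x) : measurableTypeR R -> measurableTypeR R).

Let measurable_opp : measurable_fun setT opp.
Proof. exact: measurableT_comp. Qed.

Lemma L1_opp f : L1 f -> L1 (fun x => f (- x)).
Proof.
move=> If; apply/integrableP; split.
  apply/measurable_EFinP; apply: measurableT_comp; last exact: measurable_opp.
  exact: L1_measurable.
move/integrableP : If => [mf]; apply: le_lt_trans.
have mf' : measurable_fun setT (fun x => `|(EFin \o f) x|%E).
  exact: measurableT_comp.
have := @ge0_integral_pushforward _ _ _ _ _ opp measurable_opp mu setT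
  (fun x => `|(EFin \o f) x|%E) measurableT mf' (fun x _ => abse_ge0 _).
rewrite preimage_setT => <-.
rewrite le_eqVlt; apply/orP; left; apply/eqP.
apply: eq_measure_integral => //=.
by move=> A mA _; exact: lebesgue_measureN.
Qed.

Lemma Rint_opp f : L1 f -> \int[mu]_x f (- x) = \int[mu]_x f x.
Proof.
move=> If; rewrite /Rintegral; congr fine.
have := @integral_pushforward _ _ _ _ _ opp measurable_opp mu setT
  (EFin \o f) (measurable_int _ If).
rewrite preimage_setT => /(_ (L1_opp If) measurableT) <-.
apply: eq_measure_integral => //=.
by move=> A mA _; exact: lebesgue_measureN.
Qed.

Let mem_opp a b x : (- x \in `[- b, - a]%classic) = (x \in `[a, b]%classic).
Proof.
by apply/idP/idP; rewrite !inE/= !in_itv/= !lerN2 => /andP[-> ->].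
Qed.

Lemma L1loc_opp f : L1loc f -> L1loc (fun x => f (- x)).
Proof.
move=> lf a b.
have := L1_opp (L1_restrict (- b) (- a) lf).
move=> h; apply/integrable_mkcond => //.
apply: eq_integrable h => // x _ /=.
by rewrite restrict_EFin /= !patchE mem_opp.
Qed.

Lemma Rint_itv_opp f a b : L1loc f ->
  \int[mu]_(x in `[a, b]) f (- x) = \int[mu]_(x in `[- b, - a]) f x.
Proof.
move=> lf; rewrite [LHS]Rintegral_mkcond [RHS]Rintegral_mkcond.
rewrite -(Rint_opp (L1_restrict (- b) (- a) lf)).
by apply: eq_Rintegral => x _; rewrite !patchE mem_opp.
Qed.

Lemma AC_opp f g : AC f g -> AC (fun x => f (- x)) (fun x => - g (- x)).
Proof.
move=> [lg fE].
have l1 := L1loc_opp lg.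
split; first by have := L1locZ (-1) l1; under eq_fun do rewrite mulN1r.
move=> a b ab.
under eq_Rintegral do rewrite -mulN1r.
rewrite RintZ_itv// Rint_itv_opp// mulN1r -fE ?lerN2//; ring.
Qed.

Lemma AC_id : AC (fun x : R => x) (fun=> 1).
Proof. by apply: AC_C1 => x; exact: cvg_cst. Qed.

(** Compose f with a primitive of max (s, 0): the result has nonpositive
    derivative, and the primitive is positive exactly for positive s. *)
Lemma AC_barrier f g x : AC f g -> 0 <= x -> f 0 <= 0 ->
  (forall t, 0 <= t -> t <= x -> 0 < f t -> g t <= 0) -> f x <= 0.
Proof.
move=> ACf x0 f0 Hg.
pose h s : R := Num.max s 0.
have ch : continuous h.
  by move=> s; apply: continuous_max; [exact: cvg_id|exact: cvg_cst].
have ACH : AC (fun t => prim h (f t)) (fun t => h (f t) * g t).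
  apply: (@AC_comp _ _ _ setT) => //.
  - by move=> s t u _ _ _; exact: is_derive_prim.
  - by move=> s; exact: d_cont (is_derive_prim s ch).
  - by move=> s _; exact: ch.
have lh : L1loc h by exact: L1_cont_cc.
have l0 : L1loc (fun=> 0 : R) by apply: L1_cont_cc => ?; exact: cvg_cst.
have H0 s : s <= 0 -> prim h s = 0.
  rewrite le_eqVlt => /predU1P[->|s0]; first exact: prim0.
  rewrite /prim leNgt s0/=; rewrite (@eq_Rint_itv _ _ (fun=> 0)).
    by rewrite Rint_itv_cst ?mul0r ?oppr0// ltW.
  by move=> t _ t0; rewrite /h max_r.
have Hpos s : 0 < s -> 0 < prim h s.
  move=> s0; rewrite /prim (ltW s0) (@eq_Rint_itv _ _ (fun t => 2^-1 * (2 * (t * 1)))).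
    rewrite RintZ_itv; last exact: AC_L1loc (AC_sqr AC_id).
    by rewrite (AC_int (AC_sqr AC_id)) ?(ltW s0)// expr0n/= subr0 mulr_gt0 ?invr_gt0 ?exprn_gt0.
  by move=> t t0 _; rewrite /h max_l//; field.
have : prim h (f x) - prim h (f 0) <= 0.
  rewrite -(AC_int ACH x0).
  apply: (@le_trans _ _ (\int[mu]_(t in `[0, x]) 0)); last first.
    by rewrite Rint_itv_cst// mul0r.
  apply: le_Rint_itv => //; first exact: AC_L1loc ACH.
  move=> t t0 tx; rewrite /h; have [ft|ft] := leP (f t) 0; first by rewrite mul0r.
  by rewrite mulr_ge0_le0 ?(ltW ft)//; exact: Hg.
rewrite (H0 _ f0) subr0; apply: contraTT; rewrite -!ltNge; exact: Hpos.
Qed.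

End Reflection.

Section PowerEstimates.
Context {R : realType}.
Context (k r : R).
Hypotheses (k0 : 0 < k) (r1 : 1 <= r).
Implicit Types (q p x y M : R).
Local Notation sq2 := (sq2 k).

Local Ltac slra := first [ lra | have := r1; lra | have := k0; have := r1; lra ].

Lemma pow_mono x y : 0 <= x -> x <= y -> x `^ r <= y `^ r.
Proof.
move=> x0 xy; apply: ge0_ler_powR; rewrite ?nnegrE ?(le_trans x0 xy)//; slra.
Qed.

Lemma pow_lt x y : 0 <= x -> x < y -> x `^ r < y `^ r.
Proof.
move=> x0 xy; apply: gt0_ltr_powR; rewrite ?nnegrE ?(le_trans x0 (ltW xy))//; slra.
Qed.

(** Mean value theorem; the slope r s^(r-1) is increasing since r >= 1. *)
Lemma pow_lip M x y : 0 <= x -> x <= y -> y <= M ->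
  y `^ r - x `^ r <= r * M `^ (r - 1) * (y - x).
Proof.
move=> x0; rewrite le_eqVlt => /predU1P[->|xy] yM; first by rewrite !subrr mulr0.
have y0 : 0 < y by exact: le_lt_trans xy.
have [] := @MVT R (fun s => `|s| `^ r) (fun s => r * s `^ (r - 1)) x y xy.
- move=> z; rewrite in_itv/= => /andP[xz _]; have z0 := le_lt_trans x0 xz.
  apply: d_near (d_powR r z0); near=> s; rewrite ger0_norm//.
  by apply: ltW; near: s; exact: lt_nbhsr.
- by apply: continuous_subspaceT; apply: continuous_pw; slra.
move=> z; rewrite in_itv/= => /andP[xz zy].
rewrite (ger0_norm x0) (ger0_norm (ltW y0)) => ->.
rewrite ler_wpM2r ?subr_ge0 ?(ltW xy)// ler_wpM2l//; first slra.
apply: ge0_ler_powR; rewrite ?nnegrE; [slra|slra|slra|slra].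
Unshelve. all: by end_near. Qed.

Lemma pow_lipabs M x y : 0 <= x -> x <= M -> 0 <= y -> y <= M ->
  `|y `^ r - x `^ r| <= r * M `^ (r - 1) * `|y - x|.
Proof.
move=> x0 xM y0 yM; have [xy|/ltW yx] := leP x y.
  rewrite !ger0_norm ?subr_ge0 ?pow_mono//; exact: pow_lip.
rewrite distrC [`|y - x|]distrC !ger0_norm ?subr_ge0 ?pow_mono//; exact: pow_lip.
Qed.

(** Write s^r / sq2(s) as s^(r-1) times s / sqrt (1 + 2 k s), both increasing. *)
Lemma speed_mono x y : 0 <= x -> x <= y -> x `^ r / sq2 x <= y `^ r / sq2 y.
Proof.
move=> x0 xy; have y0 := le_trans x0 xy.
rewrite -(@mulr_powRB1 _ x r) -?(@mulr_powRB1 _ y r)//; [|slra|slra].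
rewrite mulrAC [leRHS]mulrAC; apply: ler_pM.
- by rewrite divr_ge0// ltW// sq2_gt0.
- exact: powR_ge0.
- rewrite ler_pdivrMr ?sq2_gt0// mulrAC ler_pdivlMr ?sq2_gt0//.
  rewrite -ler_sqr ?nnegrE ?mulr_ge0 ?(ltW (sq2_gt0 k0 _))//.
  rewrite !exprMn !sq2_sqr// !ger0_norm//.
  have h1 : x ^+ 2 <= y ^+ 2 by rewrite ler_sqr.
  have h2 : x * y * x <= x * y * y by rewrite ler_wpM2l// mulr_ge0.
  have h3 : k * (x * y * x) <= k * (x * y * y) by rewrite ler_wpM2l// ltW.
  by nra.
- apply: ge0_ler_powR; rewrite ?nnegrE//; slra.
Qed.

Lemma speed_lip d x y : 0 <= x -> 0 <= y -> 0 <= d -> y `^ r <= x `^ r + d ->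
  y `^ r / sq2 y <= x `^ r / sq2 x + d.
Proof.
move=> x0 y0 d0 yx; have [h|/ltW h] := leP y x.
  by apply: le_trans (speed_mono y0 h) _; rewrite lerDl.
have s1 := sq2_ge1 k0 x; have s2 := sq2_gt0 k0 x; have s3 := sq2_gt0 k0 y.
have s4 := sq2_mono k0 x0 h.
apply: (@le_trans _ _ (y `^ r / sq2 x)).
  by rewrite ler_wpM2l ?powR_ge0// lef_pV2.
rewrite ler_pdivrMr// mulrDl divfK ?gt_eqF//; apply: le_trans yx _.
by rewrite lerD2l ler_peMr.
Qed.

End PowerEstimates.

Section Comparison.
Context {R : realType}.
Local Notation mu := (@lebesgue_measure R).
Context (k c r : R).
Hypotheses (k0 : 0 < k) (c0 : 0 < c) (r1 : 1 <= r).
Implicit Types (x t : R).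
Local Notation sq2 := (sq2 k).

Local Ltac slra := first [ lra | have := r1; lra | have := k0; have := r1; lra ].

(** Up to E, sqrt (Qn^r - q^r) grows with speed at most r c q^r / sq2(q), and
    the speed of rho0 is the same increasing function of U^2.  Wherever the
    former exceeds rho0, q is below U^2 up to the difference of the peaks, hence
    its speed is at most that of rho0, and the barrier argument applies.  Adding
    eta^2 under the root makes it differentiable at the maximum, at the price of
    the factor 1 / eta before E. *)
Lemma comparison (Q Qn eta : R) (U rho0 q dq E : R -> R) x :
  0 < Q -> 0 < Qn -> 0 < eta -> 0 <= x ->
  (forall t, 0 <= t -> 0 <= rho0 t) ->
  (forall t, rho0 t ^+ 2 + (U t ^+ 2) `^ r = Q `^ r) ->
  (forall t, is_derive t 1 rho0 (r * c * (U t ^+ 2) `^ r / sq2 (U t ^+ 2))) ->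
  continuous U ->
  AC q dq -> (forall t, 0 <= q t <= Qn) -> q 0 = Qn ->
  L1loc E -> (forall t, 0 <= E t) ->
  (forall t, 0 <= t -> - (2 * rate k c r Qn (q t) * q t) - E t <= dq t) ->
  Num.sqrt (Qn `^ r + eta ^+ 2 - q x `^ r) <=
  rho0 x + (eta + r * c * (`|Qn `^ r - Q `^ r| + eta ^+ 2) * x
    + r / 2 * Qn `^ (r - 1) / eta * \int[mu]_(t in `[0, x]) E t).
Proof.
move=> Q0 Qn0 eta0 x0 rho0_ge0 rhoE drho cU ACq qr q0 lE E0 Hdq.
have r0 : 0 < r by slra.
pose Z := Qn `^ r + eta ^+ 2.
have e2 : 0 < eta ^+ 2 by rewrite exprn_gt0.
pose H (s : R) := Num.sqrt (Z - `|s| `^ r).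
pose h (s : R) := - (r * `|s| `^ (r - 1)) / (2 * H s).
have Hge s : 0 <= s <= Qn -> eta <= H s.
  move=> /andP[s0 sQ]; rewrite -[leLHS](ger0_norm (ltW eta0)) -sqrtr_sqr /H.
  rewrite ler_sqrt ger0_norm//.
    by rewrite /Z; have := pow_mono r1 s0 sQ; lra.
  by rewrite /Z; have := pow_mono r1 s0 sQ; lra.
have cH : continuous H.
  apply: continuous_sqrt => s; apply: cvgB; first exact: cvg_cst.
  by apply: continuous_pw; slra.
have ch s : 0 <= s <= Qn -> {for s, continuous h}.
  move=> sr; apply: cvgM.
    by apply: cvgN; apply: cvgMr; apply: continuous_pw; slra.
  have h0 : 0 < 2 * H s by rewrite mulr_gt0// (lt_le_trans eta0)// Hge.
  apply: cvgV; first by rewrite gt_eqF.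
  by apply: cvgMr; exact: cH.
have ACrho : AC (fun t => H (q t)) (fun t => h (q t) * dq t).
  apply: (@AC_comp _ _ _ [set s | 0 <= s <= Qn]) => //.
  move=> s t u /= /andP[s0 _] /andP[_ uQ] /andP[st tu].
  have t0 : 0 < t by exact: le_lt_trans st.
  have tr : 0 <= t <= Qn by apply/andP; split; lra.
  have Zt : 0 < Z - `|t| `^ r.
    by have := Hge t tr; rewrite /H => h1; rewrite -sqrtr_gt0; lra.
  have dd : is_derive t 1 (fun s => Z - `|s| `^ r) (0 - r * t `^ (r - 1)).
    apply: dB (dcst Z t) _; apply: d_near (d_powR r t0); near=> s'.
    by rewrite ger0_norm//; apply: ltW; near: s'; exact: lt_nbhsr.
  have dS := @d_sqrt R (fun s => Z - `|s| `^ r) t _ Zt dd.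
  apply: d_eq dS _.
  by rewrite /h /H (ger0_norm (ltW t0)) sub0r.
pose A := r * c * (`|Qn `^ r - Q `^ r| + eta ^+ 2).
pose D := r / 2 * Qn `^ (r - 1) / eta.
pose drho0 t := r * c * (U t ^+ 2) `^ r / sq2 (U t ^+ 2).
have ACrho0 : AC rho0 drho0.
  apply: AC_C1 => //; rewrite /drho0.
  have cU2 : continuous (fun t => U t ^+ 2).
    by under eq_fun do rewrite expr2; exact: continuous_mulfun.
  move=> t; apply: cvgM.
    apply: cvgMr.
    have -> : (fun t => (U t ^+ 2) `^ r) = (fun t => `|U t ^+ 2| `^ r).
      by apply/funext => s; rewrite (ger0_norm (sqr_ge0 _)).
    rewrite -(ger0_norm (sqr_ge0 (U t))).
    apply: (@continuous_comp _ _ _ (fun t => U t ^+ 2) (fun s => `|s| `^ r)); first exact: cU2.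
    by apply: continuous_pw; slra.
  apply: cvgV; first by rewrite gt_eqF// sq2_gt0.
  apply: (@continuous_comp _ _ _ (fun t => U t ^+ 2) sq2); [exact: cU2|exact: continuous_sq2].
have ACG := AC_B (AC_B (AC_B (AC_B ACrho ACrho0) (AC_cst eta)) (AC_Z A AC_id))
  (AC_Z D (AC_prim lE)).
suff : H (q x) - rho0 x - eta - A * x - D * prim E x <= 0.
  rewrite /H (ger0_norm (proj1 (andP (qr x)))) [prim E x]/prim x0 -/Z.
  rewrite -/A -/D; lra.
apply: (AC_barrier ACG x0).
  have -> : prim E 0 = 0 by exact: prim0.
  have -> : H (q 0) = eta.
    rewrite q0 /H (ger0_norm (ltW Qn0)) /Z addrAC subrr add0r sqrtr_sqr.
    exact: ger0_norm (ltW eta0).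
  by have := rho0_ge0 0 (lexx 0); lra.
move=> t t0 tx.
have primE0 : 0 <= prim E t by rewrite /prim t0; apply: Rintegral_ge0.
have A0 : 0 <= A.
  by rewrite /A !mulr_ge0 ?addr_ge0 ?sqr_ge0 ?(ltW c0) ?(ltW r0).
have D0 : 0 <= D.
  by rewrite /D !mulr_ge0 ?invr_ge0 ?powR_ge0 ?(ltW eta0) ?(ltW r0).
have At : 0 <= A * t by rewrite mulr_ge0.
have Dt : 0 <= D * prim E t by rewrite mulr_ge0.
move=> Gt.
have rr : rho0 t <= H (q t) by lra.
have /andP[qt0 qtQ] := qr t.
have Ht := Hge _ (qr t); have Ht0 : 0 < H (q t) by lra.
have H2 : H (q t) ^+ 2 = Z - q t `^ r.
  rewrite /H (ger0_norm qt0) sqr_sqrtr//.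
  by rewrite /Z; have := pow_mono r1 qt0 qtQ; lra.
have rho2 : rho0 t ^+ 2 <= H (q t) ^+ 2.
  by rewrite ler_sqr ?nnegrE ?rho0_ge0 ?(ltW Ht0).
have U2 : 0 <= U t ^+ 2 by exact: sqr_ge0.
pose d := `|Qn `^ r - Q `^ r| + eta ^+ 2.
have d0 : 0 <= d by rewrite addr_ge0 ?sqr_ge0.
have key : q t `^ r / sq2 (q t) <= (U t ^+ 2) `^ r / sq2 (U t ^+ 2) + d.
  apply: speed_lip => //.
  have := rhoE t; have := ler_norm (Qn `^ r - Q `^ r).
  by rewrite /d; move: rho2; rewrite H2 /Z; lra.
(* The logarithmic slope of q is at most 2 rate, up to E. *)
have spd : h (q t) * dq t <= r * c * (q t `^ r / sq2 (q t)) + D * E t.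
  have hh : h (q t) = - (r / 2 * q t `^ (r - 1) / H (q t)).
    by rewrite /h (ger0_norm qt0); field; rewrite gt_eqF.
  have hc : 0 <= r / 2 * q t `^ (r - 1) / H (q t).
    by rewrite !mulr_ge0 ?invr_ge0 ?powR_ge0 ?(ltW Ht0) ?(ltW r0).
  rewrite hh mulNr -mulrN.
  apply: (@le_trans _ _ (r / 2 * q t `^ (r - 1) / H (q t) * (2 * rate k c r Qn (q t) * q t + E t))).
    by rewrite ler_wpM2l//; have := Hdq t t0; lra.
  rewrite mulrDr; apply: lerD.
    have -> : r / 2 * q t `^ (r - 1) / H (q t) * (2 * rate k c r Qn (q t) * q t) =
      r * c * (q t * q t `^ (r - 1) / sq2 (q t)) * (wQ r Qn (q t) / H (q t)).
      by rewrite /rate; field; rewrite !gt_eqF// sq2_gt0.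
    rewrite mulr_powRB1//.
    rewrite ler_piMr//.
      by rewrite !mulr_ge0 ?invr_ge0 ?powR_ge0 ?(ltW (sq2_gt0 k0 _)) ?(ltW c0) ?(ltW r0).
    rewrite ler_pdivrMr// mul1r /wQ /H ler_sqrt.
      by rewrite /Z; lra.
    by move: H2 Ht; rewrite (ger0_norm qt0) => <- _; exact: sqr_ge0.
  rewrite ler_wpM2r//; apply: ler_pM.
  - by rewrite !mulr_ge0 ?powR_ge0 ?(ltW r0).
  - by rewrite invr_ge0 ltW.
  - rewrite ler_wpM2l ?mulr_ge0 ?(ltW r0)//.
    by apply: ge0_ler_powR; rewrite ?nnegrE ?(ltW Qn0)//; slra.
  - by rewrite lef_pV2.
have key2 : r * c * (q t `^ r / sq2 (q t)) <= drho0 t + A.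
  rewrite /drho0 /A -/d.
  have rc0 : 0 <= r * c by rewrite mulr_ge0// ltW.
  have := ler_wpM2l rc0 key; lra.
rewrite mulr1; lra.
Unshelve. all: by end_near. Qed.

End Comparison.

(** * Convergence to the profile *)

Section NullSequences.
Context {R : realType}.
Local Notation mu := (@lebesgue_measure R).
Implicit Types (u v : nat -> R) (f h : nat -> R -> R) (g : R -> R).

Lemma cvg0D u v : u n @[n --> \oo] --> (0 : R) -> v n @[n --> \oo] --> (0 : R) ->
  u n + v n @[n --> \oo] --> (0 : R).
Proof. by move=> u0 v0; rewrite -(addr0 0); exact: cvgD. Qed.

Lemma cvg0Z (C : R) u : u n @[n --> \oo] --> (0 : R) ->
  C * u n @[n --> \oo] --> (0 : R).
Proof. by move=> u0; rewrite -(mulr0 C); exact: cvgMr. Qed.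

Lemma cvg_sub0 u (l : R) : u n @[n --> \oo] --> l -> u n - l @[n --> \oo] --> (0 : R).
Proof. by move=> ul; rewrite -(subrr l); apply: cvgB => //; exact: cvg_cst. Qed.

Lemma cvg0_norm u : u n @[n --> \oo] --> (0 : R) -> `|u n| @[n --> \oo] --> (0 : R).
Proof. by move=> u0; rewrite -(normr0 R); exact: cvg_norm. Qed.

Lemma cvg0_tau u (C : R) : (forall n, 0 <= u n) -> 0 <= C ->
  (forall tau, 0 < tau -> exists2 v : nat -> R, v n @[n --> \oo] --> (0 : R) &
     forall n, u n <= tau * C + v n) ->
  u n @[n --> \oo] --> (0 : R).
Proof.
move=> u0 C0 H; apply/cvgrPdist_lt => e e0.
have C1 : 0 < C + 1 by lra.
pose tau := e / 2 / (C + 1).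
have tau0 : 0 < tau by rewrite !divr_gt0.
have [v /cvgrPdist_lt v0 uv] := H _ tau0.
have e20 : 0 < e / 2 by rewrite divr_gt0.
have := v0 _ e20; apply: filterS => n; rewrite !sub0r !normrN (ger0_norm (u0 n)) => vn.
apply: le_lt_trans (uv n) _.
have h1 : tau * C <= e / 2.
  by rewrite /tau -mulrA ler_piMr ?(ltW e20)// mulrC ler_pdivrMr// mul1r; lra.
have := ler_norm (v n); lra.
Qed.

Lemma cvg_Rint0_dominated f g : (forall n, measurable_fun setT (f n)) -> L1 g ->
  (forall n x, 0 <= f n x) -> (forall n x, f n x <= g x) ->
  (forall x, f n x @[n --> \oo] --> (0 : R)) ->
  \int[mu]_x f n x @[n --> \oo] --> (0 : R).
Proof.
move=> mf Ig f0 fg fx.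
have [|||||_ _ H] := @dominated_convergence _ _ _ mu setT measurableT
   (fun n x => (f n x)%:E) (fun=> 0%E) (fun x => (g x)%:E).
- by move=> n; apply/measurable_EFinP; exact: mf.
- by apply: measurable_cst.
- by apply: aeW => x _; apply: (cvg_EFin _ (fx x)); exact: nearW.
- exact: Ig.
- by apply: aeW => x n _; rewrite /= lee_fin ger0_norm.
have {}H : (\int[mu]_x (f n x)%:E)%E @[n --> \oo] --> (0%R)%:E.
  by move: H; rewrite integral0.
by move/fine_cvg : H.
Qed.

(** The positive part of f - h is dominated by g; the rest of f is at most h,
    which needs to be small in the mean only. *)
Lemma cvg_Rint0 f h g : (forall n, L1 (f n)) -> (forall n, L1 (h n)) -> L1 g ->
  (forall n x, 0 <= f n x) -> (forall x, 0 <= g x) ->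
  (forall n x, f n x <= h n x + g x) ->
  (forall x, Num.max (f n x - h n x) 0 @[n --> \oo] --> (0 : R)) ->
  \int[mu]_x h n x @[n --> \oo] --> (0 : R) ->
  \int[mu]_x f n x @[n --> \oo] --> (0 : R).
Proof.
move=> If Ih Ig f0 g0 fhg fh0 h0.
pose d n x := Num.max (f n x - h n x) 0.
have md n : measurable_fun setT (d n).
  apply: measurable_maxr; last exact: measurable_cst.
  by apply: measurable_funB; apply: L1_measurable.
have d0 n x : 0 <= d n x by rewrite /d le_max lexx orbT.
have dg n x : d n x <= g x.
  by rewrite /d ge_max g0 andbT; have := fhg n x; lra.
have Id n : L1 (d n) by apply: L1_le Ig => // x; rewrite ger0_norm.
have id0 := cvg_Rint0_dominated md Ig d0 dg fh0.
apply: (@cvg0_le _ _ (fun n => \int[mu]_x h n x + \int[mu]_x d n x)); last exact: cvg0D.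
move=> n; rewrite ger0_norm; last by apply: Rintegral_ge0 => x _.
rewrite -RintD//; apply: le_RintT => //; first exact: L1D.
by move=> x; rewrite -lerBlDl /d le_max lexx.
Qed.

Lemma young (t x y : R) : 0 < t -> 2 * `|x * y| <= t * x ^+ 2 + y ^+ 2 / t.
Proof.
move=> t0; rewrite -(ler_pM2l t0).
have -> : t * (t * x ^+ 2 + y ^+ 2 / t) = t ^+ 2 * x ^+ 2 + y ^+ 2.
  by field; rewrite gt_eqF.
rewrite -(real_normK (num_real x)) -(real_normK (num_real y)) normrM.
have := sqr_ge0 (t * `|x| - `|y|); lra.
Qed.

End NullSequences.

Section LowerBound.
Context {R : realType}.
Local Notation mu := (@lebesgue_measure R).
Context (k c r : R).
Hypotheses (k0 : 0 < k) (c0 : 0 < c) (r1 : 1 <= r).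
Implicit Types (x t : R).
Local Notation sq2 := (sq2 k).

Local Ltac slra := first [ lra | have := r1; lra | have := k0; have := r1; lra ].

Lemma cvg_powR (Qn : nat -> R) (Q s : R) : 0 <= s -> 0 < Q -> (forall n, 0 < Qn n) ->
  Qn n @[n --> \oo] --> Q -> Qn n `^ s @[n --> \oo] --> Q `^ s.
Proof.
move=> s0 Q0 Qn0 QnQ.
have -> : (fun n => Qn n `^ s) = (fun n => `|Qn n| `^ s).
  by apply/funext => n; rewrite gtr0_norm.
rewrite -[in X in _ --> X](gtr0_norm Q0).
apply: (@continuous_cvg _ _ _ _ _ _ (fun t : R => `|t| `^ s)) => //.
exact: continuous_pw.
Qed.

(** Let n tend to infinity in comparison with eta fixed.  The limit bound for
    q^r is at least P^r - eta B for a constant B, where P = U^2, so a choice of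
    eta small with respect to the gap between P^r and s^r suffices. *)
Lemma lower_bound (Q : R) (Qn : nat -> R) (U rho0 : R -> R) (q dq E : nat -> R -> R) x s :
  0 < Q -> (forall n, 0 < Qn n) -> Qn n @[n --> \oo] --> Q -> 0 <= x ->
  (forall t, 0 <= t -> 0 <= rho0 t) ->
  (forall t, rho0 t ^+ 2 + (U t ^+ 2) `^ r = Q `^ r) ->
  (forall t, is_derive t 1 rho0 (r * c * (U t ^+ 2) `^ r / sq2 (U t ^+ 2))) ->
  continuous U ->
  (forall n, AC (q n) (dq n)) -> (forall n t, 0 <= q n t <= Qn n) ->
  (forall n, q n 0 = Qn n) ->
  (forall n, L1loc (E n)) -> (forall n t, 0 <= E n t) ->
  (forall n t, 0 <= t ->
     - (2 * rate k c r (Qn n) (q n t) * q n t) - E n t <= dq n t) ->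
  \int[mu]_(t in `[0, x]) E n t @[n --> \oo] --> (0 : R) ->
  0 <= s -> s < U x ^+ 2 -> \forall n \near \oo, s < q n x.
Proof.
move=> Q0 Qn0 QnQ x0 rho_ge0 rhoE drho cU ACq qr q0 lE E0 Hdq IE s0 sP.
have r0 : 0 < r by slra.
have ro := rho_ge0 x x0.
pose K := 1 + r * c * x; pose B := 2 * rho0 x * K + K ^+ 2.
have K1 : 1 <= K by rewrite /K lerDl !mulr_ge0// ltW.
have B0 : 0 < B.
  by rewrite /B ltr_wpDl ?exprn_gt0 ?(lt_le_trans ltr01 K1)// !mulr_ge0// (le_trans ler01).
pose gap := (U x ^+ 2) `^ r - s `^ r.
have gap0 : 0 < gap by rewrite subr_gt0 pow_lt.
pose eta := gap / (gap + B).
have gB : 0 < gap + B by rewrite addr_gt0.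
have eta0 : 0 < eta by rewrite divr_gt0.
have eta1 : eta <= 1 by rewrite ler_pdivrMr// mul1r lerDl ltW.
have etaB : eta * B < gap.
  by rewrite /eta mulrAC ltr_pdivrMr// ltr_pM2l// ltrDr.
pose T n := rho0 x + (eta + r * c * (`|Qn n `^ r - Q `^ r| + eta ^+ 2) * x
    + r / 2 * Qn n `^ (r - 1) / eta * \int[mu]_(t in `[0, x]) E n t).
pose T0 := rho0 x + (eta + r * c * (0 + eta ^+ 2) * x + r / 2 * Q `^ (r - 1) / eta * 0).
pose S n := Qn n `^ r + eta ^+ 2 - T n ^+ 2.
have Qr := cvg_powR (ltW r0) Q0 Qn0 QnQ.
have Qr1 : Qn n `^ (r - 1) @[n --> \oo] --> Q `^ (r - 1).
  by apply: cvg_powR => //; slra.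
have cT : T n @[n --> \oo] --> T0.
  apply: cvgD; first exact: cvg_cst.
  apply: cvgD.
    apply: cvgD; first exact: cvg_cst.
    apply: cvgMl; apply: cvgMr; apply: cvgD; last exact: cvg_cst.
    exact: cvg0_norm (cvg_sub0 Qr).
  by apply: cvgM => //; apply: cvgMl; apply: cvgMr.
have cS : S n @[n --> \oo] --> (Q `^ r + eta ^+ 2 - T0 ^+ 2).
  apply: cvgB; first by apply: cvgD => //; exact: cvg_cst.
  under eq_fun do rewrite expr2; rewrite expr2; exact: cvgM.
have lt : s `^ r < Q `^ r + eta ^+ 2 - T0 ^+ 2.
  have T0E : T0 = rho0 x + eta * (1 + r * c * x * eta) by rewrite /T0; ring.
  have T0_le : T0 <= rho0 x + eta * K.
    rewrite T0E lerD2l ler_wpM2l ?(ltW eta0)// /K lerD2l ler_piMr//.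
    by rewrite !mulr_ge0// ltW.
  have T0_ge : 0 <= T0.
    have e1 : 0 <= r * c * x * eta by exact: mulr_ge0 (mulr_ge0 (mulr_ge0 (ltW r0) (ltW c0)) x0) (ltW eta0).
    by rewrite T0E; apply: addr_ge0 => //; apply: mulr_ge0 (ltW eta0) (addr_ge0 ler01 e1).
  have h1 : T0 ^+ 2 <= (rho0 x + eta * K) ^+ 2.
    by rewrite ler_sqr ?nnegrE// (le_trans T0_ge).
  have h2 : (rho0 x + eta * K) ^+ 2 <= rho0 x ^+ 2 + eta * B.
    have -> : (rho0 x + eta * K) ^+ 2 = rho0 x ^+ 2 + eta * (2 * rho0 x * K + eta * K ^+ 2).
      by ring.
    rewrite lerD2l ler_wpM2l ?(ltW eta0)// /B lerD2l ler_piMl ?sqr_ge0//.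
  have h3 := rhoE x; have h4 := sqr_ge0 eta.
  by move: etaB; rewrite /gap; lra.
have lS : \forall n \near \oo, s `^ r < S n by exact: (cvgr_gt _ cS).
apply: filterS lS => n Sn.
have /= := comparison k0 c0 r1 Q0 (Qn0 n) eta0 x0 rho_ge0 rhoE drho cU
  (ACq n) (qr n) (q0 n) (lE n) (E0 n) (Hdq n).
rewrite -/(T n) => cmp.
have T_ge : 0 <= T n by apply: le_trans cmp; exact: sqrtr_ge0.
have /andP[qx0 qxQ] := qr n x.
have Z0 : 0 <= Qn n `^ r + eta ^+ 2 - q n x `^ r.
  by have := pow_mono r1 qx0 qxQ; have := sqr_ge0 eta; lra.
have h5 : Qn n `^ r + eta ^+ 2 - q n x `^ r <= T n ^+ 2.
  by rewrite -(sqr_sqrtr Z0) ler_sqr ?nnegrE ?sqrtr_ge0.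
rewrite ltNge; apply/negP => qs.
by have := pow_mono r1 qx0 qs; move: Sn; rewrite /S; lra.
Qed.

End LowerBound.

Section RateModulus.
Context {R : realType}.
Context (k c r : R).
Hypotheses (k0 : 0 < k) (c0 : 0 < c) (r1 : 1 <= r).
Implicit Types (q p t M Q : R).
Local Notation sq2 := (sq2 k).

Local Ltac slra := first [ lra | have := r1; lra | have := k0; have := r1; lra ].

Lemma sqrt_mod (t x y : R) : 0 < t -> 0 <= x -> 0 <= y ->
  `|Num.sqrt x - Num.sqrt y| <= t + `|x - y| / t.
Proof.
move=> t0 x0 y0.
have E : `|x - y| = `|Num.sqrt x - Num.sqrt y| * (Num.sqrt x + Num.sqrt y).
  rewrite -[in LHS](sqr_sqrtr x0) -[in LHS](sqr_sqrtr y0) subr_sqr normrM; congr (_ * _).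
  by rewrite ger0_norm// addr_ge0 ?sqrtr_ge0.
have a0 := sqrtr_ge0 x; have b0 := sqrtr_ge0 y.
have [h|h] := leP (Num.sqrt x + Num.sqrt y) t.
  apply: (@le_trans _ _ t); last by rewrite lerDl divr_ge0// ltW.
  by rewrite ler_norml; apply/andP; split; lra.
apply: (@le_trans _ _ (`|x - y| / t)); last by rewrite lerDr ltW.
by rewrite ler_pdivlMr// E ler_wpM2l// ltW.
Qed.

(** The coefficient of |p - q| in rate_mod. *)
Definition rmod M t : R := c * (r * M `^ (r - 1)) / t + c * M `^ (r / 2) * k.

Lemma rmod_ge0 M t : 0 < t -> 0 <= rmod M t.
Proof.
have r0 : 0 < r by slra.
move=> t0; rewrite /rmod; apply: addr_ge0.
  by apply: divr_ge0 (ltW t0); rewrite !mulr_ge0 ?powR_ge0 ?(ltW c0) ?(ltW r0).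
by rewrite !mulr_ge0 ?powR_ge0 ?(ltW c0) ?(ltW k0).
Qed.

(** The square root in rate is only Hoelder continuous at the peak; the inequality
    |sqrt x - sqrt y| <= t + |x - y| / t trades this for a free parameter t. *)
Lemma rate_mod M t Q Q' p q : 0 < t -> 0 <= p <= Q -> 0 <= q <= Q' -> Q <= M -> Q' <= M ->
  `|rate k c r Q p - rate k c r Q' q| <=
  c * t + (c / t * `|Q `^ r - Q' `^ r| + rmod M t * `|p - q|).
Proof.
move=> t0 /andP[p0 pQ] /andP[q0 qQ] QM QM'.
have Qp := pow_mono r1 p0 pQ; have Qq := pow_mono r1 q0 qQ.
have s1 := sq2_ge1 k0 p; have s2 := sq2_ge1 k0 q.
have s1' := sq2_gt0 k0 p; have s2' := sq2_gt0 k0 q.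
have L := pow_lipabs r1 q0 (le_trans qQ QM') p0 (le_trans pQ QM).
have Mq : Q' `^ (r / 2) <= M `^ (r / 2).
  by apply: ge0_ler_powR; rewrite ?nnegrE ?(le_trans q0 qQ) ?(le_trans (le_trans q0 qQ) QM')//; slra.
have -> : rate k c r Q p - rate k c r Q' q =
  c * ((wQ r Q p - wQ r Q' q) / sq2 p + wQ r Q' q * ((sq2 q - sq2 p) / (sq2 p * sq2 q))).
  by rewrite /rate; field; rewrite !gt_eqF.
rewrite normrM (gtr0_norm c0).
have e1 : `|(wQ r Q p - wQ r Q' q) / sq2 p| <= t + (`|Q `^ r - Q' `^ r| + r * M `^ (r - 1) * `|p - q|) / t.
  rewrite normrM normfV (gtr0_norm s1').
  apply: (@le_trans _ _ `|wQ r Q p - wQ r Q' q|).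
    by rewrite ler_pdivrMr// ler_peMr.
  rewrite /wQ (ger0_norm p0) (ger0_norm q0).
  apply: le_trans (sqrt_mod t0 _ _) _; rewrite ?subr_ge0// lerD2l.
  rewrite ler_pM2r ?invr_gt0//.
  have -> : Q `^ r - p `^ r - (Q' `^ r - q `^ r) = (Q `^ r - Q' `^ r) - (p `^ r - q `^ r) by ring.
  apply: le_trans (ler_normB _ _) _; by rewrite lerD2l.
have e2 : `|wQ r Q' q * ((sq2 q - sq2 p) / (sq2 p * sq2 q))| <= M `^ (r / 2) * (k * `|p - q|).
  rewrite normrM (ger0_norm (wQ_ge0 _ _ _)).
  apply: ler_pM => //; [exact: wQ_ge0|exact: le_trans (wQ_le _ _ _) Mq|].
  rewrite normrM normfV (gtr0_norm (mulr_gt0 s1' s2')).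
  have ss : 1 <= sq2 p * sq2 q by rewrite -[1]mulr1; apply: ler_pM.
  apply: (@le_trans _ _ `|sq2 q - sq2 p|).
    by rewrite ler_pdivrMr ?(lt_le_trans ltr01 ss)// ler_peMr.
  have [pq|/ltW qp] := leP p q.
    rewrite ger0_norm ?subr_ge0 ?sq2_mono// distrC ger0_norm ?subr_ge0//.
    exact: sq2_lip.
  rewrite distrC ger0_norm ?subr_ge0 ?sq2_mono// ger0_norm ?subr_ge0//.
  exact: sq2_lip.
have := le_trans (ler_normD _ _) (lerD e1 e2).
move/(ler_wpM2l (ltW c0)) => h; apply: le_trans h _.
rewrite le_eqVlt; apply/orP; left; apply/eqP; rewrite /rmod.
by field; rewrite gt_eqF.
Qed.

End RateModulus.

Section ProfileSlope.
Context {R : realType}.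
Local Notation mu := (@lebesgue_measure R).
Context (k c r : R).
Hypotheses (k0 : 0 < k) (c0 : 0 < c) (r1 : 1 <= r).
Variables (Q : R) (U rho : R -> R).
Hypotheses (Q0 : 0 < Q) (pU : profile k c r Q U rho).
Local Notation sq2 := (sq2 k).
Local Notation P := (fun x => U x ^+ 2).

Definition profile_slope (x : R) : R := - (c * rho x / sq2 (U x ^+ 2)) * U x.

(** rho has the sign of x and rho^2 = Q^r - P^r. *)
Lemma profile_speed x : c * rho x / sq2 (U x ^+ 2) = sgx x * rate k c r Q (U x ^+ 2).
Proof.
have -> : rate k c r Q (U x ^+ 2) = c * `|rho x| / sq2 (U x ^+ 2).
  by rewrite (profile_rho_abs pU).
rewrite /sgx; case: ifPn => [x0|].
  rewrite ger0_norm ?mul1r// -(profile_rho0 pU); exact: (profile_rho_mono k0 c0 r1 pU).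
rewrite -ltNge => /ltW x0; rewrite ler0_norm; first by ring.
rewrite -(profile_rho0 pU); exact: (profile_rho_mono k0 c0 r1 pU).
Qed.

Lemma profile_resid x : resid k c r Q U (fun=> 0) U profile_slope x = 0.
Proof.
rewrite /resid /sqn expr0n/= addr0 /profile_slope profile_speed; ring.
Qed.

Lemma profile_slope_continuous : continuous profile_slope.
Proof.
apply: continuous_mulfun; last exact: (profile_continuous pU).
move=> x; apply: cvgN; apply: cvgM.
  by apply: cvgMr; exact: (profile_rho_continuous pU).
apply: cvgV; first by rewrite gt_eqF ?sq2_gt0.
apply: (@continuous_comp _ _ _ P sq2); [exact: (profile_P_cont pU)|exact: continuous_sq2].
Qed.

Lemma profile_AC : AC U profile_slope.
Proof. by apply: AC_C1; [exact: profile_dU pU|exact: profile_slope_continuous]. Qed.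

Lemma profile_L2 : L2 U.
Proof.
split; first exact: continuous_measurable_fun (profile_continuous pU).
exact: (profile_L1 k0 c0 r1 Q0 pU).
Qed.

Lemma profile_L2_dU : L2 profile_slope.
Proof.
have mdU : measurable_fun setT profile_slope.
  exact: continuous_measurable_fun profile_slope_continuous.
split => //; have [_ lU] := profile_L2.
apply: L1_le (L1Z ((c * Q `^ (r / 2)) ^+ 2) lU); first exact: measurable_funX.
move=> x; rewrite ger0_norm ?sqr_ge0// /profile_slope exprMn sqrrN ler_wpM2r ?sqr_ge0//.
rewrite -real_normK ?num_real// ler_sqr ?nnegrE ?mulr_ge0 ?powR_ge0 ?(ltW c0)//.
have s1 := sq2_ge1 k0 (U x ^+ 2); have s0 := sq2_gt0 k0 (U x ^+ 2).
rewrite normrM normrM normfV (gtr0_norm c0) (gtr0_norm s0) ler_pdivrMr//.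
apply: (@le_trans _ _ (c * Q `^ (r / 2))).
  by rewrite ler_wpM2l ?(ltW c0)// (profile_rho_le pU).
by rewrite ler_peMr// mulr_ge0 ?powR_ge0 ?(ltW c0).
Qed.

End ProfileSlope.

Section Compactness.
Context {R : realType}.
Local Notation mu := (@lebesgue_measure R).
Context (k c r : R).
Hypotheses (k0 : 0 < k) (c0 : 0 < c) (r1 : 1 <= r).
Implicit Types (x t s : R).
Local Notation sq2 := (sq2 k).

Local Ltac slra := first [ lra | have := r1; lra | have := k0; have := r1; lra ].

Variables (Q : R) (U rho : R -> R).
Hypotheses (Q0 : 0 < Q) (pU : profile k c r Q U rho).
Variables (M : R) (Qn : nat -> R) (a b da db : nat -> R -> R).
Local Notation q n := (sqn (a n) (b n)).
Local Notation ra n := (resid k c r (Qn n) (a n) (b n) (a n) (da n)).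
Local Notation rb n := (resid k c r (Qn n) (a n) (b n) (b n) (db n)).
Local Notation P := (fun x => U x ^+ 2).
Local Notation D n := (\int[mu]_x (ra n x ^+ 2 + rb n x ^+ 2)).
Hypotheses (hp : forall n, H1pair (a n) (b n) (da n) (db n))
  (Qn0 : forall n, 0 < Qn n) (QnM : forall n, Qn n <= M)
  (qle : forall n x, q n x <= Qn n) (q0 : forall n, q n 0 = Qn n)
  (QnQ : Qn n @[n --> \oo] --> Q)
  (a0 : forall n, a n 0 = Num.sqrt (Qn n)) (b0 : forall n, b n 0 = 0)
  (D0 : D n @[n --> \oo] --> (0 : R))
  (mass_cvg : \int[mu]_x q n x @[n --> \oo] --> \int[mu]_x P x).

Let P_gt0 x : 0 < P x. Proof. exact: profile_P_gt0 pU x. Qed.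
Let P_L1 : L1 P. Proof. exact: (profile_L1 k0 c0 r1 Q0 pU). Qed.
Let cU : continuous U. Proof. exact: profile_continuous pU. Qed.
Let PQ x : P x <= Q. Proof. exact: (profile_PQ r1 Q0 pU). Qed.

Let l2a n : L2 (ra n). Proof. exact: (L2_ra k0 c0 r1 (Qn n) (hp n)). Qed.
Let l2b n : L2 (rb n). Proof. exact: (L2_rb k0 c0 r1 (Qn n) (hp n)). Qed.

Let L1D2 n : L1 (fun x => ra n x ^+ 2 + rb n x ^+ 2).
Proof. by have [_ h1] := l2a n; have [_ h2] := l2b n; exact: L1D. Qed.

Let q_L1 n : L1 (q n). Proof. exact: pair_L1q (hp n). Qed.

Let QM : Q <= M.
Proof.
rewrite leNgt; apply/negP => MQ.
have lM : \forall n \near \oo, M < Qn n by exact: (cvgr_gt _ QnQ).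
have [n] := filter_ex lM; by rewrite ltNge QnM.
Qed.

(* The deviation of q' from the law of the profile. *)
Let err n t := `|2 * (a n t * ra n t + b n t * rb n t)|.

Let err_L1 n : L1 (err n).
Proof.
apply: L1_norm; apply: L1Z; apply: L1D; apply: L2_M => //.
- exact: pair_a (hp n).
- exact: pair_b (hp n).
Qed.

Let err_ge0 n t : 0 <= err n t. Proof. exact: normr_ge0. Qed.

Let err_cvg : \int[mu]_t err n t @[n --> \oo] --> (0 : R).
Proof.
have m0 : 0 <= \int[mu]_x P x by apply: Rintegral_ge0 => x _; rewrite ltW.
apply: (@cvg0_tau _ _ (\int[mu]_x P x)) => //; first by move=> n; apply: Rintegral_ge0.
move=> tau tau0.
exists (fun n => tau * (\int[mu]_x q n x - \int[mu]_x P x) + tau^-1 * D n).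
  by apply: cvg0D; apply: cvg0Z => //; exact: cvg_sub0.
move=> n; apply: (@le_trans _ _ (\int[mu]_t (tau * q n t + tau^-1 * (ra n t ^+ 2 + rb n t ^+ 2)))).
  apply: le_RintT => //; first by apply: L1D; exact: L1Z.
  move=> t; rewrite /err normrM (ger0_norm (@ler0n R 2)).
  have h1 := young (a n t) (ra n t) tau0; have h2 := young (b n t) (rb n t) tau0.
  have := ler_normD (a n t * ra n t) (b n t * rb n t).
  by rewrite /sqn; lra.
rewrite RintD; [|exact: L1Z|exact: L1Z].
by rewrite !RintZ// mulrBr addrA (addrC (tau * _)) subrK.
Qed.

Let dqE n t : dsqn (a n) (b n) (da n) (db n) t =
  2 * (a n t * ra n t + b n t * rb n t) - sgx t * (2 * rate k c r (Qn n) (q n t) * q n t).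
Proof. by rewrite /dsqn /resid; move: (rate _ _ _ _ _) => w; rewrite /sqn; ring. Qed.

Let err_itv n (u v : R) : \int[mu]_(t in `[u, v]) err n t <= \int[mu]_t err n t.
Proof. exact: Rint_le_T. Qed.

(* For negative x the lower bound is applied to the reflected functions. *)
Let q_lower x s : 0 <= s -> s < P x -> \forall n \near \oo, s < q n x.
Proof.
move=> s0 sP; have [x0|/ltW x0] := leP 0 x.
  apply: (@lower_bound _ k c r k0 c0 r1 Q Qn U rho (fun n => q n)
    (fun n => dsqn (a n) (b n) (da n) (db n)) err) => //.
  - by move=> t t0; rewrite -(profile_rho0 pU); exact: (profile_rho_mono k0 c0 r1 pU).
  - exact: profile_eq pU.
  - exact: profile_drho pU.
  - by move=> n; exact: pair_ACq.
  - by move=> n t; rewrite sqn_ge0 qle.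
  - by move=> n; exact: L1_loc.
  - move=> n t t0; rewrite dqE /sgx t0 mul1r.
    by have := ler_norm (- (2 * (a n t * ra n t + b n t * rb n t))); rewrite normrN -/(err n t); lra.
  - apply: (cvg0_le _ err_cvg) => n; rewrite ger0_norm ?err_itv//.
    by apply: Rintegral_ge0.
have cUN : continuous (fun t => U (- t)).
  by move=> t; apply: (@continuous_comp _ _ _ (fun t => - t) U); [exact: opp_continuous|exact: cU].
have near_q : \forall n \near \oo, s < q n (- (- x)).
  apply: (@lower_bound _ k c r k0 c0 r1 Q Qn (fun t => U (- t)) (fun t => - rho (- t))
    (fun n t => q n (- t)) (fun n t => - dsqn (a n) (b n) (da n) (db n) (- t))
    (fun n t => err n (- t)) (- x)) => //.
  - by rewrite oppr_ge0.
  - move=> t t0; rewrite oppr_ge0 -(profile_rho0 pU).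
    by apply: (profile_rho_mono k0 c0 r1 pU); rewrite oppr_le0.
  - by move=> t; rewrite sqrrN (profile_eq pU).
  - move=> t; have dN : is_derive t 1 (fun s : R => - s) (- 1) by exact: is_deriveNid.
    have := dZ (-1) (dcomp (profile_drho pU (- t)) dN).
    under eq_fun do rewrite mulN1r.
    by move=> h; apply: d_eq h _; ring.
  - by move=> n; apply: AC_opp; exact: pair_ACq.
  - by move=> n t; rewrite sqn_ge0 qle.
  - by move=> n; rewrite oppr0.
  - by move=> n; apply: L1loc_opp; exact: L1_loc.
  - move=> n t; rewrite le_eqVlt => /predU1P[<-|t0].
      rewrite oppr0 dqE q0.
      have -> : rate k c r (Qn n) (Qn n) = 0.
        by rewrite /rate /wQ (gtr0_norm (Qn0 n)) subrr sqrtr0 mulr0 mul0r.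
      by have := ler_norm (2 * (a n 0 * ra n 0 + b n 0 * rb n 0)); rewrite -/(err n 0); lra.
    have sg : sgx (- t) = -1 by rewrite /sgx leNgt oppr_lt0 t0.
    rewrite dqE sg.
    by have := ler_norm (2 * (a n (- t) * ra n (- t) + b n (- t) * rb n (- t))); rewrite -/(err n (- t)); lra.
  - apply: (cvg0_le _ err_cvg) => n; rewrite ger0_norm; last by apply: Rintegral_ge0.
    by rewrite Rint_itv_opp ?err_itv//; exact: L1_loc.
  - by rewrite opprK.
by apply: filterS near_q => n; rewrite opprK.
Qed.

(* Since |q - P| = (q - P) + 2 (P - q)^+ and (P - q)^+ <= P tends to 0, the
   convergence of the masses gives convergence in L^1. *)
Let I1 : \int[mu]_x `|q n x - P x| @[n --> \oo] --> (0 : R).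
Proof.
have Lqp n : L1 (fun x => q n x - P x) by exact: L1B.
apply: (@cvg_Rint0 _ (fun n x => `|q n x - P x|) (fun n x => q n x - P x) (fun x => 2 * P x)) => //.
- by move=> n; exact: L1_norm.
- exact: L1Z.
- by move=> x; rewrite mulr_ge0// ltW.
- by move=> n x; rewrite ler_norml; have := sqn_ge0 (a n) (b n) x; have := P_gt0 x => ? ?; apply/andP; split; lra.
- move=> x; apply/cvgrPdist_lt => e e0.
  pose s := Num.max 0 (P x - e / 2).
  have sP : s < P x by rewrite /s gt_max P_gt0 /= ltrBlDr ltrDl divr_gt0.
  have s0 : 0 <= s by rewrite /s le_max lexx.
  have sle : P x - e / 2 <= s by rewrite /s le_max lexx orbT.
  apply: filterS (q_lower s0 sP) => n sq.
  rewrite sub0r normrN ger0_norm; last by rewrite le_max lexx orbT.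
  by rewrite gt_max e0 andbT ltrBlDr ltr_norml; apply/andP; split; lra.
have -> : (fun n => \int[mu]_x (q n x - P x)) = (fun n => \int[mu]_x q n x - \int[mu]_x P x).
  by apply/funext => n; rewrite RintB.
exact: cvg_sub0.
Qed.

Let w n x := `|rate k c r Q (P x) - rate k c r (Qn n) (q n x)|.

Let w_ge0 n x : 0 <= w n x. Proof. exact: normr_ge0. Qed.

Let Kc := c * M `^ (r / 2).

Let Kc0 : 0 <= Kc. Proof. by rewrite /Kc mulr_ge0 ?powR_ge0 ?(ltW c0). Qed.

Let rate_Kc (Q' t : R) : 0 < Q' -> Q' <= M -> rate k c r Q' t <= Kc.
Proof.
move=> Q'0 Q'M; apply: le_trans (rate_le r k0 c0 Q' t) _; rewrite /Kc ler_wpM2l ?(ltW c0)//.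
by apply: ge0_ler_powR; rewrite ?nnegrE ?(ltW Q'0) ?(le_trans (ltW Q'0) Q'M)//; slra.
Qed.

Let w_le n x : w n x <= Kc.
Proof.
rewrite /w; have h1 := rate_ge0 r k0 c0 Q (P x); have h2 := rate_ge0 r k0 c0 (Qn n) (q n x).
have h3 := rate_Kc (P x) Q0 QM; have h4 := rate_Kc (q n x) (Qn0 n) (QnM n).
by rewrite ler_norml; apply/andP; split; lra.
Qed.

Let mw n : measurable_fun setT (w n).
Proof.
apply: measurableT_comp => //; apply: measurable_funB.
  apply: (measurableT_comp (continuous_measurable_fun (@continuous_rate _ _ _ _ k0 r1 Q))).
  exact: L1_measurable P_L1.
apply: (measurableT_comp (continuous_measurable_fun (@continuous_rate _ _ _ _ k0 r1 (Qn n)))).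
exact: L1_measurable (q_L1 n).
Qed.

Let wP_L1 n : L1 (fun x => w n x * P x).
Proof.
apply: L1_le (L1Z Kc P_L1).
  by apply: measurable_funM => //; exact: L1_measurable P_L1.
move=> x; rewrite ger0_norm; first by rewrite ler_wpM2r ?w_le// ltW.
by rewrite mulr_ge0 ?w_ge0// ltW.
Qed.

Let I2 : \int[mu]_x (w n x * P x) @[n --> \oo] --> (0 : R).
Proof.
have m0 : 0 <= \int[mu]_x P x by apply: Rintegral_ge0 => x _; rewrite ltW.
apply: (@cvg0_tau _ _ (c * \int[mu]_x P x)).
- by move=> n; apply: Rintegral_ge0 => x _; rewrite mulr_ge0 ?w_ge0// ltW.
- by rewrite mulr_ge0// ltW.
move=> tau tau0.
exists (fun n => c / tau * \int[mu]_x P x * `|Qn n `^ r - Q `^ r|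
   + rmod k c r M tau * Q * \int[mu]_x `|q n x - P x|).
  apply: cvg0D; apply: cvg0Z; last exact: I1.
  by apply: cvg0_norm; apply: cvg_sub0; apply: cvg_powR => //; slra.
move=> n.
have Lqp : L1 (fun x => `|q n x - P x|) by apply: L1_norm; exact: L1B.
rewrite [leRHS](_ : _ = \int[mu]_x ((c * tau + c / tau * `|Qn n `^ r - Q `^ r|) * P x +
   rmod k c r M tau * Q * `|q n x - P x|)); last first.
  rewrite RintD; [|exact: L1Z|exact: L1Z].
  by rewrite !RintZ//; ring.
apply: le_RintT => //; first by apply: L1D; exact: L1Z.
move=> x.
have h := rate_mod k0 c0 r1 tau0 (p := P x) (Q := Q) (q := q n x) (Q' := Qn n) (M := M).
have {}h : w n x <= c * tau + (c / tau * `|Qn n `^ r - Q `^ r| + rmod k c r M tau * `|q n x - P x|).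
  rewrite distrC [`|q n x - _|]distrC; apply: h => //; first by rewrite ltW//= PQ.
  by rewrite sqn_ge0 qle.
have h1 := ler_wpM2r (ltW (P_gt0 x)) h; apply: le_trans h1 _.
have h2 : rmod k c r M tau * `|q n x - P x| * P x <= rmod k c r M tau * `|q n x - P x| * Q.
  by rewrite ler_wpM2l ?PQ// mulr_ge0// (rmod_ge0 k0 c0 r1).
by rewrite addrA mulrDl lerD2l [leRHS]mulrAC.
Qed.

Let U_L2 : L2 U.
Proof. by split; [exact: continuous_measurable_fun|exact: P_L1]. Qed.

Let I3 (f : nat -> R -> R) : (forall n, L2 (f n)) -> (forall n, \int[mu]_x (f n x ^+ 2) <= D n) ->
  \int[mu]_x `|f n x * U x| @[n --> \oo] --> (0 : R).
Proof.
move=> lf fD.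
have m0 : 0 <= \int[mu]_x P x by apply: Rintegral_ge0 => x _; rewrite ltW.
apply: (@cvg0_tau _ _ (\int[mu]_x P x)) => //.
  by move=> n; apply: Rintegral_ge0.
move=> tau tau0; exists (fun n => tau^-1 * D n); first exact: cvg0Z.
move=> n; have [_ lfn] := lf n.
apply: (@le_trans _ _ (\int[mu]_t (tau * P t + tau^-1 * f n t ^+ 2))).
  apply: le_RintT; [by apply: L1_norm; exact: L2_M|by apply: L1D; exact: L1Z|].
  move=> t; have := young (U t) (f n t) tau0; rewrite mulrC [U t * _]mulrC.
  by have := normr_ge0 (f n t * U t); lra.
rewrite RintD; [|exact: L1Z|exact: L1Z].
by rewrite !RintZ// lerD2l ler_wpM2l// invr_ge0 ltW.
Qed.

(* The quotient f V of a component f of u by U has derivative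
   V (R + (beta - sgx rate) f), where beta = - U' / U; on a compact set V is
   bounded, and the weights P and U in I2 and I3 are bounded below. *)
Let V x := (U x)^-1.
Let beta x := c * rho x / sq2 (P x).

Let betaE x : beta x = sgx x * rate k c r Q (P x).
Proof. exact: (profile_speed k0 c0 r1 pU). Qed.

Let cV : continuous V.
Proof. by move=> x; apply: cvgV; [rewrite gt_eqF// (profile_gt0 pU)|exact: cU]. Qed.

Let ACV : AC V (fun x => beta x * V x).
Proof.
apply: AC_C1.
  move=> x; have U0 : U x != 0 by rewrite gt_eqF// (profile_gt0 pU).
  apply: d_eq (dV U0 (profile_dU pU x)) _.
  have s0 := sq2_gt0 k0 (P x).
  by rewrite /beta /V; field; rewrite U0 gt_eqF.
have -> : (fun x => beta x * V x) = (fun x => c * (rho x * ((sq2 (P x))^-1 * V x))).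
  by apply/funext => x; rewrite /beta; ring.
move=> x; apply: cvgMr; apply: cvgM; first exact: (profile_rho_continuous pU).
apply: cvgM; last exact: cV.
apply: cvgV; first by rewrite gt_eqF ?sq2_gt0.
apply: (@continuous_comp _ _ _ P sq2); [exact: (profile_P_cont pU)|exact: continuous_sq2].
Qed.

Let pointwise (f df : nat -> R -> R) (l : nat -> R) (l0 : R) x :
  (forall n, AC (f n) (df n)) ->
  (forall n t, f n t ^+ 2 <= Qn n) ->
  (forall n, L2 (resid k c r (Qn n) (a n) (b n) (f n) (df n))) ->
  (forall n, \int[mu]_t (resid k c r (Qn n) (a n) (b n) (f n) (df n) t ^+ 2) <= D n) ->
  (forall n, f n 0 = l n) -> l n @[n --> \oo] --> l0 ->
  f n x @[n --> \oo] --> l0 * V 0 * U x.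
Proof.
move=> ACf fQ lR RD f0 ll0.
pose res n := resid k c r (Qn n) (a n) (b n) (f n) (df n).
have U0 t : 0 < U t by exact: (profile_gt0 pU).
have V0 t : 0 < V t by rewrite invr_gt0.
have [Vm Vm0 VmP] : exists2 Vm, 0 < Vm & forall t, - `|x| <= t -> t <= `|x| -> V t <= Vm.
  have xx : - `|x| <= `|x| by have := normr_ge0 x; lra.
  have [y _ Hy] := EVT_max xx (continuous_subspaceT cV).
  exists (V y) => // t t1 t2; apply: Hy; rewrite in_itv/= t1 t2//.
pose K := Num.sqrt M * Vm ^+ 3.
have K0 : 0 <= K by rewrite mulr_ge0 ?sqrtr_ge0// exprn_ge0// ltW.
pose G n t := K * (w n t * P t) + Vm ^+ 2 * `|res n t * U t|.
have G_ge0 n t : 0 <= G n t.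
  by apply: addr_ge0; apply: mulr_ge0 => //; rewrite ?sqr_ge0// mulr_ge0 ?w_ge0// ltW.
have resU n : L1 (fun t => `|res n t * U t|) by apply: L1_norm; apply: L2_M => //; exact: lR.
have LG n : L1 (G n) by apply: L1D; apply: L1Z => //; exact: wP_L1.
have IG : \int[mu]_t G n t @[n --> \oo] --> (0 : R).
  have -> : (fun n => \int[mu]_t G n t) = (fun n =>
     K * \int[mu]_t (w n t * P t) + Vm ^+ 2 * \int[mu]_t `|res n t * U t|).
    apply/funext => n; rewrite RintD; [|by apply: L1Z; exact: wP_L1|exact: L1Z].
    by rewrite !RintZ//; exact: wP_L1.
  by apply: cvg0D; apply: cvg0Z; [exact: I2|exact: I3].
have ACfV n := AC_M (ACf n) ACV.
pose dfV n t := df n t * V t + f n t * (beta t * V t).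
have dfV_le n t : - `|x| <= t -> t <= `|x| -> `|dfV n t| <= G n t.
  move=> t1 t2; have Vt := VmP t t1 t2; have v0 := V0 t.
  have E : dfV n t = res n t * U t * V t ^+ 2 +
      (sgx t * (rate k c r Q (P t) - rate k c r (Qn n) (q n t))) * f n t * P t * V t ^+ 3.
    rewrite /dfV betaE /res /resid /V.
    move: (rate _ _ _ _ _) (rate _ _ _ _ _) (sgx t) => ? ? ?.
    by field; rewrite gt_eqF.
  rewrite E; apply: le_trans (ler_normD _ _) _; rewrite addrC; apply: lerD.
    rewrite normrM normrM normrM normrM sgx_norm mul1r -/(w n t).
    rewrite (gtr0_norm (P_gt0 t)) (gtr0_norm (exprn_gt0 3 v0)).
    have fM : `|f n t| <= Num.sqrt M.
      rewrite -sqrtr_sqr ler_sqrt ?(le_trans (fQ n t) (QnM n))//.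
      exact: le_trans (ltW Q0) QM.
    have V3 : V t ^+ 3 <= Vm ^+ 3 by rewrite lerXn2r ?nnegrE// ltW.
    rewrite [leLHS](_ : _ = `|f n t| * V t ^+ 3 * (w n t * P t)); last by ring.
    apply: ler_wpM2r; first by rewrite mulr_ge0 ?w_ge0// ltW.
    by apply: ler_pM => //; rewrite exprn_ge0// ltW.
  rewrite normrM (gtr0_norm (exprn_gt0 2 v0)) mulrC ler_wpM2r//.
  by rewrite lerXn2r ?nnegrE// ltW.
have ldfV n := AC_L1loc (ACfV n).
have bound n : `|f n x * V x - f n 0 * V 0| <= \int[mu]_t G n t.
  have [x0|/ltW x0] := leP 0 x.
    rewrite -(AC_int (ACfV n) x0).
    apply: le_trans (le_normr_Rintegral _ (ldfV n _ _)) _ => //.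
    apply: le_trans (Rint_le_T 0 x (LG n) (G_ge0 n)).
    apply: le_Rint_itv; [exact: L1loc_norm|exact: L1_loc|].
    move=> t t0 tx; apply: dfV_le; rewrite (ger0_norm x0)//.
    by apply: le_trans t0; rewrite oppr_le0.
  rewrite distrC -(AC_int (ACfV n) x0).
  apply: le_trans (le_normr_Rintegral _ (ldfV n _ _)) _ => //.
  apply: le_trans (Rint_le_T x 0 (LG n) (G_ge0 n)).
  apply: le_Rint_itv; [exact: L1loc_norm|exact: L1_loc|].
  move=> t xt t0; apply: dfV_le; rewrite (ler0_norm x0) ?opprK//.
  by apply: (le_trans t0); rewrite oppr_ge0.
have L : f n x * V x - f n 0 * V 0 @[n --> \oo] --> (0 : R) by exact: cvg0_le bound IG.
have -> : (fun n => f n x) = (fun n => ((f n x * V x - f n 0 * V 0) + l n * V 0) * U x).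
  by apply/funext => n; rewrite f0 subrK /V mulfVK// gt_eqF.
apply: cvgMl; rewrite -[X in _ --> X]add0r; apply: cvgD => //; exact: cvgMl.
Qed.

Let DR_a n : \int[mu]_t (ra n t ^+ 2) <= D n.
Proof.
have [_ h] := l2a n; apply: le_RintT => // t; rewrite lerDl; exact: sqr_ge0.
Qed.

Let DR_b n : \int[mu]_t (rb n t ^+ 2) <= D n.
Proof.
have [_ h] := l2b n; apply: le_RintT => // t; rewrite lerDr; exact: sqr_ge0.
Qed.

Let a_cvg x : a n x @[n --> \oo] --> U x.
Proof.
have U0 : Num.sqrt Q * V 0 = 1.
  by rewrite /V (profile_U0 pU) mulfV// gt_eqF// sqrtr_gt0.
rewrite -[X in _ --> X]mul1r -U0; apply: (@pointwise a da (fun n => Num.sqrt (Qn n))) => //.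
- by move=> n; exact: pair_ACa (hp n).
- by move=> n t; apply: le_trans (qle n t); rewrite lerDl sqr_ge0.
- by apply: (@continuous_cvg _ _ _ _ _ _ (@Num.sqrt R)) => //; exact: sqrt_continuous.
Qed.

Let b_cvg x : b n x @[n --> \oo] --> (0 : R).
Proof.
rewrite -[X in _ --> X](_ : 0 * V 0 * U x = 0); last by rewrite !mul0r.
apply: (@pointwise b db (fun=> 0)) => //.
- by move=> n; exact: pair_ACb (hp n).
- by move=> n t; apply: le_trans (qle n t); rewrite lerDr sqr_ge0.
- exact: cvg_cst.
Qed.

(* Here |u - U|^2 <= 2 q + 2 P <= 2 |q - P| + 4 P gives the domination. *)
Let fn n x := (a n x - U x) ^+ 2 + b n x ^+ 2.

Let aU_L2 n : L2 (fun x => a n x - U x).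
Proof.
have := L2_lin 1 (-1) (pair_a (hp n)) U_L2.
by under eq_fun do rewrite mul1r mulN1r.
Qed.

Let fn_L1 n : L1 (fn n).
Proof. by have [_ h1] := aU_L2 n; have [_ h2] := pair_b (hp n); exact: L1D. Qed.

Let I4 : \int[mu]_x fn n x @[n --> \oo] --> (0 : R).
Proof.
have fn0 n x : 0 <= fn n x by rewrite addr_ge0 ?sqr_ge0.
have Lqp n : L1 (fun x => `|q n x - P x|) by apply: L1_norm; exact: L1B.
apply: (@cvg_Rint0 _ fn (fun n x => 2 * `|q n x - P x|) (fun x => 4 * P x)) => //.
- by move=> n; exact: L1Z.
- exact: L1Z.
- by move=> x; rewrite mulr_ge0// ltW.
- move=> n x; have := ler_norm (q n x - P x); rewrite /fn /sqn.
  by have := sqr_ge0 (a n x + U x); have := sqr_ge0 (b n x); lra.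
- move=> x; apply: (@cvg0_le _ _ (fun n => fn n x)).
    move=> n; rewrite ger0_norm; last by rewrite le_max lexx orbT.
    by rewrite ge_max fn0 andbT gerBl mulr_ge0.
  apply: cvg0D.
    have h : a n x - U x @[n --> \oo] --> (0 : R) by exact: (cvg_sub0 (@a_cvg x)).
    by rewrite -(mulr0 0); under eq_fun do rewrite expr2; exact: cvgM.
  by rewrite -(mulr0 0); under eq_fun do rewrite expr2; apply: cvgM; exact: b_cvg.
have -> : (fun n => \int[mu]_x (2 * `|q n x - P x|)) = (fun n => 2 * \int[mu]_x `|q n x - P x|).
  by apply/funext => n; rewrite RintZ.
exact: cvg0Z I1.
Qed.

Local Notation dU := (profile_slope k c U rho).

(** If the peaks and the masses converge to those of the profile and the
    residuals tend to 0, the functions converge in H^1.  For the derivatives,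
    u' - U' = R + sgx (rate_Q(P) - rate_Qn(q)) U + sgx rate_Qn(q) (U - u). *)
Theorem compactness : \int[mu]_x ((da n x - dU x) ^+ 2 + db n x ^+ 2
    + ((a n x - U x) ^+ 2 + b n x ^+ 2))
   @[n --> \oo] --> (0 : R).
Proof.
have fn0 n x : 0 <= fn n x by rewrite addr_ge0 ?sqr_ge0.
have [_ ldU2] := profile_L2_dU k0 c0 r1 Q0 pU.
have l2d n : L2 (fun x => da n x - dU x).
  have := L2_lin 1 (-1) (pair_da (hp n)) (profile_L2_dU k0 c0 r1 Q0 pU).
  by under eq_fun do rewrite mul1r mulN1r.
have lI n : L1 (fun x => (da n x - dU x) ^+ 2 + db n x ^+ 2 + fn n x).
  by have [_ h1] := l2d n; have [_ h2] := pair_db (hp n); apply: L1D => //; exact: L1D.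
pose G n := 3 * D n + (3 * Kc * \int[mu]_x (w n x * P x) +
  (3 * Kc ^+ 2 + 1) * \int[mu]_x fn n x).
have G0 : G n @[n --> \oo] --> (0 : R).
  apply: cvg0D; first exact: cvg0Z.
  by apply: cvg0D; apply: cvg0Z; [exact: I2|exact: I4].
apply: (cvg0_le _ G0) => n.
rewrite ger0_norm; last by apply: Rintegral_ge0 => x _; rewrite !addr_ge0 ?sqr_ge0.
rewrite /G -!RintZ// -RintD; [|exact: L1Z|exact: L1Z].
rewrite -RintD; [|exact: L1Z|by apply: L1D; exact: L1Z].
apply: le_RintT => //; first by apply: L1D; [exact: L1Z|apply: L1D; exact: L1Z].
move=> x.
have h1 := w_ge0 n x; have h2 := w_le n x.
have h3 := rate_ge0 r k0 c0 (Qn n) (q n x); have h4 := rate_Kc (q n x) (Qn0 n) (QnM n).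
have E1 : da n x - dU x = ra n x + sgx x * (rate k c r Q (P x) - rate k c r (Qn n) (q n x)) * U x
   + sgx x * rate k c r (Qn n) (q n x) * (U x - a n x).
  rewrite /profile_slope -/(beta x) betaE /resid.
  by move: (rate _ _ _ _ _) (rate _ _ _ _ _) => ? ?; ring.
have E2 : db n x = rb n x - sgx x * rate k c r (Qn n) (q n x) * b n x.
  by rewrite /resid; ring.
have w2 : w n x ^+ 2 = (rate k c r Q (P x) - rate k c r (Qn n) (q n x)) ^+ 2.
  by rewrite /w real_normK// num_real.
have wK : w n x ^+ 2 * P x <= Kc * (w n x * P x).
  rewrite expr2 [leRHS]mulrA; apply: ler_wpM2r; first exact: ltW (P_gt0 x).
  exact: ler_wpM2r.
have g2 := sgx_sqr x.
move: h3 h4 w2 E1 E2 wK; rewrite /fn; set wn := w n x.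
set rQ := rate k c r Q (U x ^+ 2); set rn := rate k c r (Qn n) (q n x); set g := sgx x => h3 h4 w2 E1 E2 wK.
have r2K : rn ^+ 2 <= Kc ^+ 2 by rewrite ler_sqr ?nnegrE.
have k1 : (da n x - dU x) ^+ 2 <= 3 * (ra n x ^+ 2 + wn ^+ 2 * P x + rn ^+ 2 * (a n x - U x) ^+ 2).
  rewrite E1 w2; set y := g * (rQ - rn) * U x; set z := g * rn * (U x - a n x).
  have -> : (rQ - rn) ^+ 2 * P x = y ^+ 2 by rewrite /y !exprMn g2; ring.
  have -> : rn ^+ 2 * (a n x - U x) ^+ 2 = z ^+ 2 by rewrite /z !exprMn g2; ring.
  have := sqr_ge0 (ra n x - y); have := sqr_ge0 (ra n x - z); have := sqr_ge0 (y - z).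
  move: (ra n x) y z => X Y Z; lra.
have k2 : db n x ^+ 2 <= 3 * (rb n x ^+ 2 + rn ^+ 2 * b n x ^+ 2).
  rewrite E2; set z := g * rn * b n x.
  have -> : rn ^+ 2 * b n x ^+ 2 = z ^+ 2 by rewrite /z !exprMn g2; ring.
  have := sqr_ge0 (rb n x + z); have := sqr_ge0 (rb n x); have := sqr_ge0 z.
  move: (rb n x) z => X Z; lra.
have k3 : rn ^+ 2 * (a n x - U x) ^+ 2 <= Kc ^+ 2 * (a n x - U x) ^+ 2.
  by rewrite ler_wpM2r ?sqr_ge0.
have k4 : rn ^+ 2 * b n x ^+ 2 <= Kc ^+ 2 * b n x ^+ 2 by rewrite ler_wpM2r ?sqr_ge0.
move: k1 k2 k3 k4 wK; move: ((da n x - _) ^+ 2) (db n x ^+ 2) (ra n x ^+ 2) (rb n x ^+ 2).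
move: ((a n x - _) ^+ 2) (b n x ^+ 2) (rn ^+ 2) (wn ^+ 2) (wn * P x) => *; lra.
Qed.

End Compactness.

(** * Continuity of mass and energy *)

Section Perturbation.
Context {R : realType}.
Local Notation mu := (@lebesgue_measure R).
Context (k c r : R).
Hypotheses (k0 : 0 < k) (c0 : 0 < c) (r1 : 1 <= r).
Implicit Types (a b da db : R -> R) (x t : R).

Definition h1dens a b da db x : R := da x ^+ 2 + db x ^+ 2 + (a x ^+ 2 + b x ^+ 2).

Definition h1sq a b da db : R := \int[mu]_x h1dens a b da db x.

Lemma h1dens_ge0 a b da db x : 0 <= h1dens a b da db x.
Proof. by rewrite !addr_ge0 ?sqr_ge0. Qed.

Lemma h1sq_ge0 a b da db : 0 <= h1sq a b da db.
Proof. by apply: Rintegral_ge0 => x _; exact: h1dens_ge0. Qed.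

Lemma L1_h1dens a b da db : H1pair a b da db -> L1 (h1dens a b da db).
Proof. by case=> _ _ [_ ?] [_ ?] [_ ?] [_ ?]; apply: L1D; exact: L1D. Qed.

Lemma H1pairB a b da db a' b' da' db' : H1pair a b da db -> H1pair a' b' da' db' ->
  H1pair (fun x => a x - a' x) (fun x => b x - b' x)
         (fun x => da x - da' x) (fun x => db x - db' x).
Proof.
have l2B f g : L2 f -> L2 g -> L2 (fun x => f x - g x).
  move=> lf lg; have := L2_lin 1 (-1) lf lg.
  by under eq_fun do rewrite mul1r mulN1r.
move=> [? ? ? ? ? ?] [? ? ? ? ? ?]; split; by [exact: AC_B|exact: l2B].
Qed.

Lemma h1sqB_le a b da db a' b' da' db' : H1pair a b da db -> H1pair a' b' da' db' ->
  h1sq (fun x => a x - a' x) (fun x => b x - b' x)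
       (fun x => da x - da' x) (fun x => db x - db' x) <=
  2 * (h1sq a b da db + h1sq a' b' da' db').
Proof.
move=> h h'; have l := L1_h1dens h; have l' := L1_h1dens h'.
rewrite /h1sq -RintD// -RintZ; last exact: L1D.
apply: le_RintT; [exact: L1_h1dens (H1pairB h h')|by apply: L1Z; exact: L1D|].
move=> x; rewrite /h1dens.
have := sqr_ge0 (a x + a' x); have := sqr_ge0 (b x + b' x).
have := sqr_ge0 (da x + da' x); have := sqr_ge0 (db x + db' x); lra.
Qed.

(** Young's inequality for 2 x d. *)
Lemma sqr_pert (t x d : R) : 0 < t ->
  `|(x + d) ^+ 2 - x ^+ 2| <= t * x ^+ 2 + (1 + t^-1) * d ^+ 2.
Proof.
move=> t0; have -> : (x + d) ^+ 2 - x ^+ 2 = 2 * (x * d) + d ^+ 2 by ring.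
apply: le_trans (ler_normD _ _) _.
rewrite normrM (ger0_norm (@ler0n R 2)) (ger0_norm (sqr_ge0 d)).
have := young x d t0; lra.
Qed.

Section Pairs.
Variables (a b da db a' b' da' db' : R -> R) (t : R).
Hypotheses (h : H1pair a b da db) (h' : H1pair a' b' da' db') (t0 : 0 < t).
Let ea x := a' x - a x.
Let eb x := b' x - b x.
Let dea x := da' x - da x.
Let deb x := db' x - db x.
Let N := h1sq a b da db.
Let e := h1sq ea eb dea deb.
Hypothesis (e1 : e <= 1).

Let he : H1pair ea eb dea deb. Proof. exact: H1pairB. Qed.
Let N0 : 0 <= N. Proof. exact: h1sq_ge0. Qed.
Let e0 : 0 <= e. Proof. exact: h1sq_ge0. Qed.
Let n x := h1dens a b da db x.
Let m x := h1dens ea eb dea deb x.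
Let ln : L1 n. Proof. exact: L1_h1dens. Qed.
Let lm : L1 m. Proof. exact: L1_h1dens. Qed.
Let n0 x : 0 <= n x. Proof. exact: h1dens_ge0. Qed.
Let m0 x : 0 <= m x. Proof. exact: h1dens_ge0. Qed.
Let pert x := t * n x + (1 + t^-1) * m x.
Let t1 : 0 <= t^-1. Proof. by rewrite invr_ge0 ltW. Qed.

Let sqn_pert x : `|sqn a' b' x - sqn a b x| <= pert x.
Proof.
have Ea : a' x = a x + ea x by rewrite /ea; ring.
have Eb : b' x = b x + eb x by rewrite /eb; ring.
have pa := sqr_pert (a x) (ea x) t0; have pb := sqr_pert (b x) (eb x) t0.
have -> : sqn a' b' x - sqn a b x = ((a x + ea x) ^+ 2 - a x ^+ 2) + ((b x + eb x) ^+ 2 - b x ^+ 2).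
  by rewrite /sqn Ea Eb; ring.
apply: le_trans (ler_normD _ _) _.
have d1 : 0 <= t * (da x ^+ 2 + db x ^+ 2).
  by apply: mulr_ge0 (ltW t0) _; rewrite addr_ge0 ?sqr_ge0.
have d2 : 0 <= (1 + t^-1) * (dea x ^+ 2 + deb x ^+ 2).
  by apply: mulr_ge0; rewrite addr_ge0 ?sqr_ge0.
rewrite /pert /n /m /h1dens; lra.
Qed.

Let der_pert x : `|(da' x ^+ 2 + db' x ^+ 2) - (da x ^+ 2 + db x ^+ 2)| <= pert x.
Proof.
have Ea : da' x = da x + dea x by rewrite /dea; ring.
have Eb : db' x = db x + deb x by rewrite /deb; ring.
have pa := sqr_pert (da x) (dea x) t0; have pb := sqr_pert (db x) (deb x) t0.
have -> : (da' x ^+ 2 + db' x ^+ 2) - (da x ^+ 2 + db x ^+ 2) =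
  ((da x + dea x) ^+ 2 - da x ^+ 2) + ((db x + deb x) ^+ 2 - db x ^+ 2).
  by rewrite Ea Eb; ring.
apply: le_trans (ler_normD _ _) _.
have d1 : 0 <= t * (a x ^+ 2 + b x ^+ 2).
  by apply: mulr_ge0 (ltW t0) _; rewrite addr_ge0 ?sqr_ge0.
have d2 : 0 <= (1 + t^-1) * (ea x ^+ 2 + eb x ^+ 2).
  by apply: mulr_ge0; rewrite addr_ge0 ?sqr_ge0.
rewrite /pert /n /m /h1dens; lra.
Qed.

Let Sa x : sqn a b x <= 2 * N. Proof. exact: pair_sup. Qed.
Let Se x : sqn ea eb x <= 2 * e. Proof. exact: (pair_sup he). Qed.

Let Sa' x : sqn a' b' x <= 4 * (N + 1).
Proof.
have s1 := Sa x; have s2 := Se x.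
have : sqn a' b' x <= 2 * (sqn a b x + sqn ea eb x).
  rewrite /sqn /ea /eb.
  by have := sqr_ge0 (2 * a x - a' x); have := sqr_ge0 (2 * b x - b' x); lra.
by move: e1; lra.
Qed.

Let M := 4 * (N + 1).

Let pow_pert x : `|sqn a' b' x `^ (r + 1) - sqn a b x `^ (r + 1)| <=
  (r + 1) * M `^ r * pert x.
Proof.
have rr : 1 <= r + 1 by move: r1; lra.
have SM : sqn a b x <= M by apply: le_trans (Sa x) _; move: N0; rewrite /M; lra.
have := pow_lipabs rr (sqn_ge0 a b x) SM (sqn_ge0 a' b' x) (Sa' x).
rewrite addrK => /le_trans; apply; apply: ler_wpM2l (sqn_pert x).
by rewrite mulr_ge0 ?powR_ge0//; move: r1; lra.
Qed.

Let quart (f f' df df' : R) (X Y : R) : f ^+ 2 + f' ^+ 2 <= X -> df ^+ 2 + df' ^+ 2 <= Y ->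
  (f * df + f' * df') ^+ 2 <= X * Y.
Proof.
move=> fX dY.
have X0 : 0 <= X by apply: le_trans fX; rewrite addr_ge0 ?sqr_ge0.
have : (f ^+ 2 + f' ^+ 2) * (df ^+ 2 + df' ^+ 2) <= X * Y.
  by apply: ler_pM => //; rewrite addr_ge0 ?sqr_ge0.
apply: le_trans; have := sqr_ge0 (f * df' - f' * df); lra.
Qed.

Let quartic_pert x :
  `|(a' x * da' x + b' x * db' x) ^+ 2 - (a x * da x + b x * db x) ^+ 2| <=
  t * (2 * N * n x) + (1 + t^-1) * (6 * (N * m x + e * n x + e * m x)).
Proof.
pose A := a x * da x + b x * db x.
pose B1 := a x * dea x + b x * deb x.
pose B2 := ea x * da x + eb x * db x.
pose B3 := ea x * dea x + eb x * deb x.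
have E : a' x * da' x + b' x * db' x = A + (B1 + B2 + B3).
  by rewrite /A /B1 /B2 /B3 /ea /eb /dea /deb; ring.
rewrite E; apply: le_trans (sqr_pert A (B1 + B2 + B3) t0) _.
have dn : da x ^+ 2 + db x ^+ 2 <= n x by rewrite /n /h1dens lerDl addr_ge0 ?sqr_ge0.
have dm : dea x ^+ 2 + deb x ^+ 2 <= m x by rewrite /m /h1dens lerDl addr_ge0 ?sqr_ge0.
have qA := quart (Sa x) dn; have q1 := quart (Sa x) dm.
have q2 := quart (Se x) dn; have q3 := quart (Se x) dm.
have B : (B1 + B2 + B3) ^+ 2 <= 6 * (N * m x + e * n x + e * m x).
  have h3 : (B1 + B2 + B3) ^+ 2 <= 3 * (B1 ^+ 2 + B2 ^+ 2 + B3 ^+ 2).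
    have := sqr_ge0 (B1 - B2); have := sqr_ge0 (B1 - B3); have := sqr_ge0 (B2 - B3); lra.
  by apply: le_trans h3 _; move: q1 q2 q3; rewrite -/B1 -/B2 -/B3; lra.
by apply: lerD; apply: ler_wpM2l => //; [exact: ltW|rewrite addr_ge0].
Qed.

(** A constant depending on the H^1 norm of the unperturbed function only, for
    perturbations of norm at most 1; 4 (N + 1) then bounds |u|^2 for both
    functions. *)
Definition pert_bound (N : R) : R :=
  1 + N + (2^-1 + c ^+ 2 / 2 * ((r + 1) * (4 * (N + 1)) `^ r)) * (1 + N)
  + k * (2 * N ^+ 2 + 12 * N + 6).

Let pert_small : t * N + (1 + t^-1) * e <= (1 + N) * (t + (1 + t^-1) * e).
Proof.
have h1 : 0 <= (1 + t^-1) * e by rewrite mulr_ge0// addr_ge0.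
have h2 : 0 <= N * ((1 + t^-1) * e) by rewrite mulr_ge0.
by have := ltW t0; lra.
Qed.

Let Ipert : \int[mu]_x pert x = t * N + (1 + t^-1) * e.
Proof. by rewrite RintD ?RintZ//; exact: L1Z. Qed.

Let Lpert : L1 pert. Proof. by apply: L1D; exact: L1Z. Qed.

Let pert0 : 0 <= t + (1 + t^-1) * e.
Proof. by rewrite addr_ge0 ?(ltW t0)// mulr_ge0// addr_ge0. Qed.

Let Cpow0 : 0 <= c ^+ 2 / 2 * ((r + 1) * M `^ r).
Proof.
by rewrite mulr_ge0 ?divr_ge0 ?sqr_ge0// mulr_ge0 ?powR_ge0//; move: r1; lra.
Qed.

Lemma mass_pert : `|\int[mu]_x sqn a' b' x - \int[mu]_x sqn a b x| <=
  pert_bound N * (t + (1 + t^-1) * e).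
Proof.
have la := pair_L1q h; have la' := pair_L1q h'.
rewrite -RintB//; apply: le_trans (le_normr_Rintegral _ (L1B la' la)) _ => //.
apply: (@le_trans _ _ (\int[mu]_x pert x)).
  by apply: le_RintT => //; apply: L1_norm; exact: L1B.
rewrite Ipert; apply: le_trans pert_small _; rewrite ler_wpM2r// /pert_bound -/M.
rewrite -addrA lerDl addr_ge0//.
  by apply: mulr_ge0; [rewrite addr_ge0|rewrite addr_ge0].
by rewrite mulr_ge0 ?(ltW k0)// !addr_ge0// mulr_ge0// sqr_ge0.
Qed.

(** The quadratic terms are perturbed by sqr_pert, the power by its Lipschitz
    bound, and a a' + b b' is a bilinear expression whose increments are
    estimated by the supremum bound pair_sup. *)
Lemma energy_pert : `|\int[mu]_x dens k c r a' b' da' db' x - \int[mu]_x dens k c r a b da db x| <=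
  pert_bound N * (t + (1 + t^-1) * e).
Proof.
have la := L1_dens k c r1 h; have la' := L1_dens k c r1 h'.
rewrite -RintB//; apply: le_trans (le_normr_Rintegral _ (L1B la' la)) _ => //.
pose C := 2^-1 + c ^+ 2 / 2 * ((r + 1) * M `^ r).
pose G x := C * pert x + k * ((t * (2 * N) + (1 + t^-1) * (6 * e)) * n x +
  (1 + t^-1) * (6 * (N + e)) * m x).
have LG : L1 G by apply: L1D; apply: L1Z => //; apply: L1D; exact: L1Z.
apply: (@le_trans _ _ (\int[mu]_x G x)).
  apply: le_RintT => //; first by apply: L1_norm; exact: L1B.
  move=> x; rewrite /dens.
  have p1 := der_pert x; have p2 := quartic_pert x; have p3 := pow_pert x.
  have p2' := ler_wpM2l (ltW k0) p2.
  have c2 : 0 <= c ^+ 2 / 2 by rewrite divr_ge0 ?sqr_ge0.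
  have p3' := ler_wpM2l c2 p3.
  move: p1 p2' p3'.
  set X := da' x ^+ 2 + _; set X0 := da x ^+ 2 + _.
  set Y := (a' x * _ + _) ^+ 2; set Y0 := (a x * _ + _) ^+ 2.
  set Z := sqn a' b' x `^ _; set Z0 := sqn a b x `^ _.
  move=> p1 p2' p3'.
  have -> : 2^-1 * X + k * Y - c ^+ 2 / 2 * Z - (2^-1 * X0 + k * Y0 - c ^+ 2 / 2 * Z0) =
    2^-1 * (X - X0) + k * (Y - Y0) - c ^+ 2 / 2 * (Z - Z0) by ring.
  apply: le_trans (ler_normB _ _) _.
  apply: le_trans (lerD (ler_normD _ _) (lexx _)) _.
  rewrite !(normrM 2^-1) !(normrM k) (normrM (c ^+ 2 / 2)) (ger0_norm c2) (gtr0_norm k0).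
  rewrite (@gtr0_norm _ 2^-1) ?invr_gt0// /G /C mulrDl.
  by move: p1 p2' p3'; move: (pert x) (n x) (m x) `|X - X0| `|Y - Y0| `|Z - Z0| => ? ? ? ? ? ?; lra.
have IG : \int[mu]_x G x = C * (t * N + (1 + t^-1) * e) +
  k * ((t * (2 * N) + (1 + t^-1) * (6 * e)) * N + (1 + t^-1) * (6 * (N + e)) * e).
  rewrite RintD; [|exact: L1Z|by apply: L1Z; apply: L1D; exact: L1Z].
  rewrite (RintZ C Lpert) Ipert RintZ; last by apply: L1D; exact: L1Z.
  by rewrite RintD ?RintZ//; exact: L1Z.
rewrite IG.
have C0 : 0 <= C by rewrite /C addr_ge0 ?invr_ge0.
have h1 := ler_wpM2l C0 pert_small.
pose v := (1 + t^-1) * e.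
have v0 : 0 <= v by rewrite /v mulr_ge0// addr_ge0.
have h2 : (t * (2 * N) + (1 + t^-1) * (6 * e)) * N + (1 + t^-1) * (6 * (N + e)) * e <=
    (2 * N ^+ 2 + 12 * N + 6) * (t + v).
  have -> : (t * (2 * N) + (1 + t^-1) * (6 * e)) * N + (1 + t^-1) * (6 * (N + e)) * e =
    2 * N ^+ 2 * t + (12 * N + 6 * e) * v by rewrite /v; ring.
  have h3 : e * v <= v by rewrite ler_piMl.
  have h4 : 0 <= N ^+ 2 * v by rewrite mulr_ge0 ?sqr_ge0.
  have h5 : 0 <= N * t by rewrite mulr_ge0// ltW.
  have := ltW t0; lra.
have h3 := ler_wpM2l (ltW k0) h2.
apply: le_trans (lerD h1 h3) _.
rewrite -/v /pert_bound -/M -/C.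
have h4 : 0 <= (1 + N) * (t + v) by rewrite mulr_ge0 ?addr_ge0// ltW.
by lra.
Qed.

End Pairs.

End Perturbation.

(** * Symmetries, and coercivity in the peak *)

Section Centering.
Context {R : realType}.
Local Notation mu := (@lebesgue_measure R).
Context (k c r theta p : R).
Hypotheses (r1 : 1 <= r) (cE : c ^+ 2 / 2 = theta / p) (rE : r + 1 = p / 2).
Implicit Types (u w : R -> R[i]) (eta xi : R) (a b da db : R -> R).

Definition orbit u eta xi x : R[i] := cis eta * u (x + xi).

Lemma edensE a b da db : edens k theta p a b da db = dens k c r a b da db.
Proof. by apply/funext => x; rewrite /edens /dens /sqn cE rE. Qed.

Lemma energyE u a b da db : rep u a b da db ->
  energy k theta p u = \int[mu]_x dens k c r a b da db x.
Proof. by move/rep_energy => ->; rewrite edensE. Qed.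

Lemma massE u a b da db : rep u a b da db -> mass u = \int[mu]_x sqn a b x.
Proof. by move/rep_mass. Qed.

Lemma H1normE u a b da db : rep u a b da db -> H1norm u = Num.sqrt (h1sq a b da db).
Proof. by move/rep_H1norm. Qed.

Lemma rot_sqr eta (x y : R) :
  (cos eta * x + - sin eta * y) ^+ 2 + (sin eta * x + cos eta * y) ^+ 2 = x ^+ 2 + y ^+ 2.
Proof.
rewrite -[RHS]mul1r -(cos2Dsin2 eta); ring.
Qed.

Lemma rot_dot eta (x y z w : R) :
  (cos eta * x + - sin eta * y) * (cos eta * z + - sin eta * w) +
  (sin eta * x + cos eta * y) * (sin eta * z + cos eta * w) = x * z + y * w.
Proof.
rewrite -[RHS]mul1r -(cos2Dsin2 eta); ring.
Qed.

Lemma rep_orbit u a b da db eta xi : rep u a b da db ->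
  rep (orbit u eta xi)
      (fun x => cos eta * a (x + xi) + - sin eta * b (x + xi))
      (fun x => sin eta * a (x + xi) + cos eta * b (x + xi))
      (fun x => cos eta * da (x + xi) + - sin eta * db (x + xi))
      (fun x => sin eta * da (x + xi) + cos eta * db (x + xi)).
Proof. by move=> ru; exact: rep_cis (rep_shift xi ru). Qed.

Lemma orbit_invariants u eta xi : H1 u ->
  [/\ mass (orbit u eta xi) = mass u,
      energy k theta p (orbit u eta xi) = energy k theta p u &
      H1norm (orbit u eta xi) = H1norm u].
Proof.
move=> /H1_rep[a [b [da [db ru]]]]; have ro := rep_orbit eta xi ru.
have hp := rep_pair ru.
split.
- rewrite (massE ro) (massE ru) -(Rint_shift xi (pair_L1q hp)).
  by apply: eq_Rintegral => x _; rewrite /sqn rot_sqr.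
- rewrite (energyE ro) (energyE ru) -(Rint_shift xi (L1_dens k c r1 hp)).
  by apply: eq_Rintegral => x _; rewrite /dens /sqn !rot_sqr rot_dot.
- rewrite (H1normE ro) (H1normE ru) /h1sq -(Rint_shift xi (L1_h1dens hp)).
  by congr Num.sqrt; apply: eq_Rintegral => x _; rewrite /h1dens !rot_sqr.
Qed.

(** Take the arc cosine of x, with the sign of y. *)
Lemma polar (x y : R) : x ^+ 2 + y ^+ 2 = 1 -> exists eta, cos eta = x /\ sin eta = y.
Proof.
move=> xy.
have x1 : -1 <= x <= 1.
  by apply/andP; split; have := sqr_ge0 y; nra.
have cx := acosK x1.
have sx : sin (acos x) = `|y|.
  by rewrite sin_acos// -xy addrAC subrr add0r sqrtr_sqr.
have [y0|/ltW y0] := leP 0 y.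
  by exists (acos x); rewrite cx sx ger0_norm.
by exists (- acos x); rewrite cosN sinN cx sx ler0_norm// opprK.
Qed.

(** Translate a maximum of |w| to 0 and divide by the phase of w there. *)
Lemma centered w : H1 w -> 0 < mass w -> exists eta xi a b da db,
  [/\ rep (orbit w eta xi) a b da db, 0 < sqn a b 0,
      forall x, sqn a b x <= sqn a b 0, a 0 = Num.sqrt (sqn a b 0) & b 0 = 0].
Proof.
move=> /H1_rep[a [b [da [db rw]]]]; rewrite (massE rw) => m0.
have [xi q0 qmax] := pair_max (rep_pair rw) m0.
pose s := Num.sqrt (sqn a b xi).
have s0 : 0 < s by rewrite sqrtr_gt0.
have s2 : s ^+ 2 = a xi ^+ 2 + b xi ^+ 2 by rewrite sqr_sqrtr// ltW.
have [|eta [ce se]] := @polar (a xi / s) (- (b xi / s)).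
  have -> : (a xi / s) ^+ 2 + (- (b xi / s)) ^+ 2 = (a xi ^+ 2 + b xi ^+ 2) / s ^+ 2.
    by field; rewrite gt_eqF.
  by rewrite -s2 mulfV// gt_eqF// exprn_gt0.
have re := rep_orbit eta xi rw.
exists eta, xi; do 4 eexists; split; first exact: re.
- by rewrite /sqn rot_sqr add0r.
- by move=> x; rewrite /sqn !rot_sqr add0r; exact: qmax.
- rewrite /sqn rot_sqr add0r -/(sqn a b xi) -/s ce se.
  have -> : a xi / s * a xi + - - (b xi / s) * b xi = (a xi ^+ 2 + b xi ^+ 2) / s.
    by field; rewrite gt_eqF.
  by rewrite -s2; field; rewrite gt_eqF.
- by rewrite /= add0r ce se; field; rewrite gt_eqF.
Qed.

End Centering.

Section Coercivity.
Context {R : realType}.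
Context (k c r : R).
Hypotheses (k0 : 0 < k) (c0 : 0 < c) (r1 : 1 <= r) (r2 : r < 2).
Variables (Q lambda : R).
Hypotheses (Q0 : 0 < Q) (QL : Lmass k c r Q = lambda).
Local Notation J := (Jact k c r).

Lemma peak_lower (y : R) : 0 < y ->
  J Q - c ^+ 2 * lambda * Q `^ r <= J y - c ^+ 2 * lambda * y `^ r.
Proof. by move=> y0; have := Jact_tangent k0 c0 r1 r2 Q0 y0; rewrite QL; lra. Qed.

(** J - c^2 lambda y^r has its strict minimum at y = Q and, as a convex function
    of y^r, grows linearly away from it: the tangents at x2 beyond Q and at z2
    before Q have slopes kx and - kz.  This beats the error delta (1 + y^r) as
    soon as y is beyond x3, resp. before z1. *)
Lemma peak_coercive (eps : R) : 0 < eps -> exists2 delta : R, 0 < delta &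
  forall y : R, 0 < y ->
    J y - c ^+ 2 * lambda * y `^ r <=
      J Q - c ^+ 2 * lambda * Q `^ r + delta * (1 + y `^ r) ->
    `|y - Q| < eps.
Proof.
move=> eps0.
have c2 : 0 < c ^+ 2 by rewrite exprn_gt0.
pose e := Num.min eps (Q / 2).
have e0 : 0 < e by rewrite lt_min eps0 divr_gt0.
have eeps : e <= eps by rewrite ge_min lexx.
have eQ : e <= Q / 2 by rewrite ge_min lexx orbT.
pose x2 := Q + e / 2; pose x3 := Q + e; pose z2 := Q - e / 2; pose z1 := Q - e.
have z10 : 0 < z1 by rewrite /z1; lra.
have z12 : z1 < z2 by rewrite /z1 /z2; lra.
have z2Q : z2 < Q by rewrite /z2; lra.
have Qx2 : Q < x2 by rewrite /x2; lra.
have x23 : x2 < x3 by rewrite /x2 /x3; lra.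
have z20 := lt_trans z10 z12; have x20 := lt_trans Q0 Qx2; have x30 := lt_trans x20 x23.
have L1 := Lmass_mono k0 c0 r1 r2 z20 z2Q; have L2 := Lmass_mono k0 c0 r1 r2 Q0 Qx2.
rewrite QL in L1 L2.
pose kz := c ^+ 2 * (lambda - Lmass k c r z2).
pose kx := c ^+ 2 * (Lmass k c r x2 - lambda).
have kz0 : 0 < kz by rewrite mulr_gt0// subr_gt0.
have kx0 : 0 < kx by rewrite mulr_gt0// subr_gt0.
have pz := pow_lt r1 (ltW z10) z12; have px := pow_lt r1 (ltW x20) x23.
have pq := pow_lt r1 (ltW z10) (lt_trans z12 z2Q).
pose dz := kz * (z2 `^ r - z1 `^ r) / (1 + z1 `^ r).
pose dx := kx * (x3 `^ r - x2 `^ r) / (1 + x3 `^ r).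
have p1 : 0 < 1 + z1 `^ r by rewrite ltr_wpDr ?powR_ge0.
have p3 : 0 < 1 + x3 `^ r by rewrite ltr_wpDr ?powR_ge0.
have dz0 : 0 < dz by rewrite divr_gt0// mulr_gt0// subr_gt0.
have dx0 : 0 < dx by rewrite divr_gt0// mulr_gt0// subr_gt0.
pose d := Num.min dz (Num.min dx kx) / 2.
have d0 : 0 < d by rewrite divr_gt0// !lt_min dz0 dx0.
have ddz : 2 * d <= dz by rewrite /d mulrC divfK// ge_min lexx.
have ddx : 2 * d <= dx by rewrite /d mulrC divfK// !ge_min lexx orbT.
have dkx : 2 * d <= kx by rewrite /d mulrC divfK// !ge_min lexx !orbT.
exists d => // y y0 H.
have Tz := Jact_tangent k0 c0 r1 r2 z20 y0; have Tx := Jact_tangent k0 c0 r1 r2 x20 y0.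
have Lz := peak_lower z20; have Lx := peak_lower x20.
apply: (@lt_le_trans _ _ e) => //.
rewrite ltr_norml; apply/andP; split; rewrite ltNge; apply/negP => hy.
- have yz1 : y <= z1 by rewrite /z1 addrC -lerBlDr.
  have py := pow_mono r1 (ltW y0) yz1.
  have h1 : kz * (z2 `^ r - y `^ r) <= d * (1 + y `^ r) by rewrite /kz; move: Tz Lz H; lra.
  have h2 : kz * (z2 `^ r - z1 `^ r) <= kz * (z2 `^ r - y `^ r).
    by rewrite ler_wpM2l ?(ltW kz0)// lerD2l lerN2.
  have h3 : d * (1 + y `^ r) <= d * (1 + z1 `^ r) by rewrite ler_wpM2l ?(ltW d0)// lerD2l.
  have h4 : dz * (1 + z1 `^ r) = kz * (z2 `^ r - z1 `^ r) by rewrite /dz divfK// gt_eqF.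
  have h5 := ler_wpM2r (ltW p1) ddz.
  have h6 : 0 < d * (1 + z1 `^ r) by rewrite mulr_gt0.
  by move: h1 h2 h3 h4 h5 h6; lra.
- have yx3 : x3 <= y by rewrite /x3 addrC -lerBrDr.
  have py := pow_mono r1 (ltW x30) yx3.
  have h1 : kx * (y `^ r - x2 `^ r) <= d * (1 + y `^ r) by rewrite /kx; move: Tx Lx H; lra.
  have h4 : dx * (1 + x3 `^ r) = kx * (x3 `^ r - x2 `^ r) by rewrite /dx divfK// gt_eqF.
  have h5 := ler_wpM2r (ltW p3) ddx.
  have h6 : 0 < d * (1 + x3 `^ r) by rewrite mulr_gt0.
  have h7 : (kx - d) * (y `^ r - x3 `^ r) >= 0.
    by rewrite mulr_ge0 ?subr_ge0//; lra.
  by move: h1 h4 h5 h6 h7; lra.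
Qed.

End Coercivity.

(** * Orbital stability *)

Section Smallness.
Context {R : realType}.

Lemma pert_choice (C d : R) : 0 < C -> 0 < d -> exists2 delta : R, 0 < delta &
  exists2 t : R, 0 < t & forall x, 0 <= x -> x < delta ->
    x ^+ 2 <= 1 /\ C * (t + (1 + t^-1) * x ^+ 2) < d.
Proof.
move=> C0 d0; pose t := d / (4 * C).
have t0 : 0 < t by rewrite divr_gt0// mulr_gt0.
have t1 : 0 < 1 + t^-1 by rewrite addr_gt0// invr_gt0.
exists (Num.min 1 (t / (1 + t^-1))); first by rewrite lt_min ltr01 divr_gt0.
exists t => // x x0; rewrite lt_min => /andP[x1 xt].
have xx : x ^+ 2 <= x by rewrite expr2 ler_piMl// ltW.
split; first exact: le_trans xx (ltW x1).
have h1 : (1 + t^-1) * x ^+ 2 <= t.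
  apply: (@le_trans _ _ ((1 + t^-1) * x)); first by rewrite ler_wpM2l// ltW.
  by rewrite mulrC -ler_pdivlMr// ltW.
have h2 : C * (t + (1 + t^-1) * x ^+ 2) <= C * (2 * t).
  by rewrite ler_wpM2l ?(ltW C0)//; lra.
apply: le_lt_trans h2 _.
have -> : C * (2 * t) = d / 2 by rewrite /t; field; rewrite gt_eqF.
lra.
Qed.

End Smallness.

Section Stability.
Local Open Scope complex_scope.
Context {R : realType}.
Local Notation mu := (@lebesgue_measure R).
Context (k c r theta p lambda : R).
Hypotheses (k0 : 0 < k) (c0 : 0 < c) (r1 : 1 <= r) (r2 : r < 2) (lambda0 : 0 < lambda).
Hypotheses (cE : c ^+ 2 / 2 = theta / p) (rE : r + 1 = p / 2).
Implicit Types (u w : R -> R[i]) (eta xi : R) (a b da db : R -> R).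
Variables (Q : R) (U rho : R -> R).
Hypotheses (Q0 : 0 < Q) (QL : Lmass k c r Q = lambda) (pU : profile k c r Q U rho).
Local Notation dU := (profile_slope k c U rho).
Local Notation zero := (fun _ : R => 0 : R).

Lemma profile_rep : rep (fun x => (U x)%:C) U zero dU zero.
Proof.
have l0 : L2 zero.
  split; first exact: measurable_cst.
  by rewrite /L1 expr0n/=; exact: integrable0.
have lU := profile_L2 k0 c0 r1 Q0 pU; have ldU := profile_L2_dU k0 c0 r1 Q0 pU.
split => //.
- exact: aeW.
- exact: aeW.
- by case: lU.
- exact: (profile_AC k0 pU).
- exact: AC_cst.
Qed.

Let hU : H1pair U zero dU zero. Proof. exact: rep_pair profile_rep. Qed.

Let sqnU x : sqn U zero x = U x ^+ 2. Proof. by rewrite /sqn expr0n/= addr0. Qed.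

Let massU : \int[mu]_x (U x ^+ 2) = 2 * lambda.
Proof. by rewrite -QL -(profile_mass k0 c0 r1 Q0 pU). Qed.

(** The energy of the profile. *)
Definition ground : R := Jact k c r Q - c ^+ 2 * lambda * Q `^ r.

(** The residual of U vanishes, so bogomolny holds without defect. *)
Lemma profile_mass_energy :
  mass (fun x => (U x)%:C) = 2 * lambda /\ energy k theta p (fun x => (U x)%:C) = ground.
Proof.
have rU := profile_rep.
have mE : \int[mu]_x sqn U zero x = 2 * lambda.
  by rewrite -massU; apply: eq_Rintegral => x _; exact: sqnU.
split; first by rewrite (massE rU).
rewrite (energyE k cE rE rU).
have qle x : sqn U zero x <= Q by rewrite sqnU; exact: (profile_PQ r1 Q0 pU).
have q0 : sqn U zero 0 = Q by rewrite sqnU; exact: (profile_P0 Q0 pU).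
have := bogomolny k0 c0 r1 hU Q0 qle q0; rewrite mE.
have -> : \int[mu]_x defect k c r Q U zero dU zero x = 0.
  rewrite -[RHS](mul0r (\int[mu]_x defect k c r Q U zero dU zero x)).
  rewrite -RintZ; last exact: (L1_defect k0 c0 r1 Q hU).
  apply: eq_Rintegral => x _; rewrite mul0r /defect.
  rewrite (profile_resid k0 c0 r1 pU) /resid mulr0 addr0; ring.
by rewrite /ground; lra.
Qed.

(** Otherwise there are pairs with mass and energy tending to those of the
    profile that stay away from it.  By the energy identity and peak_coercive
    their peaks tend to Q, then by the same identity and the tangent at Q their
    residuals tend to 0, which contradicts compactness. *)
Lemma close_to_profile (e : R) : 0 < e -> exists2 delta : R, 0 < delta &
  forall a b da db, H1pair a b da db -> 0 < sqn a b 0 ->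
    (forall x, sqn a b x <= sqn a b 0) -> a 0 = Num.sqrt (sqn a b 0) -> b 0 = 0 ->
    `|\int[mu]_x sqn a b x - 2 * lambda| < delta ->
    \int[mu]_x dens k c r a b da db x < ground + delta ->
    h1sq (fun x => a x - U x) (fun x => b x - 0) (fun x => da x - dU x)
      (fun x => db x - 0) < e.
Proof.
move=> e0; apply: contrapT => H.
pose dl (n : nat) : R := n.+1%:R^-1.
have dl0 n : 0 < dl n by rewrite invr_gt0.
have dlc : dl n @[n --> \oo] --> (0 : R) by exact: cvg_harmonic.
have bad (n : nat) : exists t : ((R -> R) * (R -> R)) * ((R -> R) * (R -> R)),
   [/\ H1pair t.1.1 t.1.2 t.2.1 t.2.2, 0 < sqn t.1.1 t.1.2 0,
     forall x, sqn t.1.1 t.1.2 x <= sqn t.1.1 t.1.2 0,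
     t.1.1 0 = Num.sqrt (sqn t.1.1 t.1.2 0) & t.1.2 0 = 0] /\
   [/\ `|\int[mu]_x sqn t.1.1 t.1.2 x - 2 * lambda| < dl n,
     \int[mu]_x dens k c r t.1.1 t.1.2 t.2.1 t.2.2 x < ground + dl n &
     e <= h1sq (fun x => t.1.1 x - U x) (fun x => t.1.2 x - 0) (fun x => t.2.1 x - dU x)
      (fun x => t.2.2 x - 0)].
  apply: contrapT => nt; apply: H; exists (dl n) => // a b da db h1 h2 h3 h4 h5 h6 h7.
  by rewrite ltNge; apply/negP => he; apply: nt; exists ((a, b), (da, db)).
have [t Ht] := choice bad.
pose a n := (t n).1.1; pose b n := (t n).1.2.
pose da n := (t n).2.1; pose db n := (t n).2.2.
pose Qn n := sqn (a n) (b n) 0.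
have hp n : H1pair (a n) (b n) (da n) (db n) by case: (Ht n) => -[].
have Qn0 n : 0 < Qn n by case: (Ht n) => -[].
have qle n x : sqn (a n) (b n) x <= Qn n by case: (Ht n) => -[].
have a0 n : a n 0 = Num.sqrt (Qn n) by case: (Ht n) => -[].
have b0 n : b n 0 = 0 by case: (Ht n) => -[].
have mn n : `|\int[mu]_x sqn (a n) (b n) x - 2 * lambda| < dl n by case: (Ht n) => _ [].
have En n : \int[mu]_x dens k c r (a n) (b n) (da n) (db n) x < ground + dl n
  by case: (Ht n) => _ [].
have far n : e <= h1sq (fun x => a n x - U x) (fun x => b n x - 0)
   (fun x => da n x - dU x) (fun x => db n x - 0) by case: (Ht n) => _ [].
pose Dn n := \int[mu]_x (resid k c r (Qn n) (a n) (b n) (a n) (da n) x ^+ 2 +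
                         resid k c r (Qn n) (a n) (b n) (b n) (db n) x ^+ 2).
have Dn0 n : 0 <= Dn n by apply: Rintegral_ge0 => x _; rewrite addr_ge0 ?sqr_ge0.
(* The energy identity with mass and energy replaced by their limits. *)
have key n : 2^-1 * Dn n + Jact k c r (Qn n) - c ^+ 2 * lambda * Qn n `^ r <=
    ground + dl n * (1 + c ^+ 2 / 2 * Qn n `^ r).
  have h1 := bogomolny k0 c0 r1 (hp n) (Qn0 n) (qle n) erefl.
  have h2 := le_defect k0 c0 r1 (Qn n) (hp n).
  have [_ h3] := ltr_normlP _ _ (mn n).
  have h4 : 0 <= c ^+ 2 / 2 * Qn n `^ r by rewrite mulr_ge0 ?powR_ge0// divr_ge0 ?sqr_ge0.
  have h5 := ler_wpM2l h4 (ltW h3).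
  have h6 := En n.
  move: h1 h2 h5 h6; rewrite -/(Dn n) -/(Qn n).
  set X := \int[mu]_x sqn _ _ x; set Y := \int[mu]_x dens _ _ _ _ _ _ _ x.
  by move: (\int[mu]_x defect _ _ _ _ _ _ _ _ x) => Z; lra.
have QnQ : Qn n @[n --> \oo] --> Q.
  apply/cvgrPdist_lt => e' e'0.
  have [d d0 Hd] := peak_coercive k0 c0 r1 r2 Q0 QL e'0.
  have c21 : 0 < 1 + c ^+ 2 / 2 by rewrite ltr_wpDr// divr_ge0 ?sqr_ge0.
  have d'0 : 0 < d / (1 + c ^+ 2 / 2) by rewrite divr_gt0.
  move/cvgrPdist_lt : dlc => /(_ _ d'0); apply: filterS => n.
  rewrite sub0r normrN (gtr0_norm (dl0 n)) ltr_pdivlMr// => dn.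
  rewrite distrC; apply: Hd => //; rewrite -/ground.
  have h1 := key n; have h2 := Dn0 n; have h3 := powR_ge0 (Qn n) r.
  have h4 : 0 <= c ^+ 2 / 2 by rewrite divr_ge0 ?sqr_ge0.
  have h5 : dl n * (1 + c ^+ 2 / 2 * Qn n `^ r) <= dl n * (1 + c ^+ 2 / 2) * (1 + Qn n `^ r).
    rewrite -[leRHS]mulrA ler_wpM2l ?(ltW (dl0 n))//.
    have := h3; have := h4; have : 0 <= c ^+ 2 / 2 * Qn n `^ r by rewrite mulr_ge0.
    by move: (Qn n `^ r) (c ^+ 2 / 2) => ? ?; lra.
  have h6 : dl n * (1 + c ^+ 2 / 2) * (1 + Qn n `^ r) <= d * (1 + Qn n `^ r).
    by rewrite ler_wpM2r ?(ltW dn)// addr_ge0.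
  by lra.
have [M QnM] : exists M, forall n, Qn n <= M.
  have [N [_ HN]] := cvg_seq_bounded (cvgP _ QnQ).
  exists (N + 1) => n; apply: le_trans (ler_norm _) _; apply: HN => //; lra.
have r0 : 0 <= r by move: r1; lra.
have D0 : Dn n @[n --> \oo] --> (0 : R).
  apply: (@cvg0_le _ _ (fun n => 2 * (1 + c ^+ 2 / 2 * M `^ r) * dl n)); last exact: cvg0Z.
  move=> n; rewrite (ger0_norm (Dn0 n)).
  have h1 := key n.
  have h2 := peak_lower k0 c0 r1 r2 Q0 QL (Qn0 n).
  have h3 : c ^+ 2 / 2 * Qn n `^ r <= c ^+ 2 / 2 * M `^ r.
    rewrite ler_wpM2l ?divr_ge0 ?sqr_ge0//; apply: pow_mono => //; exact: ltW.
  have h4 := ler_wpM2l (ltW (dl0 n)) h3.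
  by move: h1 h2 h4; rewrite /ground; lra.
have mass_cvg : \int[mu]_x sqn (a n) (b n) x @[n --> \oo] --> \int[mu]_x (U x ^+ 2).
  rewrite massU; apply/cvgrPdist_lt => e' e'0.
  move/cvgrPdist_lt : dlc => /(_ _ e'0); apply: filterS => n.
  rewrite sub0r normrN (gtr0_norm (dl0 n)) distrC; exact: lt_trans.
have := compactness k0 c0 r1 Q0 pU hp Qn0 QnM qle (fun=> erefl) QnQ a0 b0 D0 mass_cvg.
move=> /cvgr_lt => /(_ e e0) lte.
have [n] := filter_ex lte; rewrite ltNge; apply/negP; rewrite negbK.
apply: le_trans (far n) _; rewrite le_eqVlt; apply/orP; left; apply/eqP.
by apply: eq_Rintegral => x _; rewrite /h1dens !subr0.
Qed.

(** A mass within lambda of 2 lambda is positive, so centered applies. *)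
Lemma close_orbit (e : R) : 0 < e -> exists2 delta : R, 0 < delta &
  forall w, H1 w -> `|mass w - 2 * lambda| < delta ->
    energy k theta p w < ground + delta ->
    exists eta xi a b da db, rep (orbit w eta xi) a b da db /\
      h1sq (fun x => a x - U x) (fun x => b x - 0) (fun x => da x - dU x)
        (fun x => db x - 0) < e.
Proof.
move=> e0; have [d d0 Hd] := close_to_profile e0.
exists (Num.min d lambda); first by rewrite lt_min d0.
move=> w Hw; rewrite lt_min => /andP[m1 m2] Ew.
have w0 : 0 < mass w by move: m2; rewrite ltr_norml => /andP[+ _]; move: lambda0; lra.
have [eta [xi [a [b [da [db [rw q0 qle a0 b0]]]]]]] := centered Hw w0.
exists eta, xi, a, b, da, db; split => //.
have [mE EE _] := orbit_invariants k r1 cE rE eta xi Hw.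
apply: (Hd a b da db (rep_pair rw) q0 qle a0 b0).
- by rewrite -(massE rw) mE.
- rewrite -(energyE k cE rE rw) EE; apply: lt_le_trans Ew _.
  by rewrite lerD2l ge_min lexx.
Qed.

Lemma cisD (x y : R) : cis x * cis y = cis (x + y).
Proof. by rewrite /cis cosD sinD; simpc; rewrite [sin x * cos y + _]addrC. Qed.

Lemma h1sq_norm u a b da db : rep u a b da db -> h1sq a b da db = H1norm u ^+ 2.
Proof. by move=> ru; rewrite (H1normE ru) sqr_sqrtr// h1sq_ge0. Qed.

Lemma orbit_dist_le u0 w eta xi : orbit_dist u0 w <= H1norm (fun x => w x - orbit u0 eta xi x).
Proof.
apply: ge_inf; last by exists eta, xi.
by exists 0 => _ [s [y ->]]; exact: sqrtr_ge0.
Qed.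

Lemma orbit_dist_ge0 u0 w : 0 <= orbit_dist u0 w.
Proof.
apply: lb_le_inf; first by exists (H1norm (fun x => w x - cis 0 * u0 (x + 0))), 0, 0.
by move=> _ [s [y ->]]; exact: sqrtr_ge0.
Qed.

Lemma orbit_dist_lt u0 w (d : R) : orbit_dist u0 w < d ->
  exists eta xi, H1norm (fun x => w x - orbit u0 eta xi x) < d.
Proof.
move=> /inf_lt[|_ [eta [xi ->]] lt]; last by exists eta, xi.
by exists (H1norm (fun x => w x - cis 0 * u0 (x + 0))), 0, 0.
Qed.

(** The common symmetry taking w near U is an isometry of H^1; apply its inverse
    to the difference of the two functions. *)
Lemma orbit_dist_profile u0 w (eta0 xi0 eta xi : R) a0 b0 da0 db0 a b da db (e : R) :
  H1 u0 -> H1 w ->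
  rep (orbit u0 eta0 xi0) a0 b0 da0 db0 -> rep (orbit w eta xi) a b da db ->
  h1sq (fun x => a0 x - U x) (fun x => b0 x - 0) (fun x => da0 x - dU x) (fun x => db0 x - 0) < e ->
  h1sq (fun x => a x - U x) (fun x => b x - 0) (fun x => da x - dU x) (fun x => db x - 0) < e ->
  orbit_dist u0 w ^+ 2 < 4 * e.
Proof.
move=> Hu0 Hw r0 rw e0 ew.
pose eta' := eta0 - eta; pose xi' := xi0 - xi.
pose f x := w x - orbit u0 eta' xi' x.
have Hf : H1 f.
  have [a1 [b1 [da1 [db1 r1']]]] := H1_rep Hu0; have [a2 [b2 [da2 [db2 r2']]]] := H1_rep Hw.
  exact: rep_H1 (rep_B r2' (rep_orbit eta' xi' r1')).
have fE : orbit f eta xi = (fun x => orbit w eta xi x - orbit u0 eta0 xi0 x).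
  apply/funext => x; rewrite /orbit /f mulrBr /orbit mulrA cisD /eta' /xi'.
  by congr (_ - cis _ * u0 _); ring.
have [_ _ nE] := orbit_invariants k r1 cE rE eta xi Hf.
have rf := rep_B rw r0; rewrite -fE in rf.
have od := orbit_dist_le u0 w eta' xi'; rewrite -/f -nE in od.
have od0 := orbit_dist_ge0 u0 w.
have : orbit_dist u0 w ^+ 2 <= H1norm (orbit f eta xi) ^+ 2.
  by rewrite ler_sqr ?nnegrE// sqrtr_ge0.
rewrite -(h1sq_norm rf) => /le_lt_trans; apply.
have p0 := H1pairB (rep_pair r0) hU; have pw := H1pairB (rep_pair rw) hU.
have := h1sqB_le pw p0.
have sh (g h l : R -> R) : (fun x => g x - l x - (h x - l x)) = (fun x => g x - h x).
  by apply/funext => x; ring.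
by rewrite !sh => /le_lt_trans; apply; lra.
Qed.

Lemma pert_bound_ge1 N : 0 <= N -> 1 <= pert_bound k c r N.
Proof.
move=> N0; rewrite /pert_bound -!addrA lerDl addr_ge0// addr_ge0//.
  rewrite mulr_ge0 ?addr_ge0 ?invr_ge0// mulr_ge0 ?divr_ge0 ?sqr_ge0//.
  by rewrite mulr_ge0 ?powR_ge0//; move: r1; lra.
by rewrite mulr_ge0 ?(ltW k0)// !addr_ge0// mulr_ge0// sqr_ge0.
Qed.

(** Mass and energy are constant on the orbit of u0, so the constants of the
    perturbation estimates are the same for all its elements. *)
Lemma orbit_dist_invariants u0 (d1 : R) : H1 u0 -> 0 < d1 ->
  exists2 delta : R, 0 < delta & forall w, H1 w -> orbit_dist u0 w < delta ->
    `|mass w - mass u0| < d1 /\ `|energy k theta p w - energy k theta p u0| < d1.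
Proof.
move=> Hu0 d10; pose N := H1norm u0 ^+ 2; pose C := pert_bound k c r N.
have C0 : 0 < C by apply: lt_le_trans (pert_bound_ge1 (sqr_ge0 _)).
have [delta delta0 [t t0 small]] := pert_choice C0 d10.
exists delta => //.
move=> w Hw /orbit_dist_lt[eta [xi nd]].
have [a [b [da [db ru]]]] := H1_rep Hu0; have [a' [b' [da' [db' rw]]]] := H1_rep Hw.
have ro := rep_orbit eta xi ru; have rd := rep_B rw ro.
have [mE EE nE] := orbit_invariants k r1 cE rE eta xi Hu0.
have NE := h1sq_norm ro; rewrite nE -/N in NE.
have eE := h1sq_norm rd.
have [] := small _ (sqrtr_ge0 _) nd; rewrite -/(H1norm _) -eE => e1 {}small.
have mp := mass_pert c k0 r1 (rep_pair ro) (rep_pair rw) t0.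
have ep := energy_pert c k0 r1 (rep_pair ro) (rep_pair rw) t0 e1.
rewrite NE -/C in mp ep.
rewrite -mE -EE (massE rw) (massE ro) (energyE k cE rE rw) (energyE k cE rE ro).
by split; [exact: le_lt_trans mp small|exact: le_lt_trans ep small].
Qed.

(** u0 has the mass and at most the energy of the profile, so it too is close to
    the orbit of the profile, for every tolerance. *)
Lemma orbital_stability u0 : H1 u0 -> mass u0 = 2 * lambda ->
  energy k theta p u0 <= ground ->
  forall eps : R, 0 < eps -> exists2 delta : R, 0 < delta &
    forall z w, H1 z -> H1 w -> mass w = mass z -> energy k theta p w = energy k theta p z ->
      orbit_dist u0 z < delta -> orbit_dist u0 w < eps.
Proof.
move=> Hu0 mu0 Eu0 eps eps0.
have e0 : 0 < eps ^+ 2 / 4 by rewrite divr_gt0// exprn_gt0.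
have [d1 d10 close] := close_orbit e0.
have [delta delta0 inv] := orbit_dist_invariants Hu0 d10.
exists delta => // z w Hz Hw mzw Ezw od; have [mz Ez] := inv z Hz od.
have mw : `|mass w - 2 * lambda| < d1 by rewrite mzw -mu0.
have Ew : energy k theta p w < ground + d1.
  have [_] := ltr_normlP _ _ Ez; rewrite Ezw ltrBlDr => /lt_le_trans; apply.
  by rewrite addrC lerD2r.
have [eta [xi [a [b [da [db [rw ew]]]]]]] := close w Hw mw Ew.
have mu0' : `|mass u0 - 2 * lambda| < d1 by rewrite mu0 subrr normr0.
have Eu0' : energy k theta p u0 < ground + d1 by apply: le_lt_trans Eu0 _; rewrite ltrDl.
have [eta0 [xi0 [a0 [b0 [da0 [db0 [r0 eu]]]]]]] := close u0 Hu0 mu0' Eu0'.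
have := orbit_dist_profile Hu0 Hw r0 rw eu ew.
have -> : 4 * (eps ^+ 2 / 4) = eps ^+ 2 by field.
by rewrite ltr_sqr ?nnegrE ?orbit_dist_ge0 ?(ltW eps0).
Qed.

End Stability.

Local Open Scope complex_scope.

Theorem theorem4p8 (R : realType) (p k theta lambda : R) (u0 : R -> R[i]) :
  4 <= p -> p < 6 -> 0 < k -> 0 < theta -> 0 < lambda ->
  minimizers k theta p lambda u0 ->
  {ae @lebesgue_measure R, forall x, 0 < u0 x} ->
  forall eps : R, 0 < eps ->
  exists2 delta : R, 0 < delta &
    forall (z0 : R -> R[i]) (Tstar : \bar R) (z : R -> R -> R[i]),
      H1 z0 ->
      assumptionA k theta p z0 Tstar z ->
      orbit_dist u0 z0 < delta ->
      forall t : R, 0 <= t -> (t%:E < Tstar)%E ->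
        orbit_dist u0 (z t) < eps.
Proof.
move=> p4 p6 k0 theta0 lambda0 [[Hu0 mu0] Eu0] _ eps eps0.
pose r := p / 2 - 1; pose c := Num.sqrt (2 * theta / p).
have p0 : 0 < p by lra.
have c20 : 0 < 2 * theta / p by rewrite divr_gt0// mulr_gt0.
have c0 : 0 < c by rewrite sqrtr_gt0.
have r1 : 1 <= r by rewrite /r; lra.
have r2 : r < 2 by rewrite /r; lra.
have rE : r + 1 = p / 2 by rewrite /r; ring.
have cE : c ^+ 2 / 2 = theta / p by rewrite sqr_sqrtr ?ltW//; field; rewrite gt_eqF.
have [Q Q0 QL] := Lmass_surj k0 c0 r1 r2 lambda0.
have [U [rho pU]] := profile_exists k0 c0 r1 Q0.
have [mU EU] := profile_mass_energy k0 c0 r1 cE rE Q0 QL pU.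
have Em : energy k theta p u0 <= ground k c r lambda Q.
  rewrite -lee_fin Eu0 -EU; apply: ereal_inf_lbound; exists (fun x => (U x)%:C) => //.
  split; first exact: rep_H1 (profile_rep k0 c0 r1 Q0 pU).
  by rewrite mU mulKf.
have mu0' : mass u0 = 2 * lambda by rewrite -mu0 mulVKf.
have [delta delta0 H] := orbital_stability k0 c0 r1 r2 lambda0 cE rE Q0 QL pU Hu0 mu0' Em eps0.
exists delta => // z0 T z Hz0 [T0 [Hz _ _] mz Ez] od t t0 tT.
exact: (H z0 (z t) Hz0 (Hz t t0 tT) (mz t t0 tT) (Ez t t0 tT) od).
Qed.
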